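(* Let $p,q$ be nonnegative integers, let $\kappa_1,\dots,\kappa_p,\mu_1,\dots,\mu_q$ be complex numbers none of which is in $\{0,-1,-2,\dots\}$, let $\alpha,\beta\in\mathbb{C}$ with $\Re(\alpha)>0$, let $\lambda_2,\lambda_3\in\mathbb{C}$ with $\Re(\lambda_3)>\Re(\lambda_2)>0$, let $s\in\mathbb{C}$ with $\Re(s)>0$, and let $z\in\mathbb{C}$. Then the Mellin transform in $\rho$ of the M-confluent hypergeometric function is $$\int_0^\infty\rho^{s-1}\;{}^{M}\Phi_{p,q}^{(\alpha,\beta)}(\lambda_{2};\lambda_{3};z;\rho)\,d\rho =\frac{{}^{M}\Gamma_{p,q}^{(\alpha,\beta)}(s;0)\,B(\lambda_{2}+s,\lambda_{3}+s-\lambda_{2})}{B(\lambda_{2},\lambda_{3}-\lambda_{2})}\;\Phi(\lambda_{2}+s;\lambda_{3}+2s;z).$$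
   Context: $(\lambda)_m=\Gamma(\lambda+m)/\Gamma(\lambda)$, $(\lambda)_0=1$ is the Pochhammer symbol, $B(x,y)=\int_0^1 t^{x-1}(1-t)^{y-1}dt$ is the classical beta function, and $\Phi(\lambda_{2};\lambda_{3};z)=\sum_{n\ge0} \frac{(\lambda_2)_{n}}{(\lambda_3)_{n}}\frac{z^n}{n!}$ is the confluent hypergeometric function. The generalized M-series is $${}_{p}^{\alpha}M^{\beta}_{q}(\kappa_{1},\ldots,\kappa_{p};\mu_{1},\ldots,\mu_{q};z)=\sum_{m=0}^{\infty}\frac{(\kappa_{1})_{m}\cdots(\kappa_p)_{m}}{(\mu_1)_{m}\cdots(\mu_q)_{m}}\frac{z^{m}}{\Gamma(\alpha m+\beta)}.$$ With parameters $\kappa_1,\dots,\kappa_p;\mu_1,\dots,\mu_q$ suppressed from the notation, the modified gamma (M-gamma), modified beta (M-beta) and modified confluent hypergeometric (M-confluent hypergeometric) functions are $${}^{M}\Gamma_{p,q}^{(\alpha,\beta)}(x;\rho)=\int_{0}^{\infty}t^{x-1}\,{}_{p}^{\alpha}M^{\beta}_{q}\left(\kappa_{1},\ldots,\kappa_{p};\mu_{1},\ldots,\mu_{q};-t-\frac{\rho}{t}\right) dt,$$ $${}^{M}B_{p,q}^{(\alpha,\beta)}(x,y;\rho)=\int_{0}^{1}t^{x-1}(1-t)^{y-1}\,{}_{p}^{\alpha}M^{\beta}_{q}\left(\kappa_{1},\ldots,\kappa_{p};\mu_{1},\ldots,\mu_{q};\frac{-\rho}{t(1-t)}\right) dt,$$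 $${}^{M}\Phi_{p,q}^{(\alpha,\beta)}(\lambda_{2};\lambda_{3};z;\rho)=\sum_{n=0}^{\infty}\frac{{}^{M}B_{p,q}^{(\alpha,\beta)}(\lambda_{2}+n,\lambda_{3}-\lambda_{2};\rho)}{B(\lambda_{2},\lambda_{3}-\lambda_{2})}\frac{z^{n}}{n!}.$$ These functions are defined for those parameters and arguments for which the series and integrals converge. *)

(* Defs.v *)
From Stdlib Require Import Reals List ZArith.
From Coquelicot Require Import Coquelicot.
Open Scope C_scope.

(** Integrals over (0, oo) and (0, 1) of complex-valued functions of a real
    variable are improper Riemann integrals, the two end points being
    approached independently; they may converge conditionally.  The operators
    [RInt_gen], [CSeries] and everything built on them are total and only
    meaningful under the corresponding convergence predicates. *)

Definition RInt_0_oo (f : R -> C) : C :=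
  RInt_gen (V := C_R_CompleteNormedModule) f (at_right 0) (Rbar_locally p_infty).

Definition is_RInt_0_oo (f : R -> C) (l : C) : Prop :=
  is_RInt_gen (V := C_R_NormedModule) f (at_right 0) (Rbar_locally p_infty) l.

Definition ex_RInt_0_oo (f : R -> C) : Prop :=
  ex_RInt_gen (V := C_R_NormedModule) f (at_right 0) (Rbar_locally p_infty).

Definition RInt_0_1 (f : R -> C) : C :=
  RInt_gen (V := C_R_CompleteNormedModule) f (at_right 0) (at_left 1).

Definition ex_RInt_0_1 (f : R -> C) : Prop :=
  ex_RInt_gen (V := C_R_NormedModule) f (at_right 0) (at_left 1).

Definition CSeries (a : nat -> C) : C :=
  iota (T := C_CompleteNormedModule)
    (fun l : C => is_series (V := C_NormedModule) a l).

Definition ex_CSeries (a : nat -> C) : Prop :=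
  ex_series (V := C_NormedModule) a.

Definition Cexp (z : C) : C :=
  (exp (Re z) * cos (Im z), exp (Re z) * sin (Im z))%R.

(** Principal value of [t ^ x] for real [t > 0]. *)
Definition Rcpow (t : R) (x : C) : C := Cexp (x * RtoC (ln t)).

Definition Cprod (l : list C) : C := fold_right Cmult (RtoC 1) l.

(** Euler's integral, for [0 < Re z]. *)
Definition Gamma_integral (z : C) : C :=
  RInt_0_oo (fun t => Rcpow t (z - 1) * RtoC (exp (- t))).

(** Analytic continuation by [Gamma z = Gamma (z + n) / (z (z+1) ... (z+n-1))],
    where [n] is large enough for [0 < Re (z + n)] and is [0] when [0 < Re z].
    At the poles [0, -1, -2, ...] the denominator vanishes, and since
    [/ 0 = 0] both [Gamma z] and [/ Gamma z] are [0] there; the latter is the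
    value of the entire function 1/Gamma. *)
Definition Gamma_shift (z : C) : nat := Z.to_nat (up (- Re z)).

Definition Gamma (z : C) : C :=
  let n := Gamma_shift z in
  Gamma_integral (z + RtoC (INR n))
  / Cprod (map (fun k => z + RtoC (INR k)) (seq 0 n)).

Definition Pochhammer (a : C) (m : nat) : C :=
  match m with
  | O => RtoC 1
  | S _ => Gamma (a + RtoC (INR m)) / Gamma a
  end.

Definition Beta (x y : C) : C :=
  RInt_0_1 (fun t => Rcpow t (x - 1) * Rcpow (1 - t) (y - 1)).

Definition Phi (l2 l3 z : C) : C :=
  CSeries (fun n => Pochhammer l2 n / Pochhammer l3 n
                    * (z ^ n / RtoC (INR (fact n)))).

Definition nonpos_integer (a : C) : Prop :=
  exists n : nat, a = - RtoC (INR n).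

Definition Mseries_term (kappa mu : list C) (alpha beta z : C) (m : nat) : C :=
  Cprod (map (fun k => Pochhammer k m) kappa)
  / Cprod (map (fun k => Pochhammer k m) mu)
  * (z ^ m / Gamma (alpha * RtoC (INR m) + beta)).

Definition Mseries (kappa mu : list C) (alpha beta z : C) : C :=
  CSeries (Mseries_term kappa mu alpha beta z).

Definition Mseries_converges (kappa mu : list C) (alpha beta z : C) : Prop :=
  ex_CSeries (Mseries_term kappa mu alpha beta z).

Definition MGamma_arg (rho : C) (t : R) : C := - RtoC t - rho / RtoC t.

Definition MGamma_integrand (kappa mu : list C) (alpha beta x rho : C)
    (t : R) : C :=
  Rcpow t (x - 1) * Mseries kappa mu alpha beta (MGamma_arg rho t).

Definition MGamma (kappa mu : list C) (alpha beta x rho : C) : C :=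
  RInt_0_oo (MGamma_integrand kappa mu alpha beta x rho).

Definition MGamma_converges (kappa mu : list C) (alpha beta x rho : C) : Prop :=
  (forall t : R, (0 < t)%R ->
     Mseries_converges kappa mu alpha beta (MGamma_arg rho t)) /\
  ex_RInt_0_oo (MGamma_integrand kappa mu alpha beta x rho).

Definition MBeta_arg (rho : C) (t : R) : C := - rho / RtoC (t * (1 - t)).

Definition MBeta_integrand (kappa mu : list C) (alpha beta x y rho : C)
    (t : R) : C :=
  Rcpow t (x - 1) * Rcpow (1 - t) (y - 1)
  * Mseries kappa mu alpha beta (MBeta_arg rho t).

Definition MBeta (kappa mu : list C) (alpha beta x y rho : C) : C :=
  RInt_0_1 (MBeta_integrand kappa mu alpha beta x y rho).

Definition MBeta_converges (kappa mu : list C) (alpha beta x y rho : C) : Prop :=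
  (forall t : R, (0 < t < 1)%R ->
     Mseries_converges kappa mu alpha beta (MBeta_arg rho t)) /\
  ex_RInt_0_1 (MBeta_integrand kappa mu alpha beta x y rho).

Definition MPhi_term (kappa mu : list C) (alpha beta l2 l3 z rho : C)
    (n : nat) : C :=
  MBeta kappa mu alpha beta (l2 + RtoC (INR n)) (l3 - l2) rho
  / Beta l2 (l3 - l2) * (z ^ n / RtoC (INR (fact n))).

Definition MPhi (kappa mu : list C) (alpha beta l2 l3 z rho : C) : C :=
  CSeries (MPhi_term kappa mu alpha beta l2 l3 z rho).

Definition MPhi_converges (kappa mu : list C)
    (alpha beta l2 l3 z rho : C) : Prop :=
  (forall n : nat,
     MBeta_converges kappa mu alpha beta (l2 + RtoC (INR n)) (l3 - l2) rho) /\
  ex_CSeries (MPhi_term kappa mu alpha beta l2 l3 z rho).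

(* Main.v *)
Require Import Defs.
From Stdlib Require Import Reals List ZArith Lra Lia.
From Coquelicot Require Import Coquelicot.
Open Scope C_scope.
Set Bullet Behavior "Strict Subproofs".

(** Write [F u] for the M-series at [-u], [tau t = t (1 - t)], and let [G] be the
    primitive of [u^(s-1) F u] vanishing at [0], so that [G u] tends to the
    M-gamma value [L] as [u] tends to infinity.  Substituting [rho = u tau t]
    gives formally
    [int_a^b rho^(s-1) F (rho / tau t) drho = tau^s (G (b / tau t) - G (a / tau t))],
    which tends to [tau^s L] and leaves the beta integral of parameters
    [l2 + n + s] and [l3 - l2 + s].  The integrals over [t] may converge only
    conditionally, so absolute convergence cannot justify the exchange.  Instead,
    integration by parts near [t = 0] and [t = 1] against the bounded function
    [G (rho / tau t)] shows that they converge uniformly for [rho] in a compact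
    interval, with a bound linear in [n] that the factor [z^n / n!] absorbs.  The
    limits [a -> 0] and [b -> oo] are then controlled by
    [|G u| <= M min (1, u^(Re s))].  The resulting series of beta values is
    [Beta * Phi] because [Beta (X + 1) Y = X / (X + Y) Beta X Y] and because
    [Gamma], by which Pochhammer symbols divide, has no zero with [0 < Re a]. *)

(** The hypotheses give only pointwise convergence in [rho], so every uniform bound has to be
    produced from [G]. Two observations make this possible. M-gamma convergence at [rho = 0] makes
    the M-series converge at every negative real, so it is an everywhere convergent power series and
    [F] is continuous up to [u = 0]; together with the existence of the limit [L] this yields both
    halves of the bound on [G]. Moreover [t^n <= 1] on the unit interval, so all majorants can use
    exponents independent of [n]; only the coefficients produced by differentiating the kernel grow
    with [n]. The exchange is then a diagonal limit: one index [N] both cuts off the [t]-integral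
    and truncates the series, so a single uniform limit on a compact interval in [rho] treats both.
    The non-vanishing of gamma is obtained directly: comparison with real gamma integrals excludes
    zeros whose real part is large compared with the square of the imaginary part, and the
    functional equation would carry any zero of the right half-plane there. *)

Notation is_CRInt := (is_RInt (V := C_R_NormedModule)).
Notation is_Cderive := (is_derive (K := R_AbsRing) (V := C_R_NormedModule)).
Notation Ccontinuous := (continuous (U := C_UniformSpace)).

(* [ring] does not see through the carrier of [C_R_NormedModule]. *)
Ltac C_eq := match goal with |- @eq _ ?a ?b => change (@eq C a b) end.

(** * Calculus for complex-valued functions *)

(** The uniform structure of [C] is that of a product, with square balls; its equivalence with the
    modulus norm gives the epsilon form used throughout. This relational version is the one in which
    improper integrals are defined. *)
Lemma filterlimi_Cmod {T : Type} {F : (T -> Prop) -> Prop} {FF : Filter F}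
    (f : T -> C -> Prop) (l : C) :
  filterlimi f F (locally (T := C_UniformSpace) l) <->
  (forall eps : posreal, F (fun x => exists y, f x y /\ (Cmod (y - l) < eps)%R)).
Proof.
split.
- intros H eps.
  apply (H (fun y : C => (Cmod (y - l) < eps)%R)).
  apply (locally_le_locally_norm (V := C_R_NormedModule) l).
  exists eps; intros y Hy; unfold ball_norm in Hy.
  rewrite <- Cmod_norm in Hy; exact Hy.
- intros H P HP.
  destruct (locally_norm_le_locally (V := C_R_NormedModule) l P HP) as [eps He].
  unfold filtermapi, filtermap; refine (filter_imp _ _ _ (H eps)).
  intros x [y [Hy Hl]]; exists y; split; auto.
  apply He; unfold ball_norm; rewrite <- Cmod_norm; exact Hl.
Qed.

Lemma filterlim_Cmod {T : Type} {F : (T -> Prop) -> Prop} {FF : Filter F}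
    (f : T -> C) (l : C) :
  filterlim f F (locally (T := C_UniformSpace) l) <->
  (forall eps : posreal, F (fun x => (Cmod (f x - l) < eps)%R)).
Proof.
split.
- intros H eps.
  apply (H (fun y : C => (Cmod (y - l) < eps)%R)).
  apply (locally_le_locally_norm (V := C_R_NormedModule) l).
  exists eps; intros y Hy; unfold ball_norm in Hy.
  rewrite <- Cmod_norm in Hy; exact Hy.
- intros H P HP.
  destruct (locally_norm_le_locally (V := C_R_NormedModule) l P HP) as [eps He].
  unfold filtermapi, filtermap; refine (filter_imp _ _ _ (H eps)).
  intros x Hl.
  apply He; unfold ball_norm; rewrite <- Cmod_norm; exact Hl.
Qed.

Lemma filterlim_Cminus {T : Type} {F : (T -> Prop) -> Prop} {FF : Filter F}
    (f g : T -> C) (a b : C) :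
  filterlim f F (locally (T := C_UniformSpace) a) ->
  filterlim g F (locally (T := C_UniformSpace) b) ->
  filterlim (fun x => f x - g x) F (locally (T := C_UniformSpace) (a - b)).
Proof.
intros Ha Hb; apply filterlim_Cmod; intros eps.
generalize (filter_and _ _ (proj1 (filterlim_Cmod f a) Ha (pos_div_2 eps))
                           (proj1 (filterlim_Cmod g b) Hb (pos_div_2 eps))).
apply filter_imp; intros x [H1 H2].
replace (f x - g x - (a - b)) with ((f x - a) + - (g x - b)) by ring.
eapply Rle_lt_trans; [apply Cmod_triangle|].
rewrite Cmod_opp; simpl in H1, H2; lra.
Qed.

Lemma continuous_C {U : UniformSpace} (f : U -> C) (x : U) :
  Ccontinuous f x <->
  continuous (fun u => Re (f u)) x /\ continuous (fun u => Im (f u)) x.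
Proof.
split.
- intros H; split.
  + apply (continuous_comp f Re); auto.
    destruct (f x) as [a b]; apply continuous_fst.
  + apply (continuous_comp f Im); auto.
    destruct (f x) as [a b]; apply continuous_snd.
- intros [H1 H2]; apply filterlim_locally; intros eps.
  generalize (proj1 (filterlim_locally _ _) H1 eps).
  generalize (proj1 (filterlim_locally _ _) H2 eps).
  intros K2 K1; generalize (filter_and _ _ K1 K2); apply filter_imp.
  intros u [A B]; split; assumption.
Qed.

Lemma continuous_Cplus {U : UniformSpace} (f g : U -> C) (x : U) :
  Ccontinuous f x -> Ccontinuous g x -> Ccontinuous (fun u => f u + g u) x.
Proof.
intros [f1 f2]%continuous_C [g1 g2]%continuous_C; apply continuous_C; simpl; split.
- now apply (continuous_plus (fun u => Re (f u)) (fun u => Re (g u))).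
- now apply (continuous_plus (fun u => Im (f u)) (fun u => Im (g u))).
Qed.

Lemma continuous_Cmult {U : UniformSpace} (f g : U -> C) (x : U) :
  Ccontinuous f x -> Ccontinuous g x -> Ccontinuous (fun u => f u * g u) x.
Proof.
intros [f1 f2]%continuous_C [g1 g2]%continuous_C; apply continuous_C; split.
- apply (continuous_minus (fun u => (Re (f u) * Re (g u))%R)
           (fun u => (Im (f u) * Im (g u))%R)).
  + now apply (continuous_mult (fun u => Re (f u)) (fun u => Re (g u))).
  + now apply (continuous_mult (fun u => Im (f u)) (fun u => Im (g u))).
- apply (continuous_plus (fun u => (Re (f u) * Im (g u))%R)
           (fun u => (Im (f u) * Re (g u))%R)).
  + now apply (continuous_mult (fun u => Re (f u)) (fun u => Im (g u))).
  + now apply (continuous_mult (fun u => Im (f u)) (fun u => Re (g u))).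
Qed.

Lemma continuous_Cconst {U : UniformSpace} (c : C) (x : U) :
  Ccontinuous (fun _ => c) x.
Proof. apply continuous_const. Qed.

Lemma continuous_RtoC {U : UniformSpace} (f : U -> R) (x : U) :
  continuous f x -> Ccontinuous (fun u => RtoC (f u)) x.
Proof.
intros H; apply continuous_C; simpl; split; auto.
apply continuous_const.
Qed.

Lemma continuous_Cmod {U : UniformSpace} (f : U -> C) (x : U) :
  Ccontinuous f x -> continuous (fun u => Cmod (f u)) x.
Proof.
intros H.
apply (continuous_ext (fun u => norm (V := C_R_NormedModule) (f u))).
- intros u; now rewrite Cmod_norm.
- apply (continuous_comp f (norm (V := C_R_NormedModule))); auto.
  apply (filterlim_norm (V := C_R_NormedModule)).
Qed.

(** For the converse, [f] is reassembled as [Re f] times 1 plus [Im f] times [Ci], which reduces the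
    claim to real derivatives. *)
Lemma is_Cderive_iff (f : R -> C) (x : R) (l : C) :
  is_Cderive f x l <->
  is_derive (fun u => Re (f u)) x (Re l) /\ is_derive (fun u => Im (f u)) x (Im l).
Proof.
split.
- intros H; split.
  + apply (filterdiff_comp (V := C_R_NormedModule) (W := R_NormedModule) f Re _ Re H).
    apply (filterdiff_linear (U := C_R_NormedModule) (V := R_NormedModule) Re).
    apply (is_linear_fst (U := R_NormedModule) (V := R_NormedModule)).
  + apply (filterdiff_comp (V := C_R_NormedModule) (W := R_NormedModule) f Im _ Im H).
    apply (filterdiff_linear (U := C_R_NormedModule) (V := R_NormedModule) Im).
    apply (is_linear_snd (U := R_NormedModule) (V := R_NormedModule)).
- intros [H1 H2].
  generalize (is_derive_plus _ _ _ _ _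
    (is_derive_scal_l (V := C_R_NormedModule) _ _ _ (RtoC 1) H1)
    (is_derive_scal_l (V := C_R_NormedModule) _ _ _ Ci H2)).
  intros K; eapply is_derive_ext in K.
  + evar_last; [exact K|].
    destruct l as [a b]; unfold plus, scal; simpl; unfold prod_plus, prod_scal, scal, plus; simpl.
    unfold mult; simpl; f_equal; ring.
  + intros t; simpl. destruct (f t) as [a b].
    unfold plus, scal; simpl; unfold prod_plus, prod_scal, scal, plus; simpl.
    unfold mult; simpl; f_equal; ring.
Qed.

Lemma is_Cderive_mult (f g : R -> C) (x : R) (df dg : C) :
  is_Cderive f x df -> is_Cderive g x dg ->
  is_Cderive (fun t => f t * g t) x (df * g x + f x * dg).
Proof.
intros [f1 f2]%is_Cderive_iff [g1 g2]%is_Cderive_iff; apply is_Cderive_iff; split.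
- generalize (is_derive_minus _ _ _ _ _
    (is_derive_mult _ _ _ _ _ f1 g1 Rmult_comm) (is_derive_mult _ _ _ _ _ f2 g2 Rmult_comm)).
  intros K; evar_last; [exact K|].
  unfold minus, plus, opp, mult; simpl; unfold Re, Im; ring.
- generalize (is_derive_plus _ _ _ _ _
    (is_derive_mult _ _ _ _ _ f1 g2 Rmult_comm) (is_derive_mult _ _ _ _ _ f2 g1 Rmult_comm)).
  intros K; evar_last; [exact K|].
  unfold minus, plus, opp, mult; simpl; unfold Re, Im; ring.
Qed.

Lemma is_Cderive_RtoC (f : R -> R) (x l : R) :
  is_derive f x l -> is_Cderive (fun t => RtoC (f t)) x (RtoC l).
Proof.
intros H; apply is_Cderive_iff; simpl; split; auto.
apply (is_derive_const (V := R_NormedModule) 0%R).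
Qed.

Lemma is_Cderive_comp (f : R -> C) (g : R -> R) (x : R) (df : C) (dg : R) :
  is_Cderive f (g x) df -> is_derive g x dg ->
  is_Cderive (fun t => f (g t)) x (RtoC dg * df).
Proof.
intros Hf Hg; evar_last; [exact (is_derive_comp f g x df dg Hf Hg)|].
destruct df as [a b]; unfold scal, Cmult; simpl; unfold prod_scal, scal; simpl.
unfold mult; simpl; f_equal; ring.
Qed.

Lemma is_Cderive_continuous (f : R -> C) (x : R) (l : C) :
  is_Cderive f x l -> Ccontinuous f x.
Proof.
intros H; apply (ex_derive_continuous (V := C_R_NormedModule)); now exists l.
Qed.

Lemma is_CRInt_iff (f : R -> C) (a b : R) (l : C) :
  is_CRInt f a b l <->
  is_RInt (fun t => Re (f t)) a b (Re l) /\ is_RInt (fun t => Im (f t)) a b (Im l).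
Proof.
split.
- intros H; split.
  + exact (is_RInt_fct_extend_fst (U := R_NormedModule) (V := R_NormedModule) f a b l H).
  + exact (is_RInt_fct_extend_snd (U := R_NormedModule) (V := R_NormedModule) f a b l H).
- intros [H1 H2]; destruct l as [l1 l2].
  exact (is_RInt_fct_extend_pair (U := R_NormedModule) (V := R_NormedModule) f a b l1 l2 H1 H2).
Qed.

Lemma is_CRInt_Cmult (c : C) (f : R -> C) (a b : R) (l : C) :
  is_CRInt f a b l -> is_CRInt (fun t => c * f t) a b (c * l).
Proof.
intros [H1 H2]%is_CRInt_iff; apply is_CRInt_iff; split.
- exact (is_RInt_minus _ _ _ _ _ _ (is_RInt_scal _ _ _ (Re c) _ H1) (is_RInt_scal _ _ _ (Im c) _ H2)).
- exact (is_RInt_plus _ _ _ _ _ _ (is_RInt_scal _ _ _ (Re c) _ H2) (is_RInt_scal _ _ _ (Im c) _ H1)).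
Qed.

Lemma ex_CRInt_continuous (f : R -> C) (a b : R) :
  (a <= b)%R -> (forall t, (a <= t <= b)%R -> Ccontinuous f t) ->
  exists l, is_CRInt f a b l.
Proof.
intros Hab H; apply (ex_RInt_continuous (V := C_R_CompleteNormedModule)).
rewrite Rmin_left, Rmax_right; auto.
Qed.

Lemma is_CRInt_derive (f df : R -> C) (a b : R) :
  (a <= b)%R ->
  (forall t, (a <= t <= b)%R -> is_Cderive f t (df t)) ->
  (forall t, (a <= t <= b)%R -> Ccontinuous df t) ->
  is_CRInt df a b (f b - f a).
Proof.
intros Hab H1 H2; apply (is_RInt_derive (V := C_R_CompleteNormedModule) f df);
rewrite Rmin_left, Rmax_right; auto.
Qed.

Lemma Cmod_CRInt_le (f : R -> C) (g : R -> R) (a b : R) (l : C) (lg : R) :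
  (a <= b)%R -> (forall t, (a <= t <= b)%R -> (Cmod (f t) <= g t)%R) ->
  is_CRInt f a b l -> is_RInt g a b lg -> (Cmod l <= lg)%R.
Proof.
intros Hab H Hf Hg; rewrite Cmod_norm.
apply (norm_RInt_le (V := C_R_NormedModule) f g a b l lg); auto.
intros t Ht; rewrite <- Cmod_norm; auto.
Qed.

(** The majorants used below have elementary primitives [H], so an estimate of an integral becomes
    an increment of [H], and its behaviour at an end point a limit of [H]. *)
Lemma Cmod_CRInt_le_primitive (f : R -> C) (g H : R -> R) (a b : R) (l : C) :
  (a <= b)%R -> (forall t, (a <= t <= b)%R -> (Cmod (f t) <= g t)%R) ->
  (forall t, (a <= t <= b)%R -> is_derive H t (g t)) ->
  (forall t, (a <= t <= b)%R -> continuous g t) ->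
  is_CRInt f a b l -> (Cmod l <= H b - H a)%R.
Proof.
intros Hab Hfg HH Hg Hf; apply (Cmod_CRInt_le f g a b l); auto.
apply (is_RInt_derive (V := R_CompleteNormedModule) H g);
rewrite Rmin_left, Rmax_right; auto.
Qed.

Lemma is_CRInt_ext (f g : R -> C) (a b : R) (l : C) :
  (a <= b)%R -> (forall t, (a < t < b)%R -> f t = g t) ->
  is_CRInt f a b l -> is_CRInt g a b l.
Proof.
intros Hab H; apply is_RInt_ext; rewrite Rmin_left, Rmax_right; auto.
Qed.

Lemma is_CRInt_unique (f : R -> C) (a b : R) (l l' : C) :
  is_CRInt f a b l -> is_CRInt f a b l' -> l = l'.
Proof.
intros H H'; rewrite <- (is_RInt_unique (V := C_R_CompleteNormedModule) f a b l H).
apply (is_RInt_unique (V := C_R_CompleteNormedModule)); exact H'.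
Qed.

(** * Complex powers of a positive real *)

Lemma Cexp_plus (a b : C) : Cexp (a + b) = Cexp a * Cexp b.
Proof.
unfold Cexp, Cmult; simpl; rewrite exp_plus, cos_plus, sin_plus; unfold Re, Im; f_equal; ring.
Qed.

Lemma Cmod_Cexp (a : C) : Cmod (Cexp a) = exp (Re a).
Proof.
unfold Cmod, Cexp; simpl.
replace (_ + _)%R with (exp (Re a) * exp (Re a))%R.
- apply sqrt_square; left; apply exp_pos.
- generalize (sin2_cos2 (Im a)); unfold Rsqr; intros H.
  transitivity (exp (Re a) * exp (Re a) * (sin (Im a) * sin (Im a) + cos (Im a) * cos (Im a)))%R.
  + rewrite H; ring.
  + ring.
Qed.

Lemma Cmod_Rcpow (t : R) (a : C) : Cmod (Rcpow t a) = Rpower t (Re a).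
Proof.
unfold Rcpow; rewrite Cmod_Cexp; unfold Rpower; f_equal.
destruct a; simpl; ring.
Qed.

Lemma Rcpow_plus (t : R) (a b : C) : Rcpow t (a + b) = Rcpow t a * Rcpow t b.
Proof. unfold Rcpow; rewrite <- Cexp_plus; f_equal; ring. Qed.

Lemma Rcpow_mult_distr (t u : R) (a : C) :
  (0 < t)%R -> (0 < u)%R -> Rcpow (t * u) a = Rcpow t a * Rcpow u a.
Proof.
intros Ht Hu; unfold Rcpow; rewrite <- Cexp_plus, ln_mult, RtoC_plus by assumption.
f_equal; ring.
Qed.

Lemma Rcpow_RtoC (t r : R) : (0 < t)%R -> Rcpow t (RtoC r) = RtoC (Rpower t r).
Proof.
intros Ht; unfold Rcpow, Cexp, Rpower; rewrite <- RtoC_mult; unfold RtoC; simpl.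
rewrite cos_0, sin_0, Rmult_1_r, Rmult_0_r; reflexivity.
Qed.

Lemma Rcpow_1 (t : R) : (0 < t)%R -> Rcpow t 1 = RtoC t.
Proof. intros Ht; rewrite Rcpow_RtoC, Rpower_1; auto. Qed.

Lemma Rcpow_S (t : R) (a : C) : (0 < t)%R -> Rcpow t (a + 1) = Rcpow t a * t.
Proof. intros Ht; rewrite Rcpow_plus, Rcpow_1; auto. Qed.

Lemma Rcpow_components (t : R) (a : C) :
  Rcpow t a = (exp (Re a * ln t) * cos (Im a * ln t),
               exp (Re a * ln t) * sin (Im a * ln t))%R.
Proof.
unfold Rcpow, Cexp.
replace (Re (a * RtoC (ln t))) with (Re a * ln t)%R by (simpl; unfold Re, Im; ring).
replace (Im (a * RtoC (ln t))) with (Im a * ln t)%R by (simpl; unfold Re, Im; ring).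
reflexivity.
Qed.

Lemma is_Cderive_Rcpow (a : C) (t : R) :
  (0 < t)%R -> is_Cderive (fun u => Rcpow u a) t (a * Rcpow t (a - 1)).
Proof.
intros Ht.
replace (a * Rcpow t (a - 1)) with (RtoC (/ t) * (a * Rcpow t a)).
2:{ replace (Rcpow t a) with (Rcpow t (a - 1 + 1)) by (f_equal; ring).
    rewrite Rcpow_S, RtoC_inv by (assumption || lra); field.
    intros K; apply (f_equal Re) in K; simpl in K; lra. }
apply is_Cderive_iff; split.
- apply (is_derive_ext (fun u => exp (Re a * ln u) * cos (Im a * ln u))%R).
  + intros u; rewrite Rcpow_components; reflexivity.
  + rewrite Rcpow_components; simpl; auto_derive; [auto|]; unfold Re, Im; field; lra.
- apply (is_derive_ext (fun u => exp (Re a * ln u) * sin (Im a * ln u))%R).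
  + intros u; rewrite Rcpow_components; reflexivity.
  + rewrite Rcpow_components; simpl; auto_derive; [auto|]; unfold Re, Im; field; lra.
Qed.

Lemma continuous_Rcpow {U : UniformSpace} (a : C) (f : U -> R) (x : U) :
  (0 < f x)%R -> continuous f x -> Ccontinuous (fun u => Rcpow (f u) a) x.
Proof.
intros Hx Hf; apply (continuous_comp f (fun t => Rcpow t a)); auto.
eapply is_Cderive_continuous, is_Cderive_Rcpow; auto.
Qed.

(** * Improper integrals through primitives *)

Definition interval_like (D : R -> Prop) : Prop :=
  forall a b t : R, D a -> D b -> (a <= t <= b)%R -> D t.

(** Stated by integrals rather than by derivatives: convergence of the improper integral then
    becomes the existence of limits of [G] at the two ends. *)
Definition is_primitive_on (D : R -> Prop) (f G : R -> C) : Prop :=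
  forall a b : R, D a -> D b -> is_CRInt f a b (G b - G a).

Lemma ex_primitive_on (D : R -> Prop) (f : R -> C) (c : R) :
  interval_like D -> D c -> (forall t, D t -> Ccontinuous f t) ->
  exists G, is_primitive_on D f G /\ G c = RtoC 0.
Proof.
intros HD Hc Hf.
assert (Hex : forall a b, D a -> D b -> ex_RInt (V := C_R_NormedModule) f a b).
{ intros a b Ha Hb; apply (ex_RInt_continuous (V := C_R_CompleteNormedModule)).
  intros t Ht; apply Hf; revert Ht; unfold Rmin, Rmax.
  destruct (Rle_dec a b); intros Ht; [apply (HD a b)|apply (HD b a)]; auto. }
exists (fun v => RInt (V := C_R_CompleteNormedModule) f c v); split.
- intros a b Ha Hb.
  assert (Ka := RInt_correct (V := C_R_CompleteNormedModule) f c a (Hex c a Hc Ha)).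
  assert (Kb := RInt_correct (V := C_R_CompleteNormedModule) f c b (Hex c b Hc Hb)).
  generalize (is_RInt_Chasles (V := C_R_NormedModule) f a c b _ _
                (is_RInt_swap (V := C_R_NormedModule) f _ _ _ Ka) Kb).
  intros K; evar_last; [exact K|].
  change (- RInt (V := C_R_CompleteNormedModule) f c a
          + RInt (V := C_R_CompleteNormedModule) f c b
          = RInt (V := C_R_CompleteNormedModule) f c b
            - RInt (V := C_R_CompleteNormedModule) f c a).
  ring.
- exact (RInt_point (V := C_R_CompleteNormedModule) c f).
Qed.

Lemma is_primitive_on_derive (D : R -> Prop) (f G : R -> C) (v : R) :
  is_primitive_on D f G -> locally v D -> Ccontinuous f v -> is_Cderive G v (f v).
Proof.
intros HG HD Hf.
assert (Hv := locally_singleton v D HD).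
apply (is_derive_ext (fun u => plus (G v) (G u - G v : C_R_NormedModule))).
- intros t; unfold plus; simpl.
  change (G v + (G t - G v) = G t); ring.
- replace (f v) with (plus (zero : C_R_NormedModule) (f v)) by apply plus_zero_l.
  apply (is_derive_plus (V := C_R_NormedModule)).
  + apply (is_derive_const (V := C_R_NormedModule)).
  + apply (is_derive_RInt (V := C_R_NormedModule) f (fun u => G u - G v) v v); auto.
    generalize HD; apply filter_imp; intros b Hb; apply HG; auto.
Qed.

(** Cauchy criterion: since [H] has a limit its increments become small, and they dominate those of
    [G]. *)
Lemma filterlim_Cmajorized {F : (R -> Prop) -> Prop} {FF : ProperFilter F}
    (D : R -> Prop) (G : R -> C) (H : R -> R) (l : R) :
  F D -> (forall a b, D a -> D b -> (a <= b)%R -> (Cmod (G b - G a) <= H b - H a)%R) ->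
  filterlim H F (locally l) ->
  exists l', filterlim G F (locally (T := C_UniformSpace) l').
Proof.
intros HF HG Hl.
apply (filterlim_locally_cauchy (U := C_R_CompleteNormedModule) (F := F)).
intros eps.
exists (fun x => D x /\ (Rabs (H x - l) < eps / 2)%R); split.
- apply filter_and; auto.
  exact (proj1 (filterlim_locally H l) Hl (pos_div_2 eps)).
- intros u v [Du Hu] [Dv Hv].
  apply (C_NormedModule_mixin_compat1 (G u) (G v) eps).
  change (Cmod (G v - G u) < eps)%R.
  assert (K : (Cmod (G v - G u) <= Rabs (H v - H u))%R).
  { destruct (Rle_dec u v) as [L|L].
    - eapply Rle_trans; [apply HG; auto|apply Rle_abs].
    - rewrite <- Cmod_opp, <- Rabs_Ropp.
      replace (- (G v - G u)) with (G u - G v) by ring.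
      replace (- (H v - H u))%R with (H u - H v)%R by ring.
      eapply Rle_trans; [apply HG; auto; lra|apply Rle_abs]. }
  apply Rle_lt_trans with (1 := K).
  apply Rabs_def2 in Hu; apply Rabs_def2 in Hv; apply Rabs_def1; lra.
Qed.

Lemma is_RInt_gen_primitive {Fa Fb : (R -> Prop) -> Prop}
    {FFa : Filter Fa} {FFb : Filter Fb} (D : R -> Prop) (f G : R -> C) (la lb : C) :
  is_primitive_on D f G -> Fa D -> Fb D ->
  filterlim G Fa (locally (T := C_UniformSpace) la) ->
  filterlim G Fb (locally (T := C_UniformSpace) lb) ->
  is_RInt_gen (V := C_R_NormedModule) f Fa Fb (lb - la).
Proof.
intros HG Da Db Ha Hb; apply filterlimi_Cmod; intros eps.
assert (Ka := proj1 (filterlim_Cmod G la) Ha (pos_div_2 eps)).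
assert (Kb := proj1 (filterlim_Cmod G lb) Hb (pos_div_2 eps)).
exists (fun a => D a /\ (Cmod (G a - la) < eps / 2)%R)
       (fun b => D b /\ (Cmod (G b - lb) < eps / 2)%R).
- apply filter_and; assumption.
- apply filter_and; assumption.
- intros a b [Ha1 Ha2] [Hb1 Hb2]; exists (G b - G a); split; [apply HG; assumption|].
  replace (G b - G a - (lb - la)) with ((G b - lb) + - (G a - la)) by ring.
  eapply Rle_lt_trans; [apply Cmod_triangle|].
  rewrite Cmod_opp; lra.
Qed.

(** The hypothesis is one joint limit in both end points. Freezing one of them at an admissible
    value shows that [G] is Cauchy along the filter of the other, so the two limits exist
    separately. *)
Lemma primitive_limits {Fa Fb : (R -> Prop) -> Prop}
    {FFa : ProperFilter Fa} {FFb : ProperFilter Fb} (D : R -> Prop) (f G : R -> C) (l : C) :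
  is_primitive_on D f G -> Fa D -> Fb D ->
  is_RInt_gen (V := C_R_NormedModule) f Fa Fb l ->
  exists la lb, filterlim G Fa (locally (T := C_UniformSpace) la) /\
    filterlim G Fb (locally (T := C_UniformSpace) lb) /\ l = lb - la.
Proof.
intros HG Da Db Hl.
assert (HC : forall eps : posreal, exists Q S : R -> Prop, Fa Q /\ Fb S /\
   forall a b, Q a -> S b -> (Cmod (G b - G a - l) < eps)%R).
{ intros eps.
  destruct (proj1 (filterlimi_Cmod _ _) Hl eps) as [Q S HQ HS K].
  exists (fun a => D a /\ Q a), (fun b => D b /\ S b).
  repeat split; try (apply filter_and; assumption).
  intros a b [Da' Qa] [Db' Sb].
  destruct (K a b Qa Sb) as [y [Hy1 Hy2]].
  rewrite (is_CRInt_unique _ _ _ _ _ (HG a b Da' Db') Hy1); exact Hy2. }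
assert (La : exists la, filterlim G Fa (locally (T := C_UniformSpace) la)).
{ apply (filterlim_locally_cauchy (U := C_R_CompleteNormedModule) (F := Fa)).
  intros eps; destruct (HC (pos_div_2 eps)) as [Q [S [HQ [HS K]]]].
  exists Q; split; auto.
  destruct (filter_ex S HS) as [b Sb].
  intros u v Qu Qv; apply (C_NormedModule_mixin_compat1 (G u) (G v) eps).
  change (Cmod (G v - G u) < eps)%R.
  replace (G v - G u) with ((G b - G u - l) + - (G b - G v - l)) by ring.
  eapply Rle_lt_trans; [apply Cmod_triangle|]; rewrite Cmod_opp.
  generalize (K u b Qu Sb) (K v b Qv Sb); simpl; lra. }
assert (Lb : exists lb, filterlim G Fb (locally (T := C_UniformSpace) lb)).
{ apply (filterlim_locally_cauchy (U := C_R_CompleteNormedModule) (F := Fb)).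
  intros eps; destruct (HC (pos_div_2 eps)) as [Q [S [HQ [HS K]]]].
  exists S; split; auto.
  destruct (filter_ex Q HQ) as [a Qa].
  intros u v Su Sv; apply (C_NormedModule_mixin_compat1 (G u) (G v) eps).
  change (Cmod (G v - G u) < eps)%R.
  replace (G v - G u) with ((G v - G a - l) + - (G u - G a - l)) by ring.
  eapply Rle_lt_trans; [apply Cmod_triangle|]; rewrite Cmod_opp.
  generalize (K a u Qa Su) (K a v Qa Sv); simpl; lra. }
destruct La as [la Ha], Lb as [lb Hb]; exists la, lb; repeat split; auto.
assert (K := is_RInt_gen_primitive D f G la lb HG Da Db Ha Hb).
rewrite <- (is_RInt_gen_unique (V := C_R_CompleteNormedModule) f l Hl).
exact (is_RInt_gen_unique (V := C_R_CompleteNormedModule) f (lb - la) K).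
Qed.

Lemma Cmod_limit_le {T : Type} {F : (T -> Prop) -> Prop} {FF : ProperFilter F}
    (G : T -> C) (l w : C) (B : R) :
  filterlim G F (locally (T := C_UniformSpace) l) ->
  F (fun x => (Cmod (G x - w) <= B)%R) -> (Cmod (l - w) <= B)%R.
Proof.
intros Hl HB; apply le_epsilon; intros e He.
destruct (filter_ex _ (filter_and _ _ HB (proj1 (filterlim_Cmod G l) Hl (mkposreal e He))))
  as [x [H1 H2]]; simpl in H2.
replace (l - w) with ((G x - w) + - (G x - l)) by ring.
eapply Rle_trans; [apply Cmod_triangle|]; rewrite Cmod_opp; lra.
Qed.

Lemma is_RInt_gen_Cmult {Fa Fb : (R -> Prop) -> Prop}
    {FFa : Filter Fa} {FFb : Filter Fb} (c : C) (f : R -> C) (l : C) :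
  is_RInt_gen (V := C_R_NormedModule) f Fa Fb l ->
  is_RInt_gen (V := C_R_NormedModule) (fun t => c * f t) Fa Fb (c * l).
Proof.
intros H P HP.
assert (K : locally (T := C_UniformSpace) l (fun y => P (c * y))).
{ apply (continuous_Cmult (U := C_UniformSpace) (fun _ => c) (fun y => y) l); auto.
  - apply continuous_Cconst.
  - apply continuous_id. }
generalize (H _ K); unfold filtermapi; apply filter_imp.
intros [a b] [y [H1 H2]]; exists (c * y); split; auto.
now apply is_CRInt_Cmult.
Qed.

(** * The beta kernel *)

Definition unit_interval (t : R) : Prop := (0 < t < 1)%R.

Lemma unit_interval_like : interval_like unit_interval.
Proof. intros a b t [Ha _] [_ Hb] Ht; unfold unit_interval; lra. Qed.

Lemma unit_interval_at_right : at_right 0 unit_interval.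
Proof.
exists (mkposreal 1 Rlt_0_1); intros t Ht Ht0; unfold unit_interval.
apply Rabs_def2 in Ht; unfold minus, plus, opp in Ht; simpl in Ht; lra.
Qed.

Lemma unit_interval_at_left : at_left 1 unit_interval.
Proof.
exists (mkposreal 1 Rlt_0_1); intros t Ht Ht0; unfold unit_interval.
apply Rabs_def2 in Ht; unfold minus, plus, opp in Ht; simpl in Ht; lra.
Qed.

Lemma unit_interval_open (t : R) : unit_interval t -> locally t unit_interval.
Proof.
intros [H0 H1]; apply filter_and; [apply open_gt|apply open_lt]; assumption.
Qed.

Definition beta_kernel (X Y : C) (t : R) : C := Rcpow t (X - 1) * Rcpow (1 - t) (Y - 1).

Definition beta_majorant (p q t : R) : R :=
  (Rpower t (p - 1) * Rpower (1 - t) (q - 1))%R.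

Lemma Cmod_beta_kernel (X Y : C) (t : R) :
  Cmod (beta_kernel X Y t) = beta_majorant (Re X) (Re Y) t.
Proof.
unfold beta_kernel, beta_majorant; rewrite Cmod_mult, !Cmod_Rcpow.
f_equal; f_equal; simpl; unfold Re; ring.
Qed.

Lemma Rpower_decr_exponent (t a b : R) :
  (0 < t < 1)%R -> (a <= b)%R -> (Rpower t b <= Rpower t a)%R.
Proof.
intros Ht Hab; unfold Rpower.
assert (ln t <= 0)%R by (rewrite <- ln_1; apply ln_le; lra).
destruct (Req_dec (b * ln t) (a * ln t)) as [E|E]; [rewrite E; lra|].
left; apply exp_increasing; nra.
Qed.

Lemma Rpower_pos (t a : R) : (0 < Rpower t a)%R.
Proof. apply exp_pos. Qed.

Lemma Rpower_le_1 (t a : R) : (0 < t < 1)%R -> (0 <= a)%R -> (Rpower t a <= 1)%R.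
Proof.
intros Ht Ha; rewrite <- (Rpower_O t) by lra; now apply Rpower_decr_exponent.
Qed.

Lemma beta_majorant_pos (p q t : R) : (0 < beta_majorant p q t)%R.
Proof. apply Rmult_lt_0_compat; apply Rpower_pos. Qed.

(** This is how bounds for the parameter [x + n] become independent of [n]. *)
Lemma beta_majorant_decr (p q p' q' t : R) :
  (0 < t < 1)%R -> (p <= p')%R -> (q <= q')%R ->
  (beta_majorant p' q' t <= beta_majorant p q t)%R.
Proof.
intros Ht Hp Hq; apply Rmult_le_compat; try (left; apply Rpower_pos);
apply Rpower_decr_exponent; lra.
Qed.

(** The exponent splits as [(p + 1) + (q + 1)]: for [/ 2 <= u < 1] the power [Rpower u (r - 1)] is
    at most [2^(r + 1)], whatever the sign of [r - 1]. Both factors are at least 1, so their product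
    serves on either half of the interval. *)
Definition beta_const (p q : R) : R := Rpower 2 (p + q + 2).

(* On each half of the unit interval one factor of the kernel is bounded. *)
Lemma beta_majorant_le (p q t : R) :
  (0 < p)%R -> (0 < q)%R -> (0 < t < 1)%R ->
  (beta_majorant p q t
   <= beta_const p q * (Rpower t (p - 1) + Rpower (1 - t) (q - 1)))%R.
Proof.
intros Hp Hq Ht.
assert (Haux : forall u r, (/ 2 <= u < 1)%R -> (0 < r)%R ->
          (Rpower u (r - 1) <= Rpower 2 (r + 1))%R).
{ intros u r Hu Hr; unfold Rpower.
  assert (L1 : (ln u <= 0)%R) by (rewrite <- ln_1; apply ln_le; lra).
  assert (L2 : (- ln 2 <= ln u)%R) by (rewrite <- ln_Rinv by lra; apply ln_le; lra).
  assert (L3 : (0 < ln 2)%R) by (rewrite <- ln_1; apply ln_increasing; lra).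
  assert (L4 : ((r - 1) * ln u <= (r + 1) * ln 2)%R) by (destruct (Rle_dec r 1); nra).
  destruct L4 as [L4|L4]; [left; now apply exp_increasing|rewrite L4; lra]. }
assert (B1 : (1 <= Rpower 2 (p + 1))%R).
{ apply Rle_trans with (Rpower 2 0); [rewrite Rpower_O; lra|apply Rle_Rpower; lra]. }
assert (B2 : (1 <= Rpower 2 (q + 1))%R).
{ apply Rle_trans with (Rpower 2 0); [rewrite Rpower_O; lra|apply Rle_Rpower; lra]. }
assert (E : beta_const p q = (Rpower 2 (p + 1) * Rpower 2 (q + 1))%R).
{ unfold beta_const; rewrite <- Rpower_plus; f_equal; ring. }
unfold beta_majorant; rewrite E.
assert (P1 := Rpower_pos t (p - 1)); assert (P2 := Rpower_pos (1 - t) (q - 1)).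
set (a := Rpower t (p - 1)) in *; set (b := Rpower (1 - t) (q - 1)) in *.
set (A := Rpower 2 (p + 1)) in *; set (B := Rpower 2 (q + 1)) in *.
assert (M : forall u v w, (0 <= u)%R -> (v <= w)%R -> (u * v <= u * w)%R)
  by (intros; apply Rmult_le_compat_l; auto).
destruct (Rle_dec t (/ 2)) as [H|H].
- assert (K : (b <= B)%R) by (apply Haux; lra).
  assert (a * b <= a * B)%R by (apply M; lra).
  assert (a * B * 1 <= a * B * A)%R by (apply M; nra).
  assert (0 < A * B * b)%R by (repeat apply Rmult_lt_0_compat; lra).
  nra.
- assert (K : (a <= A)%R) by (apply Haux; lra).
  assert (b * a <= b * A)%R by (apply M; lra).
  assert (b * A * 1 <= b * A * B)%R by (apply M; nra).
  assert (0 < A * B * a)%R by (repeat apply Rmult_lt_0_compat; lra).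
  nra.
Qed.

(** Primitive of the majorant in which the two end points have been separated. It replaces the
    incomplete beta function by an elementary expression with finite limits at 0 and 1. *)
Definition beta_primitive (p q t : R) : R :=
  (beta_const p q * (Rpower t p / p - Rpower (1 - t) q / q))%R.

Lemma is_derive_Rpower (a t : R) :
  (0 < t)%R -> is_derive (fun u => Rpower u a) t (a * Rpower t (a - 1))%R.
Proof.
intros Ht; unfold Rpower; evar_last.
- auto_derive; [assumption|reflexivity].
- replace (a * ln t)%R with ((a - 1) * ln t + ln t)%R at 1 by ring.
  rewrite exp_plus, exp_ln by assumption; field; lra.
Qed.

Lemma is_derive_beta_primitive (p q t : R) :
  (0 < p)%R -> (0 < q)%R -> (0 < t < 1)%R ->
  is_derive (beta_primitive p q) t
    (beta_const p q * (Rpower t (p - 1) + Rpower (1 - t) (q - 1)))%R.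
Proof.
intros Hp Hq Ht; unfold beta_primitive.
assert (D1 := is_derive_Rpower p t (proj1 Ht)).
assert (D2 : is_derive (fun u => Rpower (1 - u) q) t (- (q * Rpower (1 - t) (q - 1)))%R).
{ evar_last.
  - apply (is_derive_comp (fun u => Rpower u q) (fun u => 1 - u)%R).
    + apply is_derive_Rpower; lra.
    + auto_derive; auto.
  - unfold scal; simpl; unfold mult; simpl; ring. }
evar_last.
- apply is_derive_scal, @is_derive_minus.
  + apply (is_derive_ext (fun u => / p * Rpower u p)%R); [intros u; apply Rmult_comm|].
    apply is_derive_scal, D1.
  + apply (is_derive_ext (fun u => / q * Rpower (1 - u) q)%R); [intros u; apply Rmult_comm|].
    apply is_derive_scal, D2.
- unfold minus, plus, opp; simpl; field; lra.
Qed.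

Lemma continuous_Rpower {U : UniformSpace} (a : R) (f : U -> R) (x : U) :
  (0 < f x)%R -> continuous f x -> continuous (fun u => Rpower (f u) a) x.
Proof.
intros Hx Hf; apply (continuous_comp f (fun t => Rpower t a)); auto.
apply (ex_derive_continuous (V := R_NormedModule)).
eexists; apply is_derive_Rpower; auto.
Qed.

Lemma continuous_1_minus (t : R) : continuous (fun u : R => (1 - u)%R) t.
Proof. apply (continuous_minus (fun _ => 1%R) (fun u => u)); [apply continuous_const|apply continuous_id]. Qed.

Lemma continuous_beta_bound (p q t : R) :
  (0 < t < 1)%R ->
  continuous (fun u => beta_const p q * (Rpower u (p - 1) + Rpower (1 - u) (q - 1)))%R t.
Proof.
intros Ht; apply (continuous_mult (fun _ => beta_const p q)); [apply continuous_const|].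
apply (continuous_plus (fun u => Rpower u (p - 1)) (fun u => Rpower (1 - u) (q - 1))).
- apply continuous_Rpower; [lra|apply continuous_id].
- apply continuous_Rpower; [lra|apply continuous_1_minus].
Qed.

Lemma beta_const_pos (p q : R) : (0 < beta_const p q)%R.
Proof. apply Rpower_pos. Qed.

Lemma Cmod_CRInt_beta (f : R -> C) (p q A a b : R) (l : C) :
  (0 < p)%R -> (0 < q)%R -> (0 <= A)%R -> (0 < a)%R -> (a <= b)%R -> (b < 1)%R ->
  (forall t, (a <= t <= b)%R -> (Cmod (f t) <= A * beta_majorant p q t)%R) ->
  is_CRInt f a b l ->
  (Cmod l <= A * (beta_primitive p q b - beta_primitive p q a))%R.
Proof.
intros Hp Hq HA Ha Hab Hb Hf Hl.
rewrite Rmult_minus_distr_l.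
apply (Cmod_CRInt_le_primitive f
  (fun t => A * (beta_const p q * (Rpower t (p - 1) + Rpower (1 - t) (q - 1))))%R
  (fun t => A * beta_primitive p q t)%R a b l); auto.
- intros t Ht; eapply Rle_trans; [apply Hf, Ht|].
  apply Rmult_le_compat_l; auto; apply beta_majorant_le; lra.
- intros t Ht; apply is_derive_scal, is_derive_beta_primitive; lra.
- intros t Ht; apply (continuous_mult (fun _ => A)); [apply continuous_const|].
  apply continuous_beta_bound; lra.
Qed.

(** The two bounds are the limits at 0 and at 1, so the mass of the majorant near an end point is
    controlled by the distance to one of them. *)
Lemma beta_primitive_bounds (p q t : R) :
  (0 < p)%R -> (0 < q)%R -> (0 < t < 1)%R ->
  (- (beta_const p q / q) < beta_primitive p q t < beta_const p q / p)%R.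
Proof.
intros Hp Hq Ht; unfold beta_primitive, Rdiv.
assert (K := beta_const_pos p q).
assert (P1 := Rpower_pos t p); assert (P2 := Rpower_pos (1 - t) q).
assert (Q1 : (Rpower t p <= 1)%R) by (apply Rpower_le_1; lra).
assert (Q2 : (Rpower (1 - t) q <= 1)%R) by (apply Rpower_le_1; lra).
assert (Ip := Rinv_0_lt_compat p Hp); assert (Iq := Rinv_0_lt_compat q Hq).
split.
- assert (Rpower (1 - t) q * / q <= 1 * / q)%R by (apply Rmult_le_compat_r; lra).
  assert (0 < Rpower t p * / p)%R by (apply Rmult_lt_0_compat; lra).
  assert (0 < beta_const p q * (Rpower t p * / p - Rpower (1 - t) q * / q + / q))%R
    by (apply Rmult_lt_0_compat; lra).
  lra.
- assert (Rpower t p * / p <= 1 * / p)%R by (apply Rmult_le_compat_r; lra).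
  assert (0 < Rpower (1 - t) q * / q)%R by (apply Rmult_lt_0_compat; lra).
  assert (0 < beta_const p q * (/ p - (Rpower t p * / p - Rpower (1 - t) q * / q)))%R
    by (apply Rmult_lt_0_compat; lra).
  lra.
Qed.

Lemma filterlim_Rpower_0 (p : R) :
  (0 < p)%R -> filterlim (fun t => Rpower t p) (at_right 0) (locally 0%R).
Proof.
intros Hp; apply filterlim_locally; intros eps.
exists (mkposreal _ (Rpower_pos eps (/ p))); intros t Ht Ht0.
apply Rabs_def2 in Ht; unfold minus, plus, opp in Ht; simpl in Ht.
unfold ball; simpl; unfold AbsRing_ball; simpl; unfold abs, minus, plus, opp; simpl.
rewrite Ropp_0, Rplus_0_r, Rabs_pos_eq by (left; apply Rpower_pos).
apply Rlt_le_trans with (Rpower (Rpower eps (/ p)) p).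
- apply Rlt_Rpower_l; lra.
- rewrite Rpower_mult, Rinv_l, Rpower_1 by (try lra; apply cond_pos); lra.
Qed.

Lemma filterlim_1_minus_right : filterlim (fun t => (1 - t)%R) (at_right 0) (at_left 1).
Proof.
intros P [e He]; exists e; intros t Ht Ht0; apply He; [|lra].
revert Ht; unfold ball; simpl; unfold AbsRing_ball; simpl; unfold abs, minus, plus, opp; simpl.
intros Ht; replace (1 - t + - (1))%R with (- (t + - 0))%R by ring; now rewrite Rabs_Ropp.
Qed.

Lemma filterlim_1_minus_left : filterlim (fun t => (1 - t)%R) (at_left 1) (at_right 0).
Proof.
intros P [e He]; exists e; intros t Ht Ht0; apply He; [|lra].
revert Ht; unfold ball; simpl; unfold AbsRing_ball; simpl; unfold abs, minus, plus, opp; simpl.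
intros Ht; replace (1 - t + - 0)%R with (- (t + - (1)))%R by ring; now rewrite Rabs_Ropp.
Qed.

Lemma filterlim_Rpower_1_right (q : R) :
  filterlim (fun t => Rpower (1 - t) q) (at_right 0) (locally 1%R).
Proof.
assert (H : continuous (fun t => Rpower (1 - t) q) 0%R).
{ apply continuous_Rpower; [lra|apply continuous_1_minus]. }
unfold continuous in H; replace (Rpower (1 - 0) q) with 1%R in H.
- eapply filterlim_filter_le_1; [|exact H]; apply filter_le_within.
- unfold Rpower; rewrite Rminus_0_r, ln_1, Rmult_0_r, exp_0; reflexivity.
Qed.

Lemma filterlim_Rpower_1_left (p : R) :
  filterlim (fun t => Rpower t p) (at_left 1) (locally 1%R).
Proof.
assert (H : continuous (fun t => Rpower t p) 1%R).
{ apply continuous_Rpower; [lra|apply continuous_id]. }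
unfold continuous in H; replace (Rpower 1 p) with 1%R in H.
- eapply filterlim_filter_le_1; [|exact H]; apply filter_le_within.
- unfold Rpower; rewrite ln_1, Rmult_0_r, exp_0; reflexivity.
Qed.

Lemma filterlim_beta_primitive {F : (R -> Prop) -> Prop} {FF : Filter F} (p q a b : R) :
  filterlim (fun t => Rpower t p) F (locally a) ->
  filterlim (fun t => Rpower (1 - t) q) F (locally b) ->
  filterlim (beta_primitive p q) F (locally (beta_const p q * (a / p - b / q))%R).
Proof.
intros Ha Hb.
apply (filterlim_comp_2 (G := locally a) (H := locally b)
  (fun t => Rpower t p) (fun t => Rpower (1 - t) q)
  (fun u v => (beta_const p q * (u / p - v / q))%R)); auto.
apply (filterlim_filter_le_1 (F := locally (a, b)) (G := filter_prod (locally a) (locally b))).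
- intros P [e He]; exists (ball a e) (ball b e); [apply locally_ball|apply locally_ball|].
  intros u v Hu Hv; apply He; split; assumption.
- change (continuous (fun z : R * R => (beta_const p q * (fst z / p - snd z / q))%R) (a, b)).
  apply (continuous_mult (fun _ => beta_const p q)); [apply continuous_const|].
  apply (continuous_minus (fun z : R * R => fst z / p)%R (fun z : R * R => snd z / q)%R).
  + apply (continuous_mult (fun z : R * R => fst z) (fun _ => / p)%R);
      [apply continuous_fst|apply continuous_const].
  + apply (continuous_mult (fun z : R * R => snd z) (fun _ => / q)%R);
      [apply continuous_snd|apply continuous_const].
Qed.

Lemma filterlim_beta_primitive_0 (p q : R) :
  (0 < p)%R -> (0 < q)%R ->
  filterlim (beta_primitive p q) (at_right 0) (locally (- (beta_const p q / q))%R).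
Proof.
intros Hp Hq.
replace (- (beta_const p q / q))%R with (beta_const p q * (0 / p - 1 / q))%R by (field; lra).
apply filterlim_beta_primitive; [now apply filterlim_Rpower_0|apply filterlim_Rpower_1_right].
Qed.

Lemma filterlim_beta_primitive_1 (p q : R) :
  (0 < p)%R -> (0 < q)%R ->
  filterlim (beta_primitive p q) (at_left 1) (locally (beta_const p q / p)%R).
Proof.
intros Hp Hq.
replace (beta_const p q / p)%R with (beta_const p q * (1 / p - 0 / q))%R by (field; lra).
apply filterlim_beta_primitive; [apply filterlim_Rpower_1_left|].
exact (filterlim_comp _ _ _ (fun t => 1 - t)%R (fun t => Rpower t q) _ _ _
         filterlim_1_minus_left (filterlim_Rpower_0 q Hq)).
Qed.

Lemma is_Cderive_Rcpow_1_minus (a : C) (t : R) :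
  (t < 1)%R -> is_Cderive (fun u => Rcpow (1 - u) a) t (- (a * Rcpow (1 - t) (a - 1))).
Proof.
intros Ht; evar_last.
- apply (is_Cderive_comp (fun u => Rcpow u a) (fun u => 1 - u)%R t
           (a * Rcpow (1 - t) (a - 1)) (-1)%R).
  + apply is_Cderive_Rcpow; lra.
  + auto_derive; auto; ring.
- replace (RtoC (-1)) with (- RtoC 1) by (apply injective_projections; simpl; ring); ring.
Qed.

(** With both parameters raised by one the kernel is [t^X (1 - t)^Y], whose product rule stays
    within the family of kernels. This serves the integration by parts and the recurrence of the
    beta function. *)
Lemma is_Cderive_beta_kernel (X Y : C) (t : R) :
  (0 < t < 1)%R ->
  is_Cderive (beta_kernel (X + 1) (Y + 1)) t
    (X * beta_kernel X (Y + 1) t - Y * beta_kernel (X + 1) Y t).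
Proof.
intros Ht; evar_last.
- apply is_Cderive_mult.
  + apply is_Cderive_Rcpow; lra.
  + apply is_Cderive_Rcpow_1_minus; lra.
- unfold beta_kernel; simpl.
  replace (X + 1 - 1) with X by ring; replace (Y + 1 - 1) with Y by ring; ring.
Qed.

Lemma continuous_beta_kernel {U : UniformSpace} (X Y : C) (f : U -> R) (x : U) :
  (0 < f x < 1)%R -> continuous f x -> Ccontinuous (fun u => beta_kernel X Y (f u)) x.
Proof.
intros Ht Hf; apply continuous_Cmult.
- apply continuous_Rcpow; [lra|assumption].
- apply continuous_Rcpow; [lra|].
  now apply (continuous_minus (fun _ => 1%R) f); [apply continuous_const|].
Qed.

Lemma beta_kernel_Sl (X Y : C) (t : R) :
  (0 < t < 1)%R -> beta_kernel (X + 1) Y t = RtoC t * beta_kernel X Y t.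
Proof.
intros Ht; unfold beta_kernel.
replace (X + 1 - 1) with (X - 1 + 1) by ring; rewrite Rcpow_S by lra; ring.
Qed.

Lemma beta_kernel_Sr (X Y : C) (t : R) :
  (0 < t < 1)%R -> beta_kernel X (Y + 1) t = RtoC (1 - t) * beta_kernel X Y t.
Proof.
intros Ht; unfold beta_kernel.
replace (Y + 1 - 1) with (Y - 1 + 1) by ring; rewrite Rcpow_S by lra; ring.
Qed.

(** The power [tau^s] left by the substitution in [rho] raises both beta parameters by [s]; this is
    the origin of the shifted parameters in the final formula. *)
Lemma beta_kernel_shift (X Y s : C) (t : R) :
  (0 < t < 1)%R ->
  beta_kernel (X + s) (Y + s) t = beta_kernel X Y t * Rcpow (t * (1 - t)) s.
Proof.
intros Ht; unfold beta_kernel; rewrite Rcpow_mult_distr by lra.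
replace (X + s - 1) with (X - 1 + s) by ring; replace (Y + s - 1) with (Y - 1 + s) by ring.
rewrite !Rcpow_plus; ring.
Qed.

(** * Integration by parts against a bounded primitive *)

Definition tau (t : R) : R := (t * (1 - t))%R.

Lemma tau_pos (t : R) : (0 < t < 1)%R -> (0 < tau t)%R.
Proof. intros Ht; unfold tau; nra. Qed.

Lemma tau_le (t : R) : (tau t <= / 4)%R.
Proof. unfold tau; generalize (pow2_ge_0 (t - / 2)); lra. Qed.

Lemma continuous_tau (t : R) : continuous tau t.
Proof.
apply (continuous_mult (fun u => u) (fun u => 1 - u)%R);
  [apply continuous_id|apply continuous_1_minus].
Qed.

Lemma continuous_div_tau {U : UniformSpace} (f g : U -> R) (x : U) :
  (0 < g x < 1)%R -> continuous f x -> continuous g x ->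
  continuous (fun u => f u / tau (g u))%R x.
Proof.
intros Hx Hf Hg.
apply (continuous_mult f (fun u => / tau (g u))%R); auto.
apply (continuous_comp (fun u => tau (g u)) Rinv).
- apply (continuous_comp g tau); [assumption|apply continuous_tau].
- apply continuity_pt_filterlim, continuity_pt_inv; [apply continuity_pt_id|].
  generalize (tau_pos (g x) Hx); unfold id; lra.
Qed.

(** Its integral over [t] is, as a function of [rho], a multiplicative convolution, whose Mellin
    transform is formally a product. *)
Definition convolution_kernel (F : R -> C) (X Y : C) (rho t : R) : C :=
  beta_kernel X Y t * F (rho / tau t)%R.

Lemma continuous_convolution_kernel {U : UniformSpace} (F : R -> C) (X Y : C)
    (f g : U -> R) (x : U) :
  (forall v, (0 < v)%R -> Ccontinuous F v) -> (0 < f x)%R -> (0 < g x < 1)%R ->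
  continuous f x -> continuous g x ->
  Ccontinuous (fun u => convolution_kernel F X Y (f u) (g u)) x.
Proof.
intros HF Hfx Hgx Hf Hg; apply continuous_Cmult.
- now apply continuous_beta_kernel.
- apply (continuous_comp (fun u => f u / tau (g u))%R F).
  + now apply continuous_div_tau.
  + apply HF, Rdiv_lt_0_compat; [assumption|now apply tau_pos].
Qed.

(** Bounds the derivative of the integrated factor when [|1 - 2 t| >= 1/2]: differentiating the
    kernel gives [X + s] and [Y + s], multiplied by [|1 / (1 - 2 t)| <= 2], and differentiating
    [1 / (1 - 2 t)] gives [2 / (1 - 2 t)^2 <= 8]. *)
Definition ibp_const (X Y s : C) : R := (2 * Cmod (X + s) + 2 * Cmod (Y + s) + 8)%R.

(** Up to elementary factors [F (rho / tau)] is the derivative of the bounded function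
    [G (rho / tau)], and moving that derivative onto the kernel gains [tau^s]. What remains is
    dominated by a beta majorant of positive exponents, with boundary terms that vanish at 0 and 1,
    even if the original integral converges only conditionally. *)
Lemma ibp_estimate (F G : R -> C) (X Y s : C) (M p q rho c d : R) (l : C) :
  (forall v, (0 < v)%R -> Ccontinuous F v) ->
  (forall v, (0 < v)%R -> is_Cderive G v (Rcpow v (s - 1) * F v)) ->
  (forall v, (0 < v)%R -> (Cmod (G v) <= M)%R) ->
  (0 < p)%R -> (0 < q)%R -> (p <= Re (X + s))%R -> (q <= Re (Y + s))%R ->
  (0 < rho)%R -> (0 < c)%R -> (c <= d)%R -> (d < 1)%R ->
  (forall t, (c <= t <= d)%R -> (/ 2 <= Rabs (1 - 2 * t))%R) ->
  is_CRInt (convolution_kernel F X Y rho) c d l ->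
  (Rpower rho (Re s) * Cmod l
   <= M * (2 * beta_majorant (p + 1) (q + 1) c + 2 * beta_majorant (p + 1) (q + 1) d
           + ibp_const X Y s * (beta_primitive p q d - beta_primitive p q c)))%R.
Proof.
intros HF HG HM Hp Hq HX HY Hrho Hc Hcd Hd Hhalf Hl.
(* With [tau' = 1 - 2 t], one has [(U V)' = U' V + rho^s f] where [f] is the
   integrand; this is why [t] is kept away from [1/2]. *)
set (k := fun t : R => RtoC (/ (1 - 2 * t))%R).
set (U := fun t => - (beta_kernel (X + s + 1) (Y + s + 1) t * k t)).
set (dU := fun t => - ((X + s) * beta_kernel (X + s) (Y + s + 1) t
                       - (Y + s) * beta_kernel (X + s + 1) (Y + s) t) * k t
                    - beta_kernel (X + s + 1) (Y + s + 1) t * RtoC (2 * (/ (1 - 2 * t)) ^ 2)%R).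
set (V := fun t => G (rho / tau t)%R).
assert (Hin : forall t, (c <= t <= d)%R -> (0 < t < 1)%R) by (intros; lra).
assert (Hne : forall t, (c <= t <= d)%R -> (1 - 2 * t <> 0)%R).
{ intros t Ht E; specialize (Hhalf t Ht); rewrite E, Rabs_R0 in Hhalf; lra. }
assert (Hk : forall t, (c <= t <= d)%R -> (Rabs (/ (1 - 2 * t)) <= 2)%R).
{ intros t Ht; rewrite Rabs_inv; apply Rle_trans with (/ / 2)%R; [|lra].
  apply Rinv_le_contravar; [lra|auto]. }
assert (Dk : forall t, (c <= t <= d)%R -> is_Cderive k t (RtoC (2 * (/ (1 - 2 * t)) ^ 2)%R)).
{ intros t Ht; apply is_Cderive_RtoC; auto_derive; [apply Hne, Ht|]; field; apply Hne, Ht. }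
assert (DU : forall t, (c <= t <= d)%R -> is_Cderive U t (dU t)).
{ intros t Ht; evar_last.
  - apply (is_derive_opp (V := C_R_NormedModule)), is_Cderive_mult.
    + apply is_Cderive_beta_kernel; auto.
    + auto.
  - unfold dU; change (opp (G := C_R_NormedModule) ?x) with (- x); ring. }
assert (DV : forall t, (c <= t <= d)%R -> is_Cderive V t
  (RtoC (- (rho * (1 - 2 * t)) / (tau t) ^ 2)%R
   * (Rcpow (rho / tau t) (s - 1) * F (rho / tau t)%R))).
{ intros t Ht; assert (T := tau_pos t (Hin t Ht)).
  apply (is_Cderive_comp G (fun u => rho / tau u)%R).
  - apply HG, Rdiv_lt_0_compat; auto.
  - unfold tau in *; auto_derive; [lra|]; field; split; nra. }
assert (CU : forall t, (c <= t <= d)%R -> Ccontinuous dU t).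
{ intros t Ht; specialize (Hin t Ht).
  assert (Ck : Ccontinuous k t) by (eapply is_Cderive_continuous; auto).
  assert (Cid : continuous (fun u : R => u) t) by apply continuous_id.
  assert (Cb : forall A B, Ccontinuous (beta_kernel A B) t).
  { intros A B; apply (continuous_beta_kernel A B (fun u => u)); auto. }
  unfold dU; apply continuous_Cplus.
  - apply continuous_Cmult; [|exact Ck].
    apply (continuous_opp (V := C_R_NormedModule)), continuous_Cplus.
    + apply continuous_Cmult; [apply continuous_Cconst|apply Cb].
    + apply (continuous_opp (V := C_R_NormedModule)), continuous_Cmult;
        [apply continuous_Cconst|apply Cb].
  - apply (continuous_opp (V := C_R_NormedModule)), continuous_Cmult; [apply Cb|].
    apply continuous_RtoC, (ex_derive_continuous (V := R_NormedModule)).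
    auto_derive; apply Hne, Ht. }
assert (CV : forall t, (c <= t <= d)%R -> Ccontinuous V t).
{ intros t Ht; eapply is_Cderive_continuous, DV, Ht. }
assert (Hparts : forall t, (c <= t <= d)%R ->
   is_Cderive (fun u => U u * V u) t
     (dU t * V t + Rcpow rho s * convolution_kernel F X Y rho t)).
{ intros t Ht; assert (T := tau_pos t (Hin t Ht)).
  evar_last; [exact (is_Cderive_mult _ _ _ _ _ (DU t Ht) (DV t Ht))|].
  f_equal; unfold U, k, convolution_kernel.
  replace (Rcpow rho s) with (RtoC rho * (Rcpow (rho / tau t) (s - 1) * Rcpow (tau t) (s - 1))).
  2:{ rewrite <- Rcpow_mult_distr by (auto; apply Rdiv_lt_0_compat; auto).
      replace (rho / tau t * tau t)%R with rho by (field; lra).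
      rewrite Cmult_comm, <- Rcpow_S by assumption; f_equal; ring. }
  (* This exposes [tau^2 tau^(s-1)] in the kernel: the square cancels the [1 / tau^2] of the chain
     rule, and [tau^(s-1)] completes [(rho / tau)^(s-1)] to [rho^(s-1)]. *)
  replace (X + s + 1) with (X + (s - 1) + 1 + 1) by ring.
  replace (Y + s + 1) with (Y + (s - 1) + 1 + 1) by ring.
  rewrite !beta_kernel_Sl, !beta_kernel_Sr, beta_kernel_shift by auto.
  fold (tau t).
  replace (RtoC (- (rho * (1 - 2 * t)) / tau t ^ 2)%R)
    with (- (RtoC rho * RtoC (1 - 2 * t)%R * RtoC (/ (tau t) ^ 2)%R)).
  2:{ rewrite <- !RtoC_mult, <- RtoC_opp; f_equal; field; lra. }
  transitivity (RtoC (t * t * (1 - t) * (1 - t) * / tau t ^ 2)%R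
    * RtoC (/ (1 - 2 * t) * (1 - 2 * t))%R
    * (RtoC rho * (Rcpow (rho / tau t) (s - 1) * Rcpow (tau t) (s - 1))
       * (beta_kernel X Y t * F (rho / tau t)%R))).
  - rewrite !RtoC_mult; ring.
  - replace (t * t * (1 - t) * (1 - t) * / tau t ^ 2)%R with 1%R
      by (unfold tau; field; split; specialize (Hin t Ht); lra).
    rewrite Rinv_l by auto; ring. }
assert (HdU : forall t, (c <= t <= d)%R ->
   (Cmod (dU t) <= ibp_const X Y s * beta_majorant p q t)%R).
{ intros t Ht; specialize (Hin t Ht); specialize (Hk t Ht).
  assert (B : forall A B, (p <= Re A)%R -> (q <= Re B)%R ->
             (Cmod (beta_kernel A B t) <= beta_majorant p q t)%R).
  { intros A B HA HB; rewrite Cmod_beta_kernel; apply beta_majorant_decr; auto. }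
  assert (B1 : (Cmod (beta_kernel (X + s) (Y + s + 1) t) <= beta_majorant p q t)%R)
    by (apply B; simpl in *; lra).
  assert (B2 : (Cmod (beta_kernel (X + s + 1) (Y + s) t) <= beta_majorant p q t)%R)
    by (apply B; simpl in *; lra).
  assert (B3 : (Cmod (beta_kernel (X + s + 1) (Y + s + 1) t) <= beta_majorant p q t)%R)
    by (apply B; simpl in *; lra).
  assert (K : (Cmod (k t) <= 2)%R) by (unfold k; rewrite Cmod_R; auto).
  assert (K2 : (Cmod (RtoC (2 * (/ (1 - 2 * t)) ^ 2)%R) <= 8)%R).
  { rewrite Cmod_R, Rabs_mult, <- RPow_abs, (Rabs_pos_eq 2) by lra.
    assert (0 <= Rabs (/ (1 - 2 * t)))%R by apply Rabs_pos; nra. }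
  assert (m := beta_majorant_pos p q t).
  unfold dU; eapply Rle_trans; [apply Cmod_triangle|].
  rewrite Cmod_opp, !Cmod_mult, Cmod_opp.
  apply Rle_trans with ((Cmod (X + s) * beta_majorant p q t + Cmod (Y + s) * beta_majorant p q t) * 2
       + beta_majorant p q t * 8)%R.
  - apply Rplus_le_compat.
    + apply Rmult_le_compat; auto using Cmod_ge_0.
      eapply Rle_trans; [apply Cmod_triangle|].
      rewrite Cmod_opp, !Cmod_mult.
      apply Rplus_le_compat; apply Rmult_le_compat_l; auto using Cmod_ge_0.
    + apply Rmult_le_compat; auto using Cmod_ge_0.
  - unfold ibp_const; lra. }
assert (HM0 : (0 <= M)%R).
{ eapply Rle_trans; [apply Cmod_ge_0|apply (HM 1%R); lra]. }
destruct (ex_CRInt_continuous (fun t => dU t * V t) c d Hcd) as [r Hr].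
{ intros t Ht; apply continuous_Cmult; auto. }
assert (HU : is_CRInt (fun t => dU t * V t + Rcpow rho s * convolution_kernel F X Y rho t) c d
               (U d * V d - U c * V c)).
{ apply (is_CRInt_derive (fun u => U u * V u)); auto.
  intros t Ht; apply continuous_Cplus.
  - apply continuous_Cmult; auto.
  - apply continuous_Cmult; [apply continuous_Cconst|].
    apply (continuous_convolution_kernel F X Y (fun _ => rho) (fun u => u)); auto.
    + apply continuous_const.
    + apply continuous_id. }
assert (E : U d * V d - U c * V c = r + Rcpow rho s * l).
{ apply (is_CRInt_unique _ _ _ _ _ HU).
  apply (is_RInt_plus (V := C_R_NormedModule) _ _ _ _ _ _ Hr).
  now apply is_CRInt_Cmult. }
assert (Br : (Cmod r <= ibp_const X Y s * M * (beta_primitive p q d - beta_primitive p q c))%R).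
{ apply (Cmod_CRInt_beta (fun t => dU t * V t)); auto.
  - apply Rmult_le_pos; auto.
    unfold ibp_const; generalize (Cmod_ge_0 (X + s)) (Cmod_ge_0 (Y + s)); lra.
  - intros t Ht; rewrite Cmod_mult.
    assert (T := tau_pos t (Hin t Ht)).
    replace (ibp_const X Y s * M * beta_majorant p q t)%R
      with (ibp_const X Y s * beta_majorant p q t * M)%R by ring.
    apply Rmult_le_compat; auto using Cmod_ge_0.
    apply HM, Rdiv_lt_0_compat; auto. }
assert (BU : forall t, (c <= t <= d)%R ->
   (Cmod (U t * V t) <= M * (2 * beta_majorant (p + 1) (q + 1) t))%R).
{ intros t Ht; assert (T := tau_pos t (Hin t Ht)).
  rewrite Cmod_mult, Rmult_comm; apply Rmult_le_compat; auto using Cmod_ge_0.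
  - apply HM, Rdiv_lt_0_compat; auto.
  - unfold U; rewrite Cmod_opp, Cmod_mult, Rmult_comm.
    apply Rmult_le_compat; auto using Cmod_ge_0.
    + unfold k; rewrite Cmod_R; auto.
    + rewrite Cmod_beta_kernel; apply beta_majorant_decr; auto; simpl in *; lra. }
replace (Rpower rho (Re s) * Cmod l)%R with (Cmod (U d * V d + - (U c * V c) + - r)).
2:{ rewrite <- Cmod_Rcpow, <- Cmod_mult; f_equal.
    transitivity (U d * V d - U c * V c - r); [ring|rewrite E; ring]. }
eapply Rle_trans; [apply Cmod_triangle|]; rewrite Cmod_opp.
assert (Cmod (U d * V d + - (U c * V c)) <= Cmod (U d * V d) + Cmod (U c * V c))%R.
{ eapply Rle_trans; [apply Cmod_triangle|]; rewrite Cmod_opp; lra. }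
assert (B1 := BU c ltac:(lra)); assert (B2 := BU d ltac:(lra)); lra.
Qed.

(** * Truncation errors *)

(** Cost of omitting [(0, c)] and [(d, 1)]: the two powers come from the boundary terms of the
    integration by parts, the two differences are the masses of the majorant near the ends. *)
Definition truncation_error (p q c d : R) : R :=
  (Rpower c p + Rpower (1 - d) q + (beta_primitive p q c + beta_const p q / q)
   + (beta_const p q / p - beta_primitive p q d))%R.

Lemma beta_majorant_S_le (p q t : R) :
  (0 < t < 1)%R -> (0 < p)%R -> (0 < q)%R ->
  (beta_majorant (p + 1) (q + 1) t <= Rpower t p)%R /\
  (beta_majorant (p + 1) (q + 1) t <= Rpower (1 - t) q)%R.
Proof.
intros Ht Hp Hq; unfold beta_majorant.
replace (p + 1 - 1)%R with p by ring; replace (q + 1 - 1)%R with q by ring.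
assert (P1 := Rpower_pos t p); assert (P2 := Rpower_pos (1 - t) q).
assert (Q1 : (Rpower t p <= 1)%R) by (apply Rpower_le_1; lra).
assert (Q2 : (Rpower (1 - t) q <= 1)%R) by (apply Rpower_le_1; lra).
split; nra.
Qed.

(** Lets the boundary terms, of total weight [2 + 2], be absorbed into the same constant as the
    integral term. *)
Lemma ibp_const_ge (X Y s : C) : (8 <= ibp_const X Y s)%R.
Proof. unfold ibp_const; generalize (Cmod_ge_0 (X + s)) (Cmod_ge_0 (Y + s)); lra. Qed.

Lemma is_primitive_convolution_kernel (F : R -> C) (X Y : C) (rho : R) :
  (forall v, (0 < v)%R -> Ccontinuous F v) -> (0 < rho)%R ->
  exists P, is_primitive_on unit_interval (convolution_kernel F X Y rho) P.
Proof.
intros HF Hrho.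
destruct (ex_primitive_on unit_interval (convolution_kernel F X Y rho) (/ 2)) as [P [HP _]].
- exact unit_interval_like.
- unfold unit_interval; lra.
- intros t Ht; apply (continuous_convolution_kernel F X Y (fun _ => rho) (fun u => u)); auto.
  + apply continuous_const.
  + apply continuous_id.
- now exists P.
Qed.

(** The bound of [ibp_estimate] on [[t, c]] is uniform in [t], so it survives [t -> 0]; likewise on
    [[d, t]] as [t -> 1]. The conditions [c <= 1/4] and [d >= 3/4] keep both pieces where
    [|1 - 2 t| >= 1/2]. *)
Lemma truncation_estimate (F G : R -> C) (X Y s : C) (M p q rho c d : R) (J l : C) :
  (forall v, (0 < v)%R -> Ccontinuous F v) ->
  (forall v, (0 < v)%R -> is_Cderive G v (Rcpow v (s - 1) * F v)) ->
  (forall v, (0 < v)%R -> (Cmod (G v) <= M)%R) ->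
  (0 < p)%R -> (0 < q)%R -> (p <= Re (X + s))%R -> (q <= Re (Y + s))%R ->
  (0 < rho)%R -> (0 < c <= / 4)%R -> (3 / 4 <= d < 1)%R ->
  is_RInt_gen (V := C_R_NormedModule) (convolution_kernel F X Y rho) (at_right 0) (at_left 1) J ->
  is_CRInt (convolution_kernel F X Y rho) c d l ->
  (Rpower rho (Re s) * Cmod (J - l) <= M * ibp_const X Y s * truncation_error p q c d)%R.
Proof.
intros HF HG HM Hp Hq HX HY Hrho Hc Hd HJ Hl.
destruct (is_primitive_convolution_kernel F X Y rho HF Hrho) as [P HP].
destruct (primitive_limits unit_interval _ P J HP unit_interval_at_right unit_interval_at_left HJ)
  as [la [lb [Ha [Hb E]]]].
assert (Dc : unit_interval c) by (unfold unit_interval; lra).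
assert (Dd : unit_interval d) by (unfold unit_interval; lra).
rewrite (is_CRInt_unique _ _ _ _ _ Hl (HP c d Dc Dd)), E; clear l Hl.
assert (K8 := ibp_const_ge X Y s).
assert (HM0 : (0 <= M)%R).
{ eapply Rle_trans; [apply Cmod_ge_0|apply (HM 1%R); lra]. }
assert (R0 := Rpower_pos rho (Re s)).
set (A := ibp_const X Y s) in *; set (r := Rpower rho (Re s)) in *.
assert (B1 : (r * Cmod (la - P c) <= M * A * (Rpower c p + (beta_primitive p q c + beta_const p q / q)))%R).
{ apply Rmult_le_reg_l with (/ r)%R; [now apply Rinv_0_lt_compat|].
  rewrite <- Rmult_assoc, Rinv_l, Rmult_1_l by lra.
  apply (Cmod_limit_le (F := at_right 0) P); [exact Ha|].
  exists (mkposreal c (proj1 Hc)); intros t Ht Ht0.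
  apply Rabs_def2 in Ht; unfold minus, plus, opp in Ht; simpl in Ht.
  assert (Dt : unit_interval t) by (unfold unit_interval; lra).
  apply Rmult_le_reg_l with r; [assumption|].
  rewrite <- Rmult_assoc, Rinv_r, Rmult_1_l by lra.
  replace (P t - P c) with (- (P c - P t)) by ring; rewrite Cmod_opp.
  eapply Rle_trans.
  - apply (ibp_estimate F G X Y s M p q rho t c); auto; try lra.
    intros u Hu; rewrite Rabs_pos_eq; lra.
  - fold A; rewrite Rmult_assoc; apply Rmult_le_compat_l; auto.
    destruct (beta_majorant_S_le p q t) as [m1 _]; auto.
    destruct (beta_majorant_S_le p q c) as [m2 _]; auto.
    assert (m3 : (Rpower t p <= Rpower c p)%R) by (apply Rle_Rpower_l; lra).
    assert (m4 := Rpower_pos c p).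
    destruct (beta_primitive_bounds p q t) as [m5 _]; auto.
    nra. }
assert (B2 : (r * Cmod (lb - P d) <= M * A * (Rpower (1 - d) q + (beta_const p q / p - beta_primitive p q d)))%R).
{ apply Rmult_le_reg_l with (/ r)%R; [now apply Rinv_0_lt_compat|].
  rewrite <- Rmult_assoc, Rinv_l, Rmult_1_l by lra.
  apply (Cmod_limit_le (F := at_left 1) P); [exact Hb|].
  assert (D0 : (0 < 1 - d)%R) by lra.
  exists (mkposreal (1 - d) D0); intros t Ht Ht0.
  apply Rabs_def2 in Ht; unfold minus, plus, opp in Ht; simpl in Ht.
  assert (Dt : unit_interval t) by (unfold unit_interval; lra).
  apply Rmult_le_reg_l with r; [assumption|].
  rewrite <- Rmult_assoc, Rinv_r, Rmult_1_l by lra.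
  eapply Rle_trans.
  - apply (ibp_estimate F G X Y s M p q rho d t); auto; try lra.
    intros u Hu; rewrite Rabs_left1; lra.
  - fold A; rewrite Rmult_assoc; apply Rmult_le_compat_l; auto.
    destruct (beta_majorant_S_le p q t) as [_ m1]; auto.
    destruct (beta_majorant_S_le p q d) as [_ m2]; auto.
    assert (m3 : (Rpower (1 - t) q <= Rpower (1 - d) q)%R) by (apply Rle_Rpower_l; lra).
    assert (m4 := Rpower_pos (1 - d) q).
    destruct (beta_primitive_bounds p q t) as [_ m5]; auto.
    nra. }
replace (lb - la - (P d - P c)) with ((lb - P d) + - (la - P c)) by ring.
apply Rle_trans with (r * (Cmod (lb - P d) + Cmod (la - P c)))%R.
- apply Rmult_le_compat_l; [lra|].
  eapply Rle_trans; [apply Cmod_triangle|]; rewrite Cmod_opp; lra.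
- unfold truncation_error; lra.
Qed.

(** Without the factor [F] the kernel is absolutely integrable and the masses near the ends suffice.
    The powers in [truncation_error] are slack here, so that one error sequence serves both kinds of
    integral. *)
Lemma beta_truncation_estimate (X Y : C) (p q c d : R) (B l : C) :
  (0 < p)%R -> (0 < q)%R -> (p <= Re X)%R -> (q <= Re Y)%R ->
  (0 < c < 1)%R -> (0 < d < 1)%R ->
  is_RInt_gen (V := C_R_NormedModule) (beta_kernel X Y) (at_right 0) (at_left 1) B ->
  is_CRInt (beta_kernel X Y) c d l ->
  (Cmod (B - l) <= truncation_error p q c d)%R.
Proof.
intros Hp Hq HX HY Hc Hd HB Hl.
destruct (ex_primitive_on unit_interval (beta_kernel X Y) (/ 2)) as [P [HP _]].
- exact unit_interval_like.
- unfold unit_interval; lra.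
- intros t Ht; apply (continuous_beta_kernel X Y (fun u => u)); auto; apply continuous_id.
- destruct (primitive_limits unit_interval _ P B HP unit_interval_at_right unit_interval_at_left HB)
    as [la [lb [Ha [Hb E]]]].
  rewrite (is_CRInt_unique _ _ _ _ _ Hl (HP c d Hc Hd)), E; clear l Hl.
  assert (Hm : forall u v, unit_interval u -> unit_interval v -> (u <= v)%R ->
            (Cmod (P v - P u) <= beta_primitive p q v - beta_primitive p q u)%R).
  { intros u v Hu Hv Huv.
    rewrite <- (Rmult_1_l (beta_primitive p q v - beta_primitive p q u)).
    apply (Cmod_CRInt_beta (beta_kernel X Y) p q 1 u v); auto; try apply Hu; try apply Hv; try lra.
    intros t Ht; rewrite Cmod_beta_kernel, Rmult_1_l.
    apply beta_majorant_decr; auto; unfold unit_interval in *; lra. }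
  assert (B1 : (Cmod (la - P c) <= beta_primitive p q c + beta_const p q / q)%R).
  { apply (Cmod_limit_le (F := at_right 0) P); [exact Ha|].
    exists (mkposreal c (proj1 Hc)); intros t Ht Ht0.
    apply Rabs_def2 in Ht; unfold minus, plus, opp in Ht; simpl in Ht.
    assert (Dt : unit_interval t) by (unfold unit_interval; lra).
    replace (P t - P c) with (- (P c - P t)) by ring; rewrite Cmod_opp.
    eapply Rle_trans; [apply Hm; auto; lra|].
    destruct (beta_primitive_bounds p q t) as [m5 _]; auto; lra. }
  assert (B2 : (Cmod (lb - P d) <= beta_const p q / p - beta_primitive p q d)%R).
  { apply (Cmod_limit_le (F := at_left 1) P); [exact Hb|].
    assert (D0 : (0 < 1 - d)%R) by lra.
    exists (mkposreal (1 - d) D0); intros t Ht Ht0.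
    apply Rabs_def2 in Ht; unfold minus, plus, opp in Ht; simpl in Ht.
    assert (Dt : unit_interval t) by (unfold unit_interval; lra).
    eapply Rle_trans; [apply Hm; auto; lra|].
    destruct (beta_primitive_bounds p q t) as [_ m5]; auto; lra. }
  replace (lb - la - (P d - P c)) with ((lb - P d) + - (la - P c)) by ring.
  eapply Rle_trans; [apply Cmod_triangle|]; rewrite Cmod_opp.
  unfold truncation_error.
  generalize (Rpower_pos c p) (Rpower_pos (1 - d) q); lra.
Qed.

(** The 4 keeps every cutoff at most [1/4], as the truncation estimate requires. *)
Definition cutoff (N : nat) : R := (/ (INR N + 4))%R.

Lemma cutoff_bounds (N : nat) : (0 < cutoff N <= / 4)%R.
Proof.
unfold cutoff; assert (H := pos_INR N); split.
- apply Rinv_0_lt_compat; lra.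
- apply Rinv_le_contravar; lra.
Qed.

Lemma filterlim_cutoff : filterlim cutoff eventually (at_right 0).
Proof.
intros P [e He].
destruct (nfloor_ex (/ e)) as [n [_ Hn]]; [left; apply Rinv_0_lt_compat, cond_pos|].
exists n; intros N HN; apply He; [|apply cutoff_bounds].
assert (C0 := cutoff_bounds N).
unfold ball; simpl; unfold AbsRing_ball; simpl; unfold abs, minus, plus, opp; simpl.
rewrite Ropp_0, Rplus_0_r, Rabs_pos_eq by lra.
unfold cutoff; rewrite <- (Rinv_inv e).
apply Rinv_lt_contravar.
- apply Rmult_lt_0_compat; [apply Rinv_0_lt_compat, cond_pos|].
  generalize (pos_INR N); lra.
- apply le_INR in HN; lra.
Qed.

Lemma truncation_error_cutoff (p q : R) :
  (0 < p)%R -> (0 < q)%R ->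
  is_lim_seq (fun N => truncation_error p q (cutoff N) (1 - cutoff N)%R) 0.
Proof.
intros Hp Hq.
assert (L1 : is_lim_seq (fun N => Rpower (cutoff N) p) 0).
{ exact (filterlim_comp _ _ _ _ _ _ _ _ filterlim_cutoff (filterlim_Rpower_0 p Hp)). }
assert (L2 : is_lim_seq (fun N => Rpower (cutoff N) q) 0).
{ exact (filterlim_comp _ _ _ _ _ _ _ _ filterlim_cutoff (filterlim_Rpower_0 q Hq)). }
assert (L3 : is_lim_seq (fun N => beta_primitive p q (cutoff N)) (- (beta_const p q / q))%R).
{ exact (filterlim_comp _ _ _ _ _ _ _ _ filterlim_cutoff (filterlim_beta_primitive_0 p q Hp Hq)). }
assert (L4 : is_lim_seq (fun N => beta_primitive p q (1 - cutoff N)%R) (beta_const p q / p)%R).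
{ exact (filterlim_comp _ _ _ _ _ _ _ _
    (filterlim_comp _ _ _ _ _ _ _ _ filterlim_cutoff filterlim_1_minus_right)
    (filterlim_beta_primitive_1 p q Hp Hq)). }
apply (is_lim_seq_ext (fun N => Rpower (cutoff N) p + Rpower (cutoff N) q
   + (beta_primitive p q (cutoff N) + beta_const p q / q)
   + (beta_const p q / p - beta_primitive p q (1 - cutoff N)))%R).
- intros N; unfold truncation_error.
  replace (1 - (1 - cutoff N))%R with (cutoff N) by ring; reflexivity.
- replace (Finite 0) with (Finite (0 + 0 + (- (beta_const p q / q) + beta_const p q / q)
      + (beta_const p q / p - beta_const p q / p))%R) by (f_equal; ring).
  repeat first [assumption | apply is_lim_seq_const
               | apply is_lim_seq_minus' | apply is_lim_seq_plus'].
Qed.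

(** * Exchanging the integrations over a compact rectangle *)

(** Exchange of integrations through the fundamental theorem: differentiating under the integral
    sign, the integral of [g u] over [[c, d]] has the inner integral of [dg u] as its derivative in
    [u]. That derivative is continuous because [dg] is uniformly continuous on a compact
    rectangle. *)
Lemma RInt_RInt_derive (g dg : R -> R -> R) (D1 D2 : R -> Prop) (a b c d : R) :
  interval_like D1 -> interval_like D2 ->
  (forall u, D1 u -> locally u D1) -> (forall t, D2 t -> locally t D2) ->
  D1 a -> D1 b -> D2 c -> D2 d -> (a <= b)%R -> (c <= d)%R ->
  (forall u t, D1 u -> D2 t -> is_derive (fun v => g v t) u (dg u t)) ->
  (forall u t, D1 u -> D2 t -> continuity_2d_pt dg u t) ->
  (forall u t, D1 u -> D2 t -> continuous (g u) t) ->
  is_RInt (fun u => RInt (dg u) c d) a b (RInt (g b) c d - RInt (g a) c d)%R.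
Proof.
intros HI1 HI2 HO1 HO2 Da Db Dc Dd Hab Hcd Hder Hcont Hg.
assert (HD2 : forall t, (Rmin c d <= t <= Rmax c d)%R -> D2 t).
{ rewrite Rmin_left, Rmax_right by auto; intros t Ht; apply (HI2 c d); auto. }
assert (HD1 : forall t, (Rmin a b <= t <= Rmax a b)%R -> D1 t).
{ rewrite Rmin_left, Rmax_right by auto; intros t Ht; apply (HI1 a b); auto. }
assert (Hdg1 : forall u t, D1 u -> D2 t -> continuous (dg u) t).
{ intros u t Du Dt.
  assert (K := proj1 (continuity_2d_pt_filterlim _ _ _) (Hcont u t Du Dt)).
  apply (continuous_comp (fun v => (u, v)) (fun z : R * R => dg (fst z) (snd z))); auto.
  intros P [e He]; exists e; intros v Hv; apply He; split; [apply ball_center|exact Hv]. }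
apply (is_RInt_derive (V := R_CompleteNormedModule) (fun u => RInt (g u) c d)).
- intros u Du%HD1.
  rewrite (RInt_ext (dg u) (fun t => Derive (fun v => g v t) u)).
  2:{ intros t Ht; symmetry; apply is_derive_unique, Hder; auto; apply HD2; lra. }
  apply is_derive_RInt_param.
  + generalize (HO1 u Du); apply filter_imp; intros v Dv t Ht.
    exists (dg v t); apply Hder; auto.
  + intros t Ht; apply (continuity_2d_pt_ext_loc dg); [|apply Hcont; auto].
    destruct (HO1 u Du) as [e1 He1]; destruct (HO2 t (HD2 t Ht)) as [e2 He2].
    assert (P : (0 < Rmin e1 e2)%R) by (apply Rmin_pos; apply cond_pos).
    exists (mkposreal _ P); simpl; intros v w Hv Hw.
    symmetry; apply is_derive_unique, Hder.
    * apply He1; apply Rlt_le_trans with (1 := Hv), Rmin_l.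
    * apply He2; apply Rlt_le_trans with (1 := Hw), Rmin_r.
  + generalize (HO1 u Du); apply filter_imp; intros v Dv.
    apply (ex_RInt_continuous (V := R_CompleteNormedModule)); intros t Ht; apply Hg; auto.
- intros u Hu; assert (Du := HD1 u Hu).
  apply filterlim_locally; intros eps.
  destruct (HO1 u Du) as [e1 He1].
  set (h := (e1 / 2)%R).
  assert (Hh : (0 < h)%R) by (unfold h; generalize (cond_pos e1); lra).
  assert (Dn : forall v, (u - h <= v <= u + h)%R -> D1 v).
  { intros v Hv; apply He1; unfold h in Hv.
    unfold ball; simpl; unfold AbsRing_ball; simpl; unfold abs, minus, plus, opp; simpl.
    generalize (cond_pos e1); intros; apply Rabs_def1; lra. }
  (* The [+ 1] keeps the denominator positive in the degenerate case [c = d]. *)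
  assert (P : (0 < eps / (2 * (d - c + 1)))%R).
  { apply Rdiv_lt_0_compat; [apply cond_pos|lra]. }
  destruct (uniform_continuity_2d dg (u - h) (u + h) c d) with (eps := mkposreal _ P) as [del Hdel].
  { intros v t Hv Ht; apply Hcont; [apply Dn|apply (HI2 c d)]; auto. }
  assert (P2 : (0 < Rmin del h)%R) by (apply Rmin_pos; [apply cond_pos|auto]).
  exists (mkposreal _ P2); intros v Hv.
  unfold ball in Hv |- *; simpl in *; unfold AbsRing_ball in *; simpl in *.
  unfold abs, minus, plus, opp in *; simpl in *.
  assert (Hv1 := Rlt_le_trans _ _ _ Hv (Rmin_l _ _)).
  assert (Hv2 := Rlt_le_trans _ _ _ Hv (Rmin_r _ _)).
  apply Rabs_def2 in Hv2.
  assert (Dv : D1 v) by (apply Dn; lra).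
  assert (X1 : is_RInt (dg v) c d (RInt (dg v) c d)).
  { apply (RInt_correct (V := R_CompleteNormedModule)), (ex_RInt_continuous (V := R_CompleteNormedModule)).
    auto. }
  assert (X2 : is_RInt (dg u) c d (RInt (dg u) c d)).
  { apply (RInt_correct (V := R_CompleteNormedModule)), (ex_RInt_continuous (V := R_CompleteNormedModule)).
    auto. }
  apply Rle_lt_trans with ((d - c) * (eps / (2 * (d - c + 1))))%R.
  + apply (norm_RInt_le_const (V := R_NormedModule) (fun t => minus (dg v t) (dg u t)) c d); auto.
    * intros t Ht; left.
      change (Rabs (dg v t - dg u t) < eps / (2 * (d - c + 1)))%R.
      apply (Hdel u t v t); try lra; [exact Hv1|].
      rewrite Rminus_eq_0, Rabs_R0; apply cond_pos.
    * exact (is_RInt_minus _ _ _ _ _ _ X1 X2).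
  + apply Rlt_le_trans with ((d - c + 1) * (eps / (2 * (d - c + 1))) * 2)%R.
    * set (w := (eps / (2 * (d - c + 1)))%R) in *; nra.
    * right; field; lra.
Qed.

Lemma positive_interval_like : interval_like (fun u => (0 < u)%R).
Proof. intros a b t Ha Hb Ht; lra. Qed.

Lemma positive_open (u : R) : (0 < u)%R -> locally u (fun v => (0 < v)%R).
Proof. apply open_gt. Qed.

Lemma mellin_convolution_exchange (F G : R -> C) (X Y s : C) (a b c d : R) (I : R -> C) (l : C) :
  (forall v, (0 < v)%R -> Ccontinuous F v) ->
  (forall v, (0 < v)%R -> is_Cderive G v (Rcpow v (s - 1) * F v)) ->
  (0 < a)%R -> (a <= b)%R -> (0 < c)%R -> (c <= d)%R -> (d < 1)%R ->
  (forall rho, (0 < rho)%R -> is_CRInt (convolution_kernel F X Y rho) c d (I rho)) ->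
  is_CRInt (fun t => beta_kernel (X + s) (Y + s) t * (G (b / tau t)%R - G (a / tau t)%R)) c d l ->
  is_CRInt (fun rho => Rcpow rho (s - 1) * I rho) a b l.
Proof.
intros HF HG Ha Hab Hc Hcd Hd HI Hl.
(* [g] is chosen so that its derivative in [u] is [dg]: the chain rule produces
   [tau^s (u / tau)^(s-1) / tau], which is [u^(s-1)]. *)
set (g := fun u t : R => beta_kernel (X + s) (Y + s) t * G (u / tau t)%R).
set (dg := fun u t : R => Rcpow u (s - 1) * convolution_kernel F X Y u t).
assert (Hder : forall u t, (0 < u)%R -> unit_interval t -> is_Cderive (fun v => g v t) u (dg u t)).
{ intros u t Hu Ht; assert (T := tau_pos t Ht).
  assert (Hv : (0 < u / tau t)%R) by (now apply Rdiv_lt_0_compat).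
  evar_last.
  - apply is_Cderive_mult.
    + apply (is_derive_const (V := C_R_NormedModule)).
    + apply (is_Cderive_comp G (fun v => v / tau t)%R u
        (Rcpow (u / tau t) (s - 1) * F (u / tau t)%R) (/ tau t)); [now apply HG|].
      auto_derive; [auto|]; field; lra.
  - change (zero : C_R_NormedModule) with (RtoC 0).
    unfold dg, convolution_kernel; rewrite beta_kernel_shift by exact Ht; fold (tau t).
    replace s with (s - 1 + 1) at 1 by ring; rewrite Rcpow_S by assumption.
    replace (Rcpow u (s - 1)) with (Rcpow (u / tau t) (s - 1) * Rcpow (tau t) (s - 1)).
    2:{ rewrite <- Rcpow_mult_distr by auto; f_equal; field; lra. }
    transitivity (RtoC (tau t * / tau t)%R
       * (beta_kernel X Y t * Rcpow (tau t) (s - 1) * Rcpow (u / tau t) (s - 1) * F (u / tau t)%R)).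
    + rewrite RtoC_mult; ring.
    + rewrite Rinv_r by lra; ring. }
assert (Hcont : forall u t, (0 < u)%R -> unit_interval t ->
   Ccontinuous (fun z : R * R => dg (fst z) (snd z)) (u, t)).
{ intros u t Hu Ht; unfold dg; apply continuous_Cmult.
  - apply continuous_Rcpow; [exact Hu|apply continuous_fst].
  - apply (continuous_convolution_kernel F X Y (fun z : R * R => fst z) (fun z : R * R => snd z)); auto.
    + apply continuous_fst.
    + apply continuous_snd. }
assert (Hg : forall u t, (0 < u)%R -> unit_interval t -> Ccontinuous (g u) t).
{ intros u t Hu Ht; assert (T := tau_pos t Ht); unfold g; apply continuous_Cmult.
  - apply (continuous_beta_kernel (X + s) (Y + s) (fun v => v)); auto; apply continuous_id.
  - apply (continuous_comp (fun v => u / tau v)%R G).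
    + apply (continuous_div_tau (fun _ => u) (fun v => v)); auto;
        [apply continuous_const|apply continuous_id].
    + eapply is_Cderive_continuous, HG; now apply Rdiv_lt_0_compat. }
assert (Dc : unit_interval c) by (unfold unit_interval; lra).
assert (Dd : unit_interval d) by (unfold unit_interval; lra).
assert (Hb : (0 < b)%R) by lra.
assert (Hin : forall t, (c <= t <= d)%R -> unit_interval t) by (intros; unfold unit_interval; lra).
assert (HdgI : forall u, (0 < u)%R -> is_CRInt (dg u) c d (Rcpow u (s - 1) * I u)).
{ intros u Hu; now apply is_CRInt_Cmult, HI. }
destruct (ex_CRInt_continuous (g a) c d Hcd) as [ga Hga]; [auto|].
destruct (ex_CRInt_continuous (g b) c d Hcd) as [gb Hgb]; [auto|].
assert (El : l = gb - ga).
{ apply (is_CRInt_unique _ _ _ _ _ Hl).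
  apply (is_RInt_ext (V := C_R_NormedModule) (fun t => minus (g b t : C_R_NormedModule) (g a t))).
  - intros t _; unfold g; change (minus (G := C_R_NormedModule) ?x ?y) with (x - y); C_eq; ring.
  - exact (is_RInt_minus (V := C_R_NormedModule) _ _ _ _ _ _ Hgb Hga). }
rewrite El; apply is_CRInt_iff in Hga, Hgb; apply is_CRInt_iff; split.
- replace (Re (gb - ga)) with (RInt (fun t => Re (g b t)) c d - RInt (fun t => Re (g a t)) c d)%R.
  2:{ rewrite (is_RInt_unique _ _ _ _ (proj1 Hga)), (is_RInt_unique _ _ _ _ (proj1 Hgb)); reflexivity. }
  apply (is_RInt_ext (fun u => RInt (fun t => Re (dg u t)) c d)).
  + rewrite Rmin_left, Rmax_right by assumption; intros u Hu.
    apply is_RInt_unique, (proj1 (proj1 (is_CRInt_iff _ _ _ _) (HdgI u ltac:(lra)))).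
  + apply (RInt_RInt_derive (fun u t => Re (g u t)) (fun u t => Re (dg u t))
      (fun u => (0 < u)%R) unit_interval); auto using positive_interval_like, unit_interval_like,
      positive_open, unit_interval_open.
    * intros u t Hu Ht; apply (proj1 (proj1 (is_Cderive_iff _ _ _) (Hder u t Hu Ht))).
    * intros u t Hu Ht; apply continuity_2d_pt_filterlim.
      apply (proj1 (proj1 (continuous_C _ _) (Hcont u t Hu Ht))).
    * intros u t Hu Ht; apply (proj1 (proj1 (continuous_C _ _) (Hg u t Hu Ht))).
- replace (Im (gb - ga)) with (RInt (fun t => Im (g b t)) c d - RInt (fun t => Im (g a t)) c d)%R.
  2:{ rewrite (is_RInt_unique _ _ _ _ (proj2 Hga)), (is_RInt_unique _ _ _ _ (proj2 Hgb)); reflexivity. }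
  apply (is_RInt_ext (fun u => RInt (fun t => Im (dg u t)) c d)).
  + rewrite Rmin_left, Rmax_right by assumption; intros u Hu.
    apply is_RInt_unique, (proj2 (proj1 (is_CRInt_iff _ _ _ _) (HdgI u ltac:(lra)))).
  + apply (RInt_RInt_derive (fun u t => Im (g u t)) (fun u t => Im (dg u t))
      (fun u => (0 < u)%R) unit_interval); auto using positive_interval_like, unit_interval_like,
      positive_open, unit_interval_open.
    * intros u t Hu Ht; apply (proj2 (proj1 (is_Cderive_iff _ _ _) (Hder u t Hu Ht))).
    * intros u t Hu Ht; apply continuity_2d_pt_filterlim.
      apply (proj2 (proj1 (continuous_C _ _) (Hcont u t Hu Ht))).
    * intros u t Hu Ht; apply (proj2 (proj1 (continuous_C _ _) (Hg u t Hu Ht))).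
Qed.

(** Total variation of [beta_primitive] between its limits at 0 and 1, hence a bound for the whole
    integral of the majorant. *)
Definition beta_total (p q : R) : R := (beta_const p q / p + beta_const p q / q)%R.

(** Two errors are separated. As [tau <= 1/4], the argument [b / tau] is at least [b], so
    [G (b / tau)] is within [delta] of [L]. In the bound of [G (a / tau)] the power [tau^(- Re s)]
    undoes the shift of the kernel, which is why that term involves the unshifted exponents [p'] and
    [q']. *)
Lemma mellin_limit_estimate (G : R -> C) (X Y s L : C) (M p q p' q' delta a b c d : R) (l B : C) :
  (forall v, (0 < v)%R -> (Cmod (G v) <= M * Rpower v (Re s))%R) ->
  (forall v, (b <= v)%R -> (Cmod (G v - L) <= delta)%R) ->
  (0 < p)%R -> (0 < q)%R -> (p <= Re (X + s))%R -> (q <= Re (Y + s))%R ->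
  (0 < p')%R -> (0 < q')%R -> (p' <= Re X)%R -> (q' <= Re Y)%R ->
  (0 <= M)%R ->
  (0 < a)%R -> (0 < b)%R -> (0 < c)%R -> (c <= d)%R -> (d < 1)%R ->
  is_CRInt (fun t => beta_kernel (X + s) (Y + s) t * (G (b / tau t)%R - G (a / tau t)%R)) c d l ->
  is_CRInt (beta_kernel (X + s) (Y + s)) c d B ->
  (Cmod (l - L * B) <= delta * beta_total p q + M * Rpower a (Re s) * beta_total p' q')%R.
Proof.
intros HM HL Hp Hq HX HY Hp' Hq' HX' HY' HM0 Ha Hb Hc Hcd Hd Hl HB.
assert (Hdel : (0 <= delta)%R).
{ eapply Rle_trans; [apply Cmod_ge_0|apply (HL b); lra]. }
assert (HR := Rpower_pos a (Re s)).
assert (HA : (0 <= M * Rpower a (Re s))%R) by nra.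
assert (Hin : forall t, (c <= t <= d)%R -> (0 < t < 1)%R) by (intros; lra).
assert (W : forall p q, (0 < p)%R -> (0 < q)%R ->
  (beta_primitive p q d - beta_primitive p q c <= beta_total p q)%R).
{ intros p0 q0 H1 H2; unfold beta_total.
  destruct (beta_primitive_bounds p0 q0 c) as [m1 _]; auto; [lra|].
  destruct (beta_primitive_bounds p0 q0 d) as [_ m2]; auto; lra. }
assert (Hdiff : is_CRInt (fun t => beta_kernel (X + s) (Y + s) t
                 * (G (b / tau t)%R - G (a / tau t)%R - L)) c d (l - L * B)).
{ apply (is_RInt_ext (V := C_R_NormedModule) (fun t => minus (G := C_R_NormedModule)
    (beta_kernel (X + s) (Y + s) t * (G (b / tau t)%R - G (a / tau t)%R))
    (L * beta_kernel (X + s) (Y + s) t))).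
  - intros t _; change (minus (G := C_R_NormedModule) ?x ?y) with (x - y); C_eq; ring.
  - exact (is_RInt_minus (V := C_R_NormedModule) _ _ _ _ _ _ Hl (is_CRInt_Cmult L _ _ _ _ HB)). }
apply Rle_trans with ((delta * beta_primitive p q d + M * Rpower a (Re s) * beta_primitive p' q' d)
   - (delta * beta_primitive p q c + M * Rpower a (Re s) * beta_primitive p' q' c))%R.
2:{ assert (W1 := W p q Hp Hq); assert (W2 := W p' q' Hp' Hq').
    apply (Rmult_le_compat_l delta) in W1; auto.
    apply (Rmult_le_compat_l (M * Rpower a (Re s))) in W2; auto; lra. }
apply (Cmod_CRInt_le_primitive
  (fun t => beta_kernel (X + s) (Y + s) t * (G (b / tau t)%R - G (a / tau t)%R - L))
  (fun t => delta * (beta_const p q * (Rpower t (p - 1) + Rpower (1 - t) (q - 1)))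
     + M * Rpower a (Re s) * (beta_const p' q' * (Rpower t (p' - 1) + Rpower (1 - t) (q' - 1))))%R
  (fun t => delta * beta_primitive p q t + M * Rpower a (Re s) * beta_primitive p' q' t)%R
  c d _ Hcd); [| | |exact Hdiff].
- intros t Ht; specialize (Hin t Ht); assert (T := tau_pos t Hin).
  replace (G (b / tau t)%R - G (a / tau t)%R - L)
    with ((G (b / tau t)%R - L) + - G (a / tau t)%R) by ring.
  rewrite Cmod_mult.
  apply Rle_trans with (Cmod (beta_kernel (X + s) (Y + s) t) * (delta + M * Rpower (a / tau t) (Re s)))%R.
  { apply Rmult_le_compat_l; [apply Cmod_ge_0|].
    eapply Rle_trans; [apply Cmod_triangle|]; rewrite Cmod_opp.
    apply Rplus_le_compat.
    - apply HL; apply Rmult_le_reg_r with (tau t); auto.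
      replace (b / tau t * tau t)%R with b by (field; lra).
      assert (K := tau_le t); nra.
    - apply HM; now apply Rdiv_lt_0_compat. }
  rewrite Rmult_plus_distr_l; apply Rplus_le_compat.
  + rewrite Rmult_comm; apply Rmult_le_compat_l; auto.
    rewrite Cmod_beta_kernel; eapply Rle_trans; [|apply beta_majorant_le; auto].
    apply beta_majorant_decr; auto.
  + replace (Cmod (beta_kernel (X + s) (Y + s) t) * (M * Rpower (a / tau t) (Re s)))%R
      with (M * Rpower a (Re s) * Cmod (beta_kernel X Y t))%R.
    * apply Rmult_le_compat_l; auto.
      rewrite Cmod_beta_kernel; eapply Rle_trans; [|apply beta_majorant_le; auto].
      apply beta_majorant_decr; auto.
    * rewrite beta_kernel_shift, Cmod_mult, Cmod_Rcpow by assumption; fold (tau t).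
      replace (Rpower a (Re s)) with (Rpower (a / tau t) (Re s) * Rpower (tau t) (Re s))%R; [ring|].
      rewrite Rpower_mult_distr by (auto; now apply Rdiv_lt_0_compat).
      f_equal; field; lra.
- intros t Ht; apply (is_derive_plus (V := R_NormedModule));
    apply is_derive_scal, is_derive_beta_primitive; auto.
- intros t Ht.
  apply (continuous_plus
    (fun t => delta * (beta_const p q * (Rpower t (p - 1) + Rpower (1 - t) (q - 1))))%R
    (fun t => M * Rpower a (Re s) * (beta_const p' q' * (Rpower t (p' - 1) + Rpower (1 - t) (q' - 1))))%R).
  + apply (continuous_mult (fun _ => delta)); [apply continuous_const|apply continuous_beta_bound; auto].
  + apply (continuous_mult (fun _ => M * Rpower a (Re s))%R);
      [apply continuous_const|apply continuous_beta_bound; auto].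
Qed.

(** * Series of complex numbers *)

Notation is_Cseries := (is_series (V := C_NormedModule)).
Definition csum (a : nat -> C) (N : nat) : C := sum_n (G := C_NormedModule) a N.

Lemma csum_O (a : nat -> C) : csum a 0 = a O.
Proof. apply (sum_O (G := C_NormedModule)). Qed.

Lemma csum_S (a : nat -> C) (N : nat) : csum a (S N) = csum a N + a (S N).
Proof. apply (sum_Sn (G := C_NormedModule)). Qed.

Lemma is_Cseries_csum (a : nat -> C) (l : C) :
  is_Cseries a l <-> filterlim (csum a) eventually (locally (T := C_UniformSpace) l).
Proof. reflexivity. Qed.

Lemma csum_minus (a b : nat -> C) (N : nat) :
  csum (fun n => a n - b n) N = csum a N - csum b N.
Proof.
induction N as [|N IH]; [rewrite !csum_O|rewrite !csum_S, IH]; ring.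
Qed.

Lemma csum_Cmult (c : C) (a : nat -> C) (N : nat) :
  csum (fun n => c * a n) N = c * csum a N.
Proof.
induction N as [|N IH]; [rewrite !csum_O|rewrite !csum_S, IH]; ring.
Qed.

Lemma Cmod_csum_le (a : nat -> C) (b : nat -> R) (N : nat) :
  (forall n, (Cmod (a n) <= b n)%R) -> (Cmod (csum a N) <= sum_n b N)%R.
Proof.
intros H; induction N as [|N IH].
- rewrite csum_O, sum_O; apply H.
- rewrite csum_S, sum_Sn; eapply Rle_trans; [apply Cmod_triangle|].
  now apply Rplus_le_compat.
Qed.

Lemma sum_n_le_series (b : nat -> R) (l : R) (N : nat) :
  (forall n, (0 <= b n)%R) -> is_series b l -> (sum_n b N <= l)%R.
Proof.
intros Hb Hl.
apply (filterlim_le (F := eventually) (fun _ => sum_n b N) (sum_n b) (Finite (sum_n b N)) (Finite l)).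
- exists N; intros m Hm; induction Hm as [|m Hm IH]; [lra|].
  rewrite sum_Sn; specialize (Hb (S m)); unfold plus; simpl; lra.
- apply filterlim_const.
- exact Hl.
Qed.

Lemma Cseries_tail_le (a : nat -> C) (b : nat -> R) (S : C) (l : R) (N : nat) :
  (forall n, (Cmod (a n) <= b n)%R) -> is_Cseries a S -> is_series b l ->
  (Cmod (S - csum a N) <= l - sum_n b N)%R.
Proof.
intros H Ha Hb.
assert (Hb0 : forall n, (0 <= b n)%R).
{ intros n; eapply Rle_trans; [apply Cmod_ge_0|apply H]. }
apply (Cmod_limit_le (F := eventually) (csum a)); [exact Ha|].
exists N; intros m Hm.
apply Rle_trans with (sum_n b m - sum_n b N)%R.
- induction Hm as [|m Hm IH].
  + replace (csum a N - csum a N) with (RtoC 0) by ring; rewrite Cmod_0; lra.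
  + rewrite csum_S, sum_Sn.
    replace (csum a m + a (Datatypes.S m) - csum a N)
      with ((csum a m - csum a N) + a (Datatypes.S m)) by ring.
    eapply Rle_trans; [apply Cmod_triangle|].
    specialize (H (Datatypes.S m)); unfold plus; simpl; lra.
- generalize (sum_n_le_series b l m Hb0 Hb); lra.
Qed.

Lemma is_Cseries_Cmult (c : C) (a : nat -> C) (l : C) :
  is_Cseries a l -> is_Cseries (fun n => c * a n) (c * l).
Proof. apply (is_series_scal (V := C_NormedModule)). Qed.

Lemma CSeries_unique (a : nat -> C) (l : C) : is_Cseries a l -> CSeries a = l.
Proof.
intros H; apply (iota_filterlim_locally (V := C_CompleteNormedModule) (sum_n (G := C_NormedModule) a)).
exact H.
Qed.

Lemma CSeries_correct (a : nat -> C) : ex_CSeries a -> is_Cseries a (CSeries a).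
Proof. intros [l Hl]; now rewrite (CSeries_unique a l). Qed.

Definition exp_term (z : C) (n : nat) : C := z ^ n / RtoC (INR (fact n)).

(* The factor [2^n] absorbs the linear growth of [ibp_const] in [n]. *)
Definition exp_bound (z : C) (n : nat) : R := ((2 * Cmod z) ^ n / INR (fact n))%R.

Lemma Cmod_exp_term (z : C) (n : nat) :
  Cmod (exp_term z n) = (Cmod z ^ n / INR (fact n))%R.
Proof.
assert (F := INR_fact_lt_0 n).
unfold exp_term; rewrite Cmod_div, Cmod_pow, Cmod_R, Rabs_pos_eq; [reflexivity|lra|].
intros K; apply RtoC_inj in K; lra.
Qed.

Lemma exp_bound_pow2 (z : C) (n : nat) :
  exp_bound z n = (2 ^ n * Cmod (exp_term z n))%R.
Proof. rewrite Cmod_exp_term; unfold exp_bound; rewrite Rpow_mult_distr; unfold Rdiv; ring. Qed.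

Lemma pow2_ge_S (n : nat) : (INR n + 1 <= 2 ^ n)%R.
Proof.
induction n as [|n IH]; [simpl; lra|].
rewrite S_INR; simpl; generalize (pos_INR n); lra.
Qed.

Lemma exp_bound_ge (z : C) (n : nat) : (Cmod (exp_term z n) <= exp_bound z n)%R.
Proof.
rewrite exp_bound_pow2, <- (Rmult_1_l (Cmod _)) at 1.
apply Rmult_le_compat_r; [apply Cmod_ge_0|].
generalize (pow2_ge_S n) (pos_INR n); lra.
Qed.

Lemma exp_bound_pos (z : C) (n : nat) : (0 <= exp_bound z n)%R.
Proof. eapply Rle_trans; [apply Cmod_ge_0|apply exp_bound_ge]. Qed.

Lemma is_series_exp_bound (z : C) : is_series (exp_bound z) (exp (2 * Cmod z)).
Proof.
generalize (is_exp_Reals (2 * Cmod z)); unfold is_pseries.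
apply is_series_ext; intros n; rewrite pow_n_pow; reflexivity.
Qed.

Lemma is_CRInt_csum (f : nat -> R -> C) (a b : R) (l : nat -> C) (N : nat) :
  (forall n, is_CRInt (f n) a b (l n)) ->
  is_CRInt (fun t => csum (fun n => f n t) N) a b (csum l N).
Proof.
intros H; induction N as [|N IH].
- rewrite csum_O; apply (is_RInt_ext (V := C_R_NormedModule) (f O)); [|apply H].
  intros t _; now rewrite csum_O.
- rewrite csum_S.
  apply (is_RInt_ext (V := C_R_NormedModule) (fun t => plus (G := C_R_NormedModule)
          (csum (fun n => f n t) N) (f (S N) t))).
  + intros t _; now rewrite csum_S.
  + exact (is_RInt_plus (V := C_R_NormedModule) _ _ _ _ _ _ IH (H (S N))).
Qed.

Lemma is_CRInt_uniform_limit (phi : nat -> R -> C) (g : R -> C) (h : nat -> C)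
    (err : nat -> R) (a b : R) :
  (a <= b)%R -> (forall N, is_CRInt (phi N) a b (h N)) ->
  (forall N t, (a <= t <= b)%R -> (Cmod (phi N t - g t) <= err N)%R) ->
  is_lim_seq err 0 ->
  exists I, filterlim h eventually (locally (T := C_UniformSpace) I) /\ is_CRInt g a b I.
Proof.
intros Hab Hphi Herr Hlim.
(* Outside the segment [phi N] is replaced by its limit, since [filterlim_RInt] takes uniform
   convergence on the whole line. *)
set (f := fun N t => if Rle_dec a t then if Rle_dec t b then phi N t else g t else g t).
apply (filterlim_RInt (V := C_R_CompleteNormedModule) f a b eventually _ g h).
- intros N; apply (is_CRInt_ext (phi N)); auto.
  intros t Ht; unfold f; destruct (Rle_dec a t), (Rle_dec t b); auto; lra.
- apply (filterlim_locally (U := fct_UniformSpace R C_UniformSpace)); intros eps.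
  destruct (proj1 (filterlim_locally _ _) Hlim eps) as [N0 HN0].
  exists N0; intros N HN t.
  unfold f; destruct (Rle_dec a t), (Rle_dec t b); try apply ball_center.
  apply (C_NormedModule_mixin_compat1 (g t) (phi N t) eps).
  apply Rle_lt_trans with (err N); [apply Herr; auto|].
  specialize (HN0 N HN).
  unfold ball in HN0; simpl in HN0; unfold AbsRing_ball in HN0; simpl in HN0.
  apply Rabs_def2 in HN0; unfold minus, plus, opp in HN0; simpl in HN0; lra.
Qed.

Lemma Cbounded_segment (f : R -> C) (a b : R) :
  (a <= b)%R -> (forall t, (a <= t <= b)%R -> Ccontinuous f t) ->
  exists M, (0 <= M)%R /\ forall t, (a <= t <= b)%R -> (Cmod (f t) <= M)%R.
Proof.
intros Hab Hf.
destruct (continuity_ab_maj (fun t => Cmod (f t)) a b Hab) as [m [Hm _]].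
- intros t Ht; apply continuity_pt_filterlim.
  exact (continuous_Cmod f t (Hf t Ht)).
- exists (Cmod (f m)); split; [apply Cmod_ge_0|exact Hm].
Qed.

(** * The Mellin transform of the beta integrals *)

Lemma ibp_const_shift (x y s : C) (n : nat) :
  (ibp_const (x + RtoC (INR n)) y s <= ibp_const x y s * 2 ^ n)%R.
Proof.
assert (K := pow2_ge_S n); assert (P := pos_INR n).
unfold ibp_const.
replace (x + RtoC (INR n) + s) with ((x + s) + RtoC (INR n)) by ring.
assert (T : (Cmod (x + s + RtoC (INR n)) <= Cmod (x + s) + INR n)%R).
{ eapply Rle_trans; [apply Cmod_triangle|]; rewrite Cmod_R, Rabs_pos_eq; lra. }
assert (A := Cmod_ge_0 (x + s)); assert (B := Cmod_ge_0 (y + s)).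
apply Rle_trans with ((2 * Cmod (x + s) + 2 * Cmod (y + s) + 8) * (INR n + 1))%R.
- nra.
- apply Rmult_le_compat_l; lra.
Qed.

(** Diagonal argument: [phi N] keeps the terms up to [N] and cuts each [t]-integral at [cutoff N].
    It converges uniformly to the integrand on [[a, b]], while its integral [h N] is computed
    exactly by the exchange on rectangles. Comparing [h N] with [L] times the partial sums of the
    beta series then estimates the limit. Every bound is [exp_bound z n] times a quantity
    independent of [n]. *)
Lemma mellin_beta_series_segment (F G : R -> C) (x y s z L : C) (M delta a b : R)
    (J : nat -> R -> C) (S : R -> C) (B : nat -> C) (T : C) :
  (0 < Re x)%R -> (0 < Re y)%R -> (0 < Re s)%R ->
  (forall v, (0 < v)%R -> Ccontinuous F v) ->
  (forall v, (0 < v)%R -> is_Cderive G v (Rcpow v (s - 1) * F v)) ->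
  (forall v, (0 < v)%R -> (Cmod (G v) <= M)%R) ->
  (forall v, (0 < v)%R -> (Cmod (G v) <= M * Rpower v (Re s))%R) ->
  (forall n rho, (0 < rho)%R -> is_RInt_gen (V := C_R_NormedModule)
     (convolution_kernel F (x + RtoC (INR n)) y rho) (at_right 0) (at_left 1) (J n rho)) ->
  (forall rho, (0 < rho)%R -> is_Cseries (fun n => exp_term z n * J n rho) (S rho)) ->
  (forall n, is_RInt_gen (V := C_R_NormedModule)
     (beta_kernel (x + RtoC (INR n) + s) (y + s)) (at_right 0) (at_left 1) (B n)) ->
  is_Cseries (fun n => exp_term z n * B n) T ->
  (0 < a)%R -> (a <= b)%R ->
  (forall v, (b <= v)%R -> (Cmod (G v - L) <= delta)%R) ->
  exists I, is_CRInt (fun rho => Rcpow rho (s - 1) * S rho) a b I /\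
    (Cmod (I - L * T) <= exp (2 * Cmod z)
       * (delta * beta_total (Re (x + s)) (Re (y + s))
          + M * Rpower a (Re s) * beta_total (Re x) (Re y)))%R.
Proof.
intros Hx Hy Hs HF HG HM HMs HJ HS HB HT Ha Hab HL.
set (xn := fun n => x + RtoC (INR n)).
assert (Hxn : forall n, (Re x <= Re (xn n))%R).
{ intros n; unfold xn, Re; simpl; generalize (pos_INR n); lra. }
assert (Hxns : forall n, (Re (x + s) <= Re (xn n + s))%R).
{ intros n; specialize (Hxn n); unfold Re in *; simpl in *; lra. }
set (p := Re (x + s)) in *; set (q := Re (y + s)).
assert (Hp : (0 < p)%R) by (unfold p, Re in *; simpl in *; lra).
assert (Hq : (0 < q)%R) by (unfold q, Re in *; simpl in *; lra).
set (c := cutoff); set (d := fun N => (1 - cutoff N)%R).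
assert (Hc : forall N, (0 < c N <= / 4)%R) by apply cutoff_bounds.
assert (Hd : forall N, (3 / 4 <= d N < 1)%R).
{ intros N; specialize (Hc N); unfold d, c in *; lra. }
assert (Hcd : forall N, (c N <= d N)%R).
{ intros N; specialize (Hc N); specialize (Hd N); lra. }
assert (Hin : forall N t, (c N <= t <= d N)%R -> (0 < t < 1)%R).
{ intros N t; specialize (Hc N); specialize (Hd N); lra. }
set (E := fun N => truncation_error p q (c N) (d N)).
assert (HE : is_lim_seq E 0) by (now apply truncation_error_cutoff).
assert (HM0 : (0 <= M)%R).
{ eapply Rle_trans; [apply Cmod_ge_0|apply (HM 1%R); lra]. }
set (I := fun n N rho => RInt (V := C_R_CompleteNormedModule)
            (convolution_kernel F (xn n) y rho) (c N) (d N)).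
assert (HI : forall n N rho, (0 < rho)%R ->
   is_CRInt (convolution_kernel F (xn n) y rho) (c N) (d N) (I n N rho)).
{ intros n N rho Hrho; apply (RInt_correct (V := C_R_CompleteNormedModule)).
  apply ex_CRInt_continuous; auto.
  intros t Ht; apply (continuous_convolution_kernel F (xn n) y (fun _ => rho) (fun u => u)); eauto.
  - apply continuous_const.
  - apply continuous_id. }
assert (Hbk : forall X Y N t, (c N <= t <= d N)%R -> Ccontinuous (beta_kernel X Y) t).
{ intros X Y N t Ht; apply (continuous_beta_kernel X Y (fun u => u)); eauto; apply continuous_id. }
set (Bt := fun n N => RInt (V := C_R_CompleteNormedModule)
             (beta_kernel (xn n + s) (y + s)) (c N) (d N)).
assert (HBt : forall n N, is_CRInt (beta_kernel (xn n + s) (y + s)) (c N) (d N) (Bt n N)).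
{ intros n N; apply (RInt_correct (V := C_R_CompleteNormedModule)), ex_CRInt_continuous; eauto. }
set (gd := fun n t => beta_kernel (xn n + s) (y + s) t * (G (b / tau t)%R - G (a / tau t)%R)).
set (D := fun n N => RInt (V := C_R_CompleteNormedModule) (gd n) (c N) (d N)).
assert (HD : forall n N, is_CRInt (gd n) (c N) (d N) (D n N)).
{ intros n N; apply (RInt_correct (V := C_R_CompleteNormedModule)), ex_CRInt_continuous; auto.
  intros t Ht; assert (H01 := Hin N t Ht); assert (Tt := tau_pos t H01).
  assert (CG : forall r, (0 < r)%R -> Ccontinuous (fun u => G (r / tau u)%R) t).
  { intros r Hr; apply (continuous_comp (fun u => r / tau u)%R G).
    - apply (continuous_div_tau (fun _ => r) (fun u => u)); auto;
        [apply continuous_const|apply continuous_id].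
    - eapply is_Cderive_continuous, HG; now apply Rdiv_lt_0_compat. }
  apply continuous_Cmult; [eapply Hbk; eauto|].
  apply (continuous_minus (V := C_R_NormedModule) (fun u => G (b / tau u)%R) (fun u => G (a / tau u)%R));
    apply CG; lra. }
set (A := ibp_const x y s).
assert (HA : (8 <= A)%R) by apply ibp_const_ge.
(* The truncation estimate carries the factor [rho^(Re s)]; on [[a, b]] it is smallest at [a], so
   [r0] removes it uniformly. *)
set (r0 := (/ Rpower a (Re s))%R).
assert (Hr0 : (0 < r0)%R) by apply Rinv_0_lt_compat, Rpower_pos.
assert (HEpos : forall N, (0 <= E N)%R).
{ intros N; unfold E, truncation_error.
  destruct (beta_primitive_bounds p q (c N)) as [m1 _]; auto; [split; specialize (Hc N); lra|].
  destruct (beta_primitive_bounds p q (d N)) as [_ m2]; auto; [split; specialize (Hd N); lra|].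
  generalize (Rpower_pos (c N) p) (Rpower_pos (1 - d N) q); lra. }
assert (HJI : forall n N rho, (a <= rho <= b)%R ->
   (Cmod (exp_term z n * J n rho - exp_term z n * I n N rho)
    <= r0 * M * A * E N * exp_bound z n)%R).
{ intros n N rho Hrho.
  replace (exp_term z n * J n rho - exp_term z n * I n N rho)
    with (exp_term z n * (J n rho - I n N rho)) by ring.
  rewrite Cmod_mult, exp_bound_pow2.
  assert (K : (Rpower rho (Re s) * Cmod (J n rho - I n N rho)
     <= M * ibp_const (xn n) y s * E N)%R).
  { apply (truncation_estimate F G (xn n) y s M p q rho (c N) (d N)); auto; try lra.
    - apply Rle_refl.
    - apply HJ; lra.
    - apply HI; lra. }
  assert (K1 : (Rpower a (Re s) <= Rpower rho (Re s))%R) by (apply Rle_Rpower_l; lra).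
  assert (K2 : (Rpower a (Re s) * Cmod (J n rho - I n N rho) <= M * (A * 2 ^ n) * E N)%R).
  { eapply Rle_trans; [|eapply Rle_trans; [exact K|]].
    - apply Rmult_le_compat_r; [apply Cmod_ge_0|exact K1].
    - apply Rmult_le_compat_r; auto; apply Rmult_le_compat_l; auto; apply ibp_const_shift. }
  assert (K3 : (Cmod (J n rho - I n N rho) <= r0 * (M * (A * 2 ^ n) * E N))%R).
  { apply Rmult_le_reg_l with (Rpower a (Re s)); [apply Rpower_pos|].
    unfold r0; rewrite <- (Rmult_assoc (Rpower a (Re s))), Rinv_r, Rmult_1_l; [exact K2|].
    generalize (Rpower_pos a (Re s)); lra. }
  apply Rle_trans with (Cmod (exp_term z n) * (r0 * (M * (A * 2 ^ n) * E N)))%R; [|lra].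
  apply Rmult_le_compat_l; [apply Cmod_ge_0|exact K3]. }
(* For [N = 0] the cutoffs are [1/4] and [3/4]; there [tau] lies between [1/6] and [1/4], so
   [rho / tau] stays in [[4 a, 6 b]]. *)
destruct (Cbounded_segment F (4 * a) (6 * b)) as [M2 [HM2 HF2]]; [lra| |].
{ intros t Ht; apply HF; lra. }
destruct (Cbounded_segment (beta_kernel x y) (c O) (d O)) as [M1 [HM1 HK1]]; eauto.
destruct (Cbounded_segment (fun v => Rcpow v (s - 1)) a b Hab) as [M3 [HM3 HP3]].
{ intros t Ht; apply (continuous_Rcpow (s - 1) (fun v => v)); [lra|apply continuous_id]. }
assert (HI0 : forall n rho, (a <= rho <= b)%R -> (Cmod (I n O rho) <= M1 * M2)%R).
{ intros n rho Hrho.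
  apply Rle_trans with ((d O - c O) * (M1 * M2))%R.
  2:{ assert (0 <= M1 * M2)%R by (now apply Rmult_le_pos).
      specialize (Hc O); specialize (Hd O); nra. }
  assert (K := HI n O rho ltac:(lra)).
  rewrite Cmod_norm.
  apply (norm_RInt_le_const (V := C_R_NormedModule) (convolution_kernel F (xn n) y rho)
           (c O) (d O)); auto.
  intros t Ht; rewrite <- Cmod_norm; assert (H01 := Hin O t Ht).
  unfold convolution_kernel; rewrite Cmod_mult.
  apply Rmult_le_compat; auto using Cmod_ge_0.
  - eapply Rle_trans; [|apply (HK1 t Ht)].
    rewrite !Cmod_beta_kernel; apply beta_majorant_decr; auto; lra.
  - assert (Tt := tau_pos t H01); assert (T4 := tau_le t).
    assert (T5 : (/ 6 <= tau t)%R).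
    { revert Ht; unfold c, d, cutoff; simpl; rewrite Rplus_0_l; intros Ht; unfold tau; nra. }
    apply HF2; split.
    + apply Rmult_le_reg_r with (tau t); auto.
      replace (rho / tau t * tau t)%R with rho by (field; lra); nra.
    + apply Rmult_le_reg_r with (tau t); auto.
      replace (rho / tau t * tau t)%R with rho by (field; lra); nra. }
(* A possibly conditional integral is bounded through its truncation at [N = 0]: the first summand
   is the truncation error, the second the truncated integral itself. The resulting domination of
   the series is uniform in [rho]. *)
set (C1 := (r0 * M * A * E O + M1 * M2)%R).
assert (HC1 : forall n rho, (a <= rho <= b)%R ->
   (Cmod (exp_term z n * J n rho) <= C1 * exp_bound z n)%R).
{ intros n rho Hrho.
  replace (exp_term z n * J n rho) with ((exp_term z n * J n rho - exp_term z n * I n O rho)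
     + exp_term z n * I n O rho) by ring.
  eapply Rle_trans; [apply Cmod_triangle|].
  unfold C1; rewrite Rmult_plus_distr_r; apply Rplus_le_compat; [now apply HJI|].
  rewrite Cmod_mult, Rmult_comm; apply Rmult_le_compat; auto using Cmod_ge_0, exp_bound_ge. }
assert (HEx := is_series_exp_bound z); set (X := exp (2 * Cmod z)) in *.
assert (HXN : forall N, (sum_n (exp_bound z) N <= X)%R).
{ intros N; apply sum_n_le_series; [apply exp_bound_pos|exact HEx]. }
assert (HXpos : (0 < X)%R) by apply exp_pos.
assert (Hscal : forall (k : R) N, (sum_n (fun n => k * exp_bound z n) N = k * sum_n (exp_bound z) N)%R).
{ intros k N; induction N as [|N IH]; [now rewrite !sum_O|].
  rewrite !sum_Sn, IH; unfold plus; simpl; ring. }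
set (phi := fun N rho => csum (fun n => exp_term z n * (Rcpow rho (s - 1) * I n N rho)) N).
set (h := fun N => csum (fun n => exp_term z n * D n N) N).
(* The first summand collects the truncation errors of the retained terms, the second is the tail of
   the series. *)
set (err := fun N => (M3 * (r0 * M * A * E N * X + C1 * (X - sum_n (exp_bound z) N)))%R).
destruct (is_CRInt_uniform_limit phi (fun rho => Rcpow rho (s - 1) * S rho) h err a b Hab)
  as [lim [Hlim Hint]].
- intros N; apply is_CRInt_csum; intros n; apply is_CRInt_Cmult.
  apply (mellin_convolution_exchange F G (xn n) y s a b (c N) (d N) (I n N)); auto.
  + apply Hc.
  + apply Hd.
  + apply HD.
- intros N rho Hrho.
  replace (phi N rho) with (Rcpow rho (s - 1) * csum (fun n => exp_term z n * I n N rho) N).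
  2:{ rewrite <- csum_Cmult; unfold phi, csum; apply (sum_n_ext (G := C_NormedModule)).
      intros n; C_eq; ring. }
  replace (_ - _) with (- (Rcpow rho (s - 1)
     * (csum (fun n => exp_term z n * J n rho - exp_term z n * I n N rho) N
        + (S rho - csum (fun n => exp_term z n * J n rho) N)))).
  2:{ rewrite csum_minus; ring. }
  rewrite Cmod_opp, Cmod_mult; unfold err.
  apply Rmult_le_compat; auto using Cmod_ge_0.
  eapply Rle_trans; [apply Cmod_triangle|]; apply Rplus_le_compat.
  + eapply Rle_trans.
    * apply (Cmod_csum_le _ (fun n => r0 * M * A * E N * exp_bound z n)%R); auto.
    * rewrite Hscal; apply Rmult_le_compat_l; auto.
      repeat apply Rmult_le_pos; auto; lra.
  + rewrite Rmult_minus_distr_l, <- Hscal.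
    apply (Cseries_tail_le (fun n => exp_term z n * J n rho)); auto.
    * apply HS; lra.
    * exact (is_series_scal_l C1 _ _ HEx).
- unfold err.
  replace (Finite 0) with (Finite (M3 * (r0 * M * A * 0 * X + C1 * (X - X)))%R) by (f_equal; ring).
  apply (is_lim_seq_scal_l _ M3 (Finite _)), is_lim_seq_plus'.
  + apply (is_lim_seq_scal_r _ X (Finite _)), (is_lim_seq_scal_l _ _ (Finite _)), HE.
  + apply (is_lim_seq_scal_l _ C1 (Finite _)), is_lim_seq_minus'; [apply is_lim_seq_const|].
    exact HEx.
- exists lim; split; [exact Hint|].
  set (eta := (delta * beta_total p q + M * Rpower a (Re s) * beta_total (Re x) (Re y))%R).
  assert (HDB : forall n N, (Cmod (D n N - L * Bt n N) <= eta)%R).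
  { intros n N; apply (mellin_limit_estimate G (xn n) y s L M p q (Re x) (Re y) delta a b (c N) (d N));
      auto; try apply Rle_refl; try apply Hc; try apply Hd; try apply HD; lra. }
  assert (HBB : forall n N, (Cmod (Bt n N - B n) <= E N)%R).
  { intros n N; rewrite <- Cmod_opp; replace (- (Bt n N - B n)) with (B n - Bt n N) by ring.
    apply (beta_truncation_estimate (xn n + s) (y + s) p q (c N) (d N)); auto;
      try apply Rle_refl; [specialize (Hc N)|specialize (Hd N)|apply HB]; lra. }
  (* Each term is compared in two stages: the exchanged integral with [L] times the truncated beta
     integral, then the latter with the full one. Only the second error tends to 0 with [N]; the
     first depends on [a] and [b] and remains in the conclusion. *)
  assert (HhT : forall N, (Cmod (h N - L * csum (fun n => exp_term z n * B n)%C N)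
                  <= X * eta + X * Cmod L * E N)%R).
  { intros N; unfold h; rewrite <- csum_Cmult, <- csum_minus.
    apply Rle_trans with ((eta + Cmod L * E N) * sum_n (exp_bound z) N)%R.
    - rewrite <- Hscal; apply Cmod_csum_le; intros n.
      replace (exp_term z n * D n N - L * (exp_term z n * B n))
        with (exp_term z n * ((D n N - L * Bt n N) + L * (Bt n N - B n))) by ring.
      rewrite Cmod_mult, Rmult_comm; apply Rmult_le_compat; auto using Cmod_ge_0, exp_bound_ge.
      eapply Rle_trans; [apply Cmod_triangle|]; apply Rplus_le_compat; auto.
      rewrite Cmod_mult; apply Rmult_le_compat_l; auto using Cmod_ge_0.
    - replace (X * eta + X * Cmod L * E N)%R with ((eta + Cmod L * E N) * X)%R by ring.
      apply Rmult_le_compat_l; auto.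
      apply Rplus_le_le_0_compat.
      + eapply Rle_trans; [apply Cmod_ge_0|apply (HDB O O)].
      + apply Rmult_le_pos; auto using Cmod_ge_0. }
  apply le_epsilon; intros eps Heps.
  replace (lim - L * T) with (lim - L * T - 0) by ring.
  apply (Cmod_limit_le (F := eventually)
           (fun N => h N - L * csum (fun n => exp_term z n * B n) N)).
  + apply filterlim_Cminus; [exact Hlim|].
    generalize (is_Cseries_Cmult L _ _ HT); intros K.
    apply is_Cseries_csum in K; revert K; apply filterlim_ext; intros N; apply csum_Cmult.
  + assert (HlE : is_lim_seq (fun N => X * Cmod L * E N)%R 0).
    { replace (Finite 0) with (Finite (X * Cmod L * 0)%R) by (f_equal; ring).
      exact (is_lim_seq_scal_l E (X * Cmod L) (Finite 0) HE). }
    destruct (proj1 (filterlim_locally _ _) HlE (mkposreal eps Heps)) as [N0 HN0].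
    exists N0; intros N HN; specialize (HN0 N HN); specialize (HhT N).
    unfold ball in HN0; simpl in HN0; unfold AbsRing_ball in HN0; simpl in HN0.
    apply Rabs_def2 in HN0; unfold minus, plus, opp in HN0; simpl in HN0.
    replace (h N - L * csum (fun n => exp_term z n * B n) N - 0)
      with (h N - L * csum (fun n => exp_term z n * B n) N) by ring.
    lra.
Qed.

(** * From compact segments to the half-line *)

Notation p_oo := (Rbar_locally p_infty).

Lemma positive_at_right : at_right 0 (fun t => (0 < t)%R).
Proof. exists (mkposreal 1 Rlt_0_1); intros t _ Ht; exact Ht. Qed.

Lemma positive_p_oo : p_oo (fun t => (0 < t)%R).
Proof. exists 0%R; auto. Qed.

(** Subtracting its limit at 0 normalises the primitive. On [(0, 1]] boundedness of [F] gives the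
    bound by [v^(Re s)]; beyond 1 boundedness comes from compactness and from the limit [L], even if
    the integral converges conditionally. A single [M] serves both bounds because [v^(Re s)] is at
    most 1 on the first range and at least 1 on the second. *)
Lemma ex_mellin_primitive (F : R -> C) (s L : C) :
  (0 < Re s)%R -> (forall v, (0 <= v)%R -> Ccontinuous F v) ->
  is_RInt_0_oo (fun t => Rcpow t (s - 1) * F t) L ->
  exists (G : R -> C) (M : R),
    (forall v, (0 < v)%R -> is_Cderive G v (Rcpow v (s - 1) * F v)) /\
    (forall v, (0 < v)%R -> (Cmod (G v) <= M)%R) /\
    (forall v, (0 < v)%R -> (Cmod (G v) <= M * Rpower v (Re s))%R) /\
    filterlim G p_oo (locally (T := C_UniformSpace) L).
Proof.
intros Hs HF HL.
set (f := fun t => Rcpow t (s - 1) * F t).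
assert (Hf : forall t, (0 < t)%R -> Ccontinuous f t).
{ intros t Ht; apply continuous_Cmult; [|apply HF; lra].
  apply (continuous_Rcpow (s - 1) (fun u => u)); auto; apply continuous_id. }
destruct (ex_primitive_on (fun t => (0 < t)%R) f 1) as [P [HP _]];
  [exact positive_interval_like|lra|exact Hf|].
destruct (primitive_limits _ f P L HP positive_at_right positive_p_oo HL)
  as [la [lb [Ha [Hb EL]]]].
set (G := fun v => P v - la).
assert (HG : forall v, (0 < v)%R -> is_Cderive G v (f v)).
{ intros v Hv; evar_last.
  - apply (is_derive_minus (V := C_R_NormedModule) P (fun _ => la)).
    + apply (is_primitive_on_derive _ f P v HP); auto using positive_open.
    + apply (is_derive_const (V := C_R_NormedModule)).
  - change (f v - RtoC 0 = f v); ring. }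
assert (HGlim : filterlim G p_oo (locally (T := C_UniformSpace) L)).
{ rewrite EL; apply filterlim_Cminus; [exact Hb|apply filterlim_const]. }
destruct (Cbounded_segment F 0 1) as [M0 [HM0 HF0]]; [lra|intros; apply HF; lra|].
assert (H0 : forall v, (0 < v <= 1)%R -> (Cmod (G v) <= M0 / Re s * Rpower v (Re s))%R).
{ intros v Hv; rewrite <- Cmod_opp; unfold G.
  replace (- (P v - la)) with (la - P v) by ring.
  apply (Cmod_limit_le (F := at_right 0) P); [exact Ha|].
  exists (mkposreal v (proj1 Hv)); intros u Hu Hu0.
  apply Rabs_def2 in Hu; unfold minus, plus, opp in Hu; simpl in Hu.
  replace (P u - P v) with (- (P v - P u)) by ring; rewrite Cmod_opp.
  apply Rle_trans with (M0 / Re s * Rpower v (Re s) - M0 / Re s * Rpower u (Re s))%R.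
  2:{ assert (0 <= M0 / Re s * Rpower u (Re s))%R; [|lra].
      apply Rmult_le_pos; [|left; apply Rpower_pos].
      apply Rmult_le_pos; [exact HM0|left; now apply Rinv_0_lt_compat]. }
  apply (Cmod_CRInt_le_primitive f (fun t => M0 * Rpower t (Re s - 1))%R
           (fun t => M0 / Re s * Rpower t (Re s))%R u v); [lra| | | |apply HP; lra].
  - intros t Ht; unfold f; rewrite Cmod_mult, Cmod_Rcpow, Rmult_comm.
    apply Rmult_le_compat; auto using Cmod_ge_0.
    + left; apply Rpower_pos.
    + apply HF0; lra.
    + right; f_equal; unfold Re; simpl; ring.
  - intros t Ht; evar_last.
    + apply is_derive_scal, is_derive_Rpower; lra.
    + field; lra.
  - intros t Ht; apply (continuous_mult (fun _ => M0)); [apply continuous_const|].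
    apply (continuous_Rpower (Re s - 1) (fun u => u)); [lra|apply continuous_id]. }
destruct (proj1 (filterlim_Cmod G L) HGlim (mkposreal 1 Rlt_0_1)) as [V HV].
destruct (Cbounded_segment G 1 (Rmax 1 V)) as [M1 [HM1 HG1]].
{ apply Rmax_l. }
{ intros t Ht; eapply is_Cderive_continuous, HG; lra. }
set (M := (M0 / Re s + M1 + Cmod L + 1)%R).
assert (K0 : (0 <= M0 / Re s)%R).
{ apply Rmult_le_pos; [exact HM0|left; now apply Rinv_0_lt_compat]. }
assert (KL := Cmod_ge_0 L).
assert (HMbig : forall v, (1 <= v)%R -> (Cmod (G v) <= M)%R).
{ intros v Hv; destruct (Rle_dec v (Rmax 1 V)) as [H|H].
  - eapply Rle_trans; [apply HG1; split; auto|unfold M; lra].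
  - assert (HvV : (V < v)%R) by (generalize (Rmax_r 1 V); lra).
    specialize (HV v HvV); simpl in HV.
    replace (G v) with ((G v - L) + L) by ring.
    eapply Rle_trans; [apply Cmod_triangle|unfold M; lra]. }
exists G, M; split; [exact HG|split; [|split; [|exact HGlim]]].
- intros v Hv; destruct (Rle_dec v 1) as [H|H]; [|apply HMbig; lra].
  eapply Rle_trans; [apply H0; lra|].
  apply Rle_trans with (M0 / Re s * 1)%R; [|unfold M; lra].
  apply Rmult_le_compat_l; auto.
  destruct H as [H|H]; [apply Rpower_le_1; lra|].
  rewrite H; unfold Rpower; rewrite ln_1, Rmult_0_r, exp_0; lra.
- intros v Hv; destruct (Rle_dec v 1) as [H|H].
  + eapply Rle_trans; [apply H0; lra|].
    apply Rmult_le_compat_r; [left; apply Rpower_pos|unfold M; lra].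
  + eapply Rle_trans; [apply HMbig; lra|].
    rewrite <- (Rmult_1_r M) at 1; apply Rmult_le_compat_l; [unfold M; lra|].
    apply Rle_trans with (Rpower v 0); [rewrite Rpower_O; lra|apply Rle_Rpower; lra].
Qed.

Lemma beta_total_pos (p q : R) : (0 < p)%R -> (0 < q)%R -> (0 < beta_total p q)%R.
Proof.
intros Hp Hq; unfold beta_total; assert (K := beta_const_pos p q).
apply Rplus_lt_0_compat; apply Rdiv_lt_0_compat; auto.
Qed.

Lemma mellin_beta_series (F : R -> C) (x y s z L : C)
    (J : nat -> R -> C) (S : R -> C) (B : nat -> C) (T : C) :
  (0 < Re x)%R -> (0 < Re y)%R -> (0 < Re s)%R ->
  (forall v, (0 <= v)%R -> Ccontinuous F v) ->
  is_RInt_0_oo (fun t => Rcpow t (s - 1) * F t) L ->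
  (forall n rho, (0 < rho)%R -> is_RInt_gen (V := C_R_NormedModule)
     (convolution_kernel F (x + RtoC (INR n)) y rho) (at_right 0) (at_left 1) (J n rho)) ->
  (forall rho, (0 < rho)%R -> is_Cseries (fun n => exp_term z n * J n rho) (S rho)) ->
  (forall n, is_RInt_gen (V := C_R_NormedModule)
     (beta_kernel (x + RtoC (INR n) + s) (y + s)) (at_right 0) (at_left 1) (B n)) ->
  is_Cseries (fun n => exp_term z n * B n) T ->
  is_RInt_0_oo (fun rho => Rcpow rho (s - 1) * S rho) (L * T).
Proof.
intros Hx Hy Hs HF HL HJ HS HB HT.
destruct (ex_mellin_primitive F s L Hs HF HL) as [G [M [HG [HM [HMs HGl]]]]].
assert (HM0 : (0 <= M)%R).
{ eapply Rle_trans; [apply Cmod_ge_0|apply (HM 1%R); lra]. }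
assert (W1 : (0 < beta_total (Re (x + s)) (Re (y + s)))%R).
{ apply beta_total_pos; unfold Re in *; simpl in *; lra. }
assert (W2 := beta_total_pos (Re x) (Re y) Hx Hy).
assert (HX := exp_pos (2 * Cmod z)).
apply filterlimi_Cmod; intros eps.
set (X := exp (2 * Cmod z)) in *.
set (w1 := beta_total (Re (x + s)) (Re (y + s))) in *.
set (w2 := beta_total (Re x) (Re y)) in *.
assert (He := cond_pos eps).
assert (Hd : (0 < eps / (2 * X * w1))%R).
{ apply Rdiv_lt_0_compat; auto; repeat apply Rmult_lt_0_compat; lra. }
(* Each of the two errors is given half of [eps]; [M + 1] in place of [M] keeps the denominator
   positive when [M = 0]. *)
assert (He2 : (0 < eps / (2 * X * (M + 1) * w2))%R).
{ apply Rdiv_lt_0_compat; auto; repeat apply Rmult_lt_0_compat; lra. }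
destruct (proj1 (filterlim_Cmod G L) HGl (mkposreal _ Hd)) as [V HV]; simpl in HV.
assert (H0 := proj1 (filterlim_locally _ _) (filterlim_Rpower_0 (Re s) Hs) (mkposreal _ He2)).
exists (fun a => unit_interval a /\ (ball 0 (mkposreal _ He2) (Rpower a (Re s))))
       (fun b => 1 < b /\ V < b)%R.
- apply filter_and; [apply unit_interval_at_right|exact H0].
- apply filter_and; [exists 1%R|exists V]; auto.
- intros a b [Ha1 Ha2] [Hb1 Hb2]; simpl.
  destruct (mellin_beta_series_segment F G x y s z L M (eps / (2 * X * w1)) a b J S B T)
    as [I [HI1 HI2]]; auto.
  + intros v Hv; apply HF; lra.
  + apply Ha1.
  + unfold unit_interval in Ha1; lra.
  + intros v Hv; left; apply HV; lra.
  + exists I; split; [exact HI1|].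
    eapply Rle_lt_trans; [exact HI2|]; fold X w1 w2.
    unfold ball in Ha2; simpl in Ha2; unfold AbsRing_ball in Ha2; simpl in Ha2.
    apply Rabs_def2 in Ha2; unfold minus, plus, opp in Ha2; simpl in Ha2.
    assert (Ha3 := Rpower_pos a (Re s)); set (r := Rpower a (Re s)) in *.
    replace (X * (eps / (2 * X * w1) * w1 + M * r * w2))%R
      with (eps / 2 + X * M * w2 * r)%R by (field; lra).
    assert (K : (X * M * w2 * r <= X * (M + 1) * w2 * r)%R).
    { apply Rmult_le_compat_r; [lra|].
      apply Rmult_le_compat_r; [lra|]; apply Rmult_le_compat_l; lra. }
    assert (K2 : (X * (M + 1) * w2 * r < X * (M + 1) * w2 * (eps / (2 * X * (M + 1) * w2)))%R).
    { apply Rmult_lt_compat_l; [repeat apply Rmult_lt_0_compat; lra|lra]. }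
    replace (X * (M + 1) * w2 * (eps / (2 * X * (M + 1) * w2)))%R with (eps / 2)%R in K2
      by (field; lra).
    lra.
Qed.

(** * Power series with complex coefficients *)

(** At a real argument the real and imaginary parts are two real power series, so continuity follows
    from their radii of convergence. *)
Definition Cpseries (c : nat -> C) (u : R) : C :=
  (PSeries (fun m => Re (c m)) u, PSeries (fun m => Im (c m)) u).

Lemma is_Cseries_components (a : nat -> C) (l : C) :
  is_Cseries a l -> is_series (fun n => Re (a n)) (Re l) /\ is_series (fun n => Im (a n)) (Im l).
Proof.
intros H.
assert (K : forall f : nat -> C, (forall N, sum_n (fun n => Re (f n)) N = Re (csum f N)) /\
                              (forall N, sum_n (fun n => Im (f n)) N = Im (csum f N))).
{ intros f; split; intros N; (induction N as [|N IH];
    [rewrite sum_O, csum_O; reflexivity|rewrite sum_Sn, csum_S, IH; reflexivity]). }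
assert (Hc := proj1 (filterlim_Cmod _ _) (proj1 (is_Cseries_csum a l) H)).
split; apply filterlim_locally; intros eps; generalize (Hc eps); apply filter_imp; intros N HN;
  unfold ball; simpl; unfold AbsRing_ball; simpl.
- rewrite (proj1 (K a)); eapply Rle_lt_trans; [|exact HN].
  exact (re_le_Cmod (csum a N - l)).
- rewrite (proj2 (K a)); eapply Rle_lt_trans; [|exact HN].
  eapply Rle_trans; [|apply Rmax_Cmod]; exact (Rmax_r _ _).
Qed.

Lemma ex_series_CV_radius (a : nat -> R) (x : R) :
  ex_series (fun n => a n * x ^ n)%R -> Rbar_le (Rabs x) (CV_radius a).
Proof.
intros H; apply Rbar_not_lt_le; intros K.
apply (CV_disk_outside a x K), ex_series_lim_0, H.
Qed.

Lemma CSeries_Cpseries (c : nat -> C) (u : R) :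
  ex_CSeries (fun m => c m * RtoC u ^ m) -> CSeries (fun m => c m * RtoC u ^ m) = Cpseries c u.
Proof.
intros H; assert (K := is_Cseries_components _ _ (CSeries_correct _ H)).
destruct K as [K1 K2].
rewrite (surjective_pairing (CSeries _)); unfold Cpseries, PSeries; f_equal; symmetry.
- apply is_series_unique; revert K1; apply is_series_ext; intros n.
  rewrite <- RtoC_pow; simpl; unfold Re; ring.
- apply is_series_unique; revert K2; apply is_series_ext; intros n.
  rewrite <- RtoC_pow; simpl; unfold Im; ring.
Qed.

(** Convergence along the negative half-axis alone forces infinite radius: convergence at
    [- (|x| + 1)] already puts [x] strictly inside the disk. *)
Lemma continuous_Cpseries (c : nat -> C) (x : R) :
  (forall u, (u < 0)%R -> ex_CSeries (fun m => c m * RtoC u ^ m)) ->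
  Ccontinuous (Cpseries c) x.
Proof.
intros H.
assert (Hu : (- (Rabs x + 1) < 0)%R) by (generalize (Rabs_pos x); lra).
assert (K := is_Cseries_components _ _ (CSeries_correct _ (H _ Hu))); destruct K as [K1 K2].
assert (E : Rabs (- (Rabs x + 1)) = (Rabs x + 1)%R).
{ rewrite Rabs_Ropp; apply Rabs_pos_eq; generalize (Rabs_pos x); lra. }
apply continuous_C; split; apply continuity_pt_filterlim, PSeries_continuity.
- apply Rbar_lt_le_trans with (Finite (Rabs x + 1)); [simpl; lra|].
  rewrite <- E; apply ex_series_CV_radius; refine (ex_intro _ _ (is_series_ext _ _ _ _ K1)); intros n.
  rewrite <- RtoC_pow; simpl; unfold Re; ring.
- apply Rbar_lt_le_trans with (Finite (Rabs x + 1)); [simpl; lra|].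
  rewrite <- E; apply ex_series_CV_radius; refine (ex_intro _ _ (is_series_ext _ _ _ _ K2)); intros n.
  rewrite <- RtoC_pow; simpl; unfold Im; ring.
Qed.

(** * The beta function *)

Lemma is_primitive_on_intro (D : R -> Prop) (f G : R -> C) :
  interval_like D -> (forall t, D t -> is_Cderive G t (f t)) ->
  (forall t, D t -> Ccontinuous f t) -> is_primitive_on D f G.
Proof.
intros HD HG Hf a b Ha Hb.
assert (K : forall t, (Rmin a b <= t <= Rmax a b)%R -> D t).
{ intros t; unfold Rmin, Rmax; destruct (Rle_dec a b); intros Ht;
    [apply (HD a b)|apply (HD b a)]; auto. }
apply (is_RInt_derive (V := C_R_CompleteNormedModule) G f); auto.
Qed.

Lemma filterlim_C0_le {T : Type} {F : (T -> Prop) -> Prop} {FF : Filter F}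
    (f : T -> C) (h : T -> R) :
  F (fun x => (Cmod (f x) <= h x)%R) -> filterlim h F (locally 0%R) ->
  filterlim f F (locally (T := C_UniformSpace) (RtoC 0)).
Proof.
intros Hf Hh; apply filterlim_Cmod; intros eps.
generalize (filter_and _ _ Hf (proj1 (filterlim_locally _ _) Hh eps)); apply filter_imp.
intros x [H1 H2].
unfold ball in H2; simpl in H2; unfold AbsRing_ball in H2; simpl in H2.
apply Rabs_def2 in H2; unfold minus, plus, opp in H2; simpl in H2.
replace (f x - RtoC 0) with (f x) by ring; lra.
Qed.

Lemma is_RInt_gen_Beta (X Y : C) :
  (0 < Re X)%R -> (0 < Re Y)%R ->
  is_RInt_gen (V := C_R_NormedModule) (beta_kernel X Y) (at_right 0) (at_left 1) (Beta X Y).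
Proof.
intros HX HY.
destruct (ex_primitive_on unit_interval (beta_kernel X Y) (/ 2)) as [P [HP _]].
- exact unit_interval_like.
- unfold unit_interval; lra.
- intros t Ht; apply (continuous_beta_kernel X Y (fun u => u)); auto; apply continuous_id.
- assert (Hm : forall u v, unit_interval u -> unit_interval v -> (u <= v)%R ->
     (Cmod (P v - P u) <= beta_primitive (Re X) (Re Y) v - beta_primitive (Re X) (Re Y) u)%R).
  { intros u v Hu Hv Huv.
    rewrite <- (Rmult_1_l (beta_primitive _ _ v - beta_primitive _ _ u)).
    apply (Cmod_CRInt_beta (beta_kernel X Y) (Re X) (Re Y) 1 u v); auto;
      try apply Hu; try apply Hv; try lra.
    intros t Ht; rewrite Cmod_beta_kernel; lra. }
  destruct (filterlim_Cmajorized unit_interval P _ _ unit_interval_at_right Hm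
              (filterlim_beta_primitive_0 _ _ HX HY)) as [la Ha].
  destruct (filterlim_Cmajorized unit_interval P _ _ unit_interval_at_left Hm
              (filterlim_beta_primitive_1 _ _ HX HY)) as [lb Hb].
  assert (K := is_RInt_gen_primitive unit_interval _ P la lb HP
                 unit_interval_at_right unit_interval_at_left Ha Hb).
  change (Beta X Y) with (RInt_gen (V := C_R_CompleteNormedModule)
    (beta_kernel X Y) (at_right 0) (at_left 1)).
  apply (RInt_gen_correct (V := C_R_CompleteNormedModule)); now exists (lb - la).
Qed.

(** Two linear relations are combined: [E1] integrates [t + (1 - t) = 1] against the kernel, and
    [E2] integrates the derivative of [t^X (1 - t)^Y], which vanishes at both ends. *)
Lemma Beta_succ (X Y : C) :
  (0 < Re X)%R -> (0 < Re Y)%R -> (X + Y) * Beta (X + 1) Y = X * Beta X Y.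
Proof.
intros HX HY.
assert (HX1 : (0 < Re (X + 1))%R) by (unfold Re in *; simpl; lra).
assert (HY1 : (0 < Re (Y + 1))%R) by (unfold Re in *; simpl; lra).
assert (B0 := is_RInt_gen_Beta X Y HX HY).
assert (Bl := is_RInt_gen_Beta (X + 1) Y HX1 HY).
assert (Br := is_RInt_gen_Beta X (Y + 1) HX HY1).
assert (U : filter_prod (at_right 0) (at_left 1) (fun ab => forall t,
   (Rmin (fst ab) (snd ab) < t < Rmax (fst ab) (snd ab))%R -> unit_interval t)).
{ exists unit_interval unit_interval; [apply unit_interval_at_right|apply unit_interval_at_left|].
  intros a b Ha Hb t; simpl; unfold Rmin, Rmax, unit_interval in *; destruct (Rle_dec a b); lra. }
assert (E1 : Beta X Y = Beta (X + 1) Y + Beta X (Y + 1)).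
{ assert (K := is_RInt_gen_plus (V := C_R_NormedModule) _ _ _ _ Bl Br).
  apply (is_RInt_gen_ext (V := C_R_NormedModule) _ (beta_kernel X Y)) in K.
  - rewrite <- (is_RInt_gen_unique (V := C_R_CompleteNormedModule) _ _ B0).
    apply (is_RInt_gen_unique (V := C_R_CompleteNormedModule)), K.
  - generalize U; apply filter_imp; intros ab Hab t Ht.
    change (beta_kernel (X + 1) Y t + beta_kernel X (Y + 1) t = beta_kernel X Y t).
    rewrite beta_kernel_Sl, beta_kernel_Sr, RtoC_minus by (apply (Hab t Ht)); ring. }
assert (E2 : X * Beta X (Y + 1) - Y * Beta (X + 1) Y = RtoC 0).
{ assert (K := is_RInt_gen_minus (V := C_R_NormedModule) _ _ _ _
     (is_RInt_gen_Cmult X _ _ Br) (is_RInt_gen_Cmult Y _ _ Bl)).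
  assert (P : is_primitive_on unit_interval
     (fun t => X * beta_kernel X (Y + 1) t - Y * beta_kernel (X + 1) Y t)
     (beta_kernel (X + 1) (Y + 1))).
  { apply is_primitive_on_intro; [apply unit_interval_like|apply is_Cderive_beta_kernel|].
    assert (Cb : forall A B t, unit_interval t -> Ccontinuous (beta_kernel A B) t).
    { intros A B t Ht; apply (continuous_beta_kernel A B (fun u => u)); auto; apply continuous_id. }
    intros t Ht; apply (continuous_minus (V := C_R_NormedModule)
      (fun u => X * beta_kernel X (Y + 1) u) (fun u => Y * beta_kernel (X + 1) Y u));
      apply continuous_Cmult; auto using continuous_Cconst. }
  assert (N : forall t, unit_interval t ->
     (Cmod (beta_kernel (X + 1) (Y + 1) t) <= Rpower t (Re X))%R /\
     (Cmod (beta_kernel (X + 1) (Y + 1) t) <= Rpower (1 - t) (Re Y))%R).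
  { intros t Ht; rewrite Cmod_beta_kernel; apply beta_majorant_S_le; auto. }
  assert (L0 : filterlim (beta_kernel (X + 1) (Y + 1)) (at_right 0)
                 (locally (T := C_UniformSpace) (RtoC 0))).
  { apply (filterlim_C0_le _ (fun t => Rpower t (Re X))).
    - generalize unit_interval_at_right; apply filter_imp; intros t Ht; apply N, Ht.
    - now apply filterlim_Rpower_0. }
  assert (L1 : filterlim (beta_kernel (X + 1) (Y + 1)) (at_left 1)
                 (locally (T := C_UniformSpace) (RtoC 0))).
  { apply (filterlim_C0_le _ (fun t => Rpower (1 - t) (Re Y))).
    - generalize unit_interval_at_left; apply filter_imp; intros t Ht; apply N, Ht.
    - exact (filterlim_comp _ _ _ (fun t => 1 - t)%R (fun t => Rpower t (Re Y)) _ _ _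
         filterlim_1_minus_left (filterlim_Rpower_0 (Re Y) HY)). }
  assert (K' := is_RInt_gen_primitive _ _ _ _ _ P unit_interval_at_right unit_interval_at_left L0 L1).
  transitivity (RtoC 0 - RtoC 0); [|ring].
  rewrite <- (is_RInt_gen_unique (V := C_R_CompleteNormedModule) _ _ K').
  symmetry; apply (is_RInt_gen_unique (V := C_R_CompleteNormedModule)), K. }
rewrite E1, Cmult_plus_distr_l.
replace (X * Beta X (Y + 1)) with (Y * Beta (X + 1) Y).
- ring.
- transitivity (X * Beta X (Y + 1) - (X * Beta X (Y + 1) - Y * Beta (X + 1) Y)); [ring|].
  rewrite E2; ring.
Qed.

(** * The gamma function on the right half-plane *)

Definition gamma_kernel (a : C) (t : R) : C := Rcpow t (a - 1) * RtoC (exp (- t)).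

Lemma Cmod_gamma_kernel (a : C) (t : R) :
  Cmod (gamma_kernel a t) = (Rpower t (Re a - 1) * exp (- t))%R.
Proof.
unfold gamma_kernel; rewrite Cmod_mult, Cmod_Rcpow, Cmod_R, Rabs_pos_eq by (left; apply exp_pos).
f_equal; f_equal; unfold Re; simpl; ring.
Qed.

Lemma continuous_gamma_kernel (a : C) (t : R) : (0 < t)%R -> Ccontinuous (gamma_kernel a) t.
Proof.
intros Ht; apply continuous_Cmult.
- apply (continuous_Rcpow (a - 1) (fun u => u)); auto; apply continuous_id.
- apply continuous_RtoC, (ex_derive_continuous (V := R_NormedModule)); auto_derive; auto.
Qed.

Lemma ln_le_sub_1 (u : R) : (0 < u)%R -> (ln u <= u - 1)%R.
Proof. intros Hu; generalize (exp_ineq1_le (ln u)); rewrite exp_ln by assumption; lra. Qed.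

(** From [ln w <= w - 1] at [w = t / (2 r)]. Only half of the exponential is spent on the power,
    which leaves [exp (- (t / 2))] for convergence. *)
Lemma Rpower_le_exp_half (r t : R) :
  (0 < r)%R -> (1 <= t)%R -> (Rpower t r <= exp (r * ln (2 * r)) * exp (t / 2))%R.
Proof.
intros Hr Ht; unfold Rpower; rewrite <- exp_plus.
assert (K := ln_le_sub_1 (t / (2 * r)) ltac:(apply Rdiv_lt_0_compat; lra)).
rewrite ln_div in K by lra.
assert (K2 : (r * (ln t - ln (2 * r)) <= r * (t / (2 * r) - 1))%R)
  by (apply Rmult_le_compat_l; lra).
replace (r * (t / (2 * r) - 1))%R with (t / 2 - r)%R in K2 by (field; lra).
destruct (Req_dec (r * ln t) (r * ln (2 * r) + t / 2)) as [E|E]; [rewrite E; lra|].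
left; apply exp_increasing; lra.
Qed.

Lemma gamma_kernel_decay (r t : R) :
  (0 < r)%R -> (1 <= t)%R ->
  (Rpower t r * exp (- t) <= exp (r * ln (2 * r)) * exp (- (t / 2)))%R.
Proof.
intros Hr Ht.
replace (exp (r * ln (2 * r)) * exp (- (t / 2)))%R
  with (exp (r * ln (2 * r)) * exp (t / 2) * exp (- t))%R.
- apply Rmult_le_compat_r; [left; apply exp_pos|now apply Rpower_le_exp_half].
- rewrite Rmult_assoc, <- exp_plus; do 2 f_equal; lra.
Qed.

Lemma filterlim_exp_half : filterlim (fun t => exp (- (t / 2))) p_oo (locally 0%R).
Proof.
apply (filterlim_comp _ _ _ (fun t => - (t / 2))%R exp p_oo (Rbar_locally m_infty)).
- intros P [m Hm]; exists (- (2 * m))%R; intros t Ht; apply Hm; lra.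
- exact (is_lim_exp_m).
Qed.

Lemma is_RInt_0_oo_Gamma_integral (a : C) :
  (0 < Re a)%R -> is_RInt_0_oo (gamma_kernel a) (Gamma_integral a).
Proof.
intros Ha.
destruct (ex_primitive_on (fun t => (0 < t)%R) (gamma_kernel a) 1) as [P [HP _]];
  [exact positive_interval_like|lra|apply continuous_gamma_kernel|].
assert (L0 : exists la, filterlim P (at_right 0) (locally (T := C_UniformSpace) la)).
{ apply (filterlim_Cmajorized unit_interval P (fun t => Rpower t (Re a) / Re a)%R 0).
  - exact unit_interval_at_right.
  - intros u v Hu Hv Huv.
    apply (Cmod_CRInt_le_primitive (gamma_kernel a) (fun t => Rpower t (Re a - 1))
             (fun t => Rpower t (Re a) / Re a)%R); auto.
    + intros t Ht; rewrite Cmod_gamma_kernel.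
      rewrite <- (Rmult_1_r (Rpower t (Re a - 1))) at 2.
      apply Rmult_le_compat_l; [left; apply Rpower_pos|].
      unfold unit_interval in *; rewrite <- exp_0.
      destruct (Req_dec t 0) as [E|E]; [lra|]; left; apply exp_increasing; lra.
    + intros t Ht; apply (is_derive_ext (fun t => / Re a * Rpower t (Re a))%R).
      * intros w; apply Rmult_comm.
      * evar_last; [apply is_derive_scal, is_derive_Rpower; unfold unit_interval in *; lra|].
        field; lra.
    + intros t Ht; apply (continuous_Rpower (Re a - 1) (fun w => w));
        [unfold unit_interval in *; lra|apply continuous_id].
    + apply HP; [apply Hu|apply Hv].
  - replace 0%R with (0 * / Re a)%R at 2 by ring.
    apply (filterlim_comp _ _ _ (fun t => Rpower t (Re a)) (fun u => u * / Re a)%R _ (locally 0%R)).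
    + now apply filterlim_Rpower_0.
    + apply (continuous_mult (fun u => u) (fun _ => / Re a)%R 0%R);
        [apply continuous_id|apply continuous_const]. }
assert (L1 : exists lb, filterlim P p_oo (locally (T := C_UniformSpace) lb)).
{ set (K := exp (Re a * ln (2 * Re a))).
  apply (filterlim_Cmajorized (fun t => (1 <= t)%R) P (fun t => - (2 * K) * exp (- (t / 2)))%R 0).
  - exists 1%R; intros t Ht; lra.
  - intros u v Hu Hv Huv.
    apply (Cmod_CRInt_le_primitive (gamma_kernel a) (fun t => K * exp (- (t / 2)))%R
             (fun t => - (2 * K) * exp (- (t / 2)))%R); auto.
    + intros t Ht; rewrite Cmod_gamma_kernel.
      (* The exponent [Re a - 1] may be negative; since [1 <= t] it is raised to [Re a], to which
         the decay estimate applies. *)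
      eapply Rle_trans; [|apply gamma_kernel_decay; lra].
      apply Rmult_le_compat_r; [left; apply exp_pos|apply Rle_Rpower; lra].
    + intros t Ht; auto_derive; [auto|]; unfold Rdiv; field.
    + intros t Ht; apply (ex_derive_continuous (V := R_NormedModule)); auto_derive; auto.
    + apply HP; lra.
  - replace 0%R with (- (2 * K) * 0)%R by ring.
    apply (filterlim_comp _ _ _ (fun t => exp (- (t / 2))) (fun u => - (2 * K) * u)%R _ (locally 0%R)).
    + apply filterlim_exp_half.
    + apply (continuous_mult (fun _ => - (2 * K))%R (fun u => u) 0%R);
        [apply continuous_const|apply continuous_id]. }
destruct L0 as [la L0], L1 as [lb L1].
assert (K := is_RInt_gen_primitive _ _ P la lb HP positive_at_right positive_p_oo L0 L1).
change (Gamma_integral a) with (RInt_gen (V := C_R_CompleteNormedModule)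
  (gamma_kernel a) (at_right 0) p_oo).
apply (RInt_gen_correct (V := C_R_CompleteNormedModule) (gamma_kernel a)); now exists (lb - la).
Qed.

Lemma is_RInt_0_oo_unique (f : R -> C) (l l' : C) :
  is_RInt_0_oo f l -> is_RInt_0_oo f l' -> l = l'.
Proof.
intros H H'; rewrite <- (is_RInt_gen_unique (V := C_R_CompleteNormedModule) f l H).
exact (is_RInt_gen_unique (V := C_R_CompleteNormedModule) f l' H').
Qed.

(** Integrates the derivative of [- t^a e^(-t)], which vanishes at both ends. *)
Lemma Gamma_integral_succ (a : C) :
  (0 < Re a)%R -> Gamma_integral (a + 1) = a * Gamma_integral a.
Proof.
intros Ha.
assert (Ha1 : (0 < Re (a + 1))%R) by (unfold Re in *; simpl; lra).
set (Q := fun t => - gamma_kernel (a + 1) t).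
assert (P : is_primitive_on (fun t => (0 < t)%R)
     (fun t => gamma_kernel (a + 1) t - a * gamma_kernel a t) Q).
{ apply is_primitive_on_intro; [exact positive_interval_like| |].
  - intros t Ht; evar_last.
    + apply (is_derive_opp (V := C_R_NormedModule)), is_Cderive_mult.
      * apply is_Cderive_Rcpow; exact Ht.
      * apply is_Cderive_RtoC; auto_derive; [auto|reflexivity].
    + change (opp (G := C_R_NormedModule) ?x) with (- x); C_eq; unfold gamma_kernel.
      replace (a + 1 - 1) with a by ring.
      replace (RtoC (- (1) * exp (- t))%R) with (- RtoC (exp (- t)))
        by (rewrite <- RtoC_opp; f_equal; ring).
      ring.
  - intros t Ht; apply (continuous_minus (V := C_R_NormedModule)
      (gamma_kernel (a + 1)) (fun u => a * gamma_kernel a u)).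
    + now apply continuous_gamma_kernel.
    + apply continuous_Cmult; [apply continuous_Cconst|now apply continuous_gamma_kernel]. }
assert (N : forall t, Cmod (Q t) = (Rpower t (Re a) * exp (- t))%R).
{ intros t; unfold Q; rewrite Cmod_opp, Cmod_gamma_kernel; do 2 f_equal; unfold Re; simpl; ring. }
assert (L0 : filterlim Q (at_right 0) (locally (T := C_UniformSpace) (RtoC 0))).
{ apply (filterlim_C0_le _ (fun t => Rpower t (Re a))); [|now apply filterlim_Rpower_0].
  generalize positive_at_right; apply filter_imp; intros t Ht; rewrite N.
  rewrite <- (Rmult_1_r (Rpower t (Re a))) at 2.
  apply Rmult_le_compat_l; [left; apply Rpower_pos|].
  rewrite <- exp_0; left; apply exp_increasing; lra. }
assert (L1 : filterlim Q p_oo (locally (T := C_UniformSpace) (RtoC 0))).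
{ apply (filterlim_C0_le _ (fun t => exp (Re a * ln (2 * Re a)) * exp (- (t / 2)))%R).
  - exists 1%R; intros t Ht; rewrite N; apply gamma_kernel_decay; lra.
  - replace 0%R with (exp (Re a * ln (2 * Re a)) * 0)%R by ring.
    apply (filterlim_comp _ _ _ (fun t => exp (- (t / 2)))
      (fun u => exp (Re a * ln (2 * Re a)) * u)%R _ (locally 0%R)).
    + apply filterlim_exp_half.
    + apply (continuous_mult (fun _ => exp (Re a * ln (2 * Re a)))%R (fun u => u) 0%R);
        [apply continuous_const|apply continuous_id]. }
assert (K := is_RInt_gen_primitive _ _ Q _ _ P positive_at_right positive_p_oo L0 L1).
assert (K' := is_RInt_gen_minus (V := C_R_NormedModule) _ _ _ _
   (is_RInt_0_oo_Gamma_integral (a + 1) Ha1)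
   (is_RInt_gen_Cmult a _ _ (is_RInt_0_oo_Gamma_integral a Ha))).
assert (E : Gamma_integral (a + 1) - a * Gamma_integral a = RtoC 0 - RtoC 0)
  by exact (is_RInt_0_oo_unique _ _ _ K' K).
transitivity (Gamma_integral (a + 1) - a * Gamma_integral a + a * Gamma_integral a); [ring|].
rewrite E; ring.
Qed.

(** A lower bound for proper integrals passes to the limit. The end points are restricted so that
    [[1, 2]] lies inside, which provides a strictly positive contribution in
    [Gamma_integral_pos]. *)
Lemma is_RInt_0_oo_Re_ge (f : R -> C) (l : C) (m : R) :
  is_RInt_0_oo f l ->
  (forall a b z, (0 < a < 1)%R -> (2 < b)%R -> is_CRInt f a b z -> (m <= Re z)%R) ->
  (m <= Re l)%R.
Proof.
intros Hl Hm; apply le_epsilon; intros e He.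
assert (K := proj1 (filterlimi_Cmod _ _) Hl (mkposreal e He)).
assert (K2 : filter_prod (at_right 0) p_oo (fun ab => (0 < fst ab < 1)%R /\ (2 < snd ab)%R)).
{ exists unit_interval (fun b => (2 < b)%R); auto using unit_interval_at_right.
  exists 2%R; auto. }
destruct (filter_ex _ (filter_and _ _ K K2)) as [[a b] [[z [H1 H2]] [H3 H4]]]; simpl in *.
assert (H5 := Hm a b z H3 H4 H1).
assert (H6 := re_le_Cmod (z - l)).
assert (H7 : Re (z - l) = (Re z - Re l)%R) by reflexivity.
rewrite H7 in H6; generalize (Rle_abs (Re z - Re l)); lra.
Qed.

Lemma gamma_kernel_RtoC (x t : R) :
  (0 < t)%R -> gamma_kernel (RtoC x) t = RtoC (Rpower t (x - 1) * exp (- t))%R.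
Proof.
intros Ht; unfold gamma_kernel; rewrite <- RtoC_minus, Rcpow_RtoC by assumption.
now rewrite RtoC_mult.
Qed.

Lemma Gamma_integral_pos (x : R) : (0 < x)%R -> (0 < Re (Gamma_integral (RtoC x)))%R.
Proof.
intros Hx; set (f := fun t => (Rpower t (x - 1) * exp (- t))%R).
assert (Hf : forall t, (0 < f t)%R).
{ intros t; apply Rmult_lt_0_compat; [apply Rpower_pos|apply exp_pos]. }
assert (Hc : forall t, (0 < t)%R -> continuous f t).
{ intros t Ht; apply (continuous_mult (fun t => Rpower t (x - 1)) (fun t => exp (- t))).
  - apply (continuous_Rpower (x - 1) (fun u => u)); auto; apply continuous_id.
  - apply (ex_derive_continuous (V := R_NormedModule)); auto_derive; auto. }
apply Rlt_le_trans with (RInt f 1 2).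
- apply RInt_gt_0; [lra|auto|intros t Ht; apply Hc; lra].
- apply (is_RInt_0_oo_Re_ge (gamma_kernel (RtoC x))); [now apply is_RInt_0_oo_Gamma_integral|].
  intros a b z Ha Hb Hz; apply is_CRInt_iff in Hz; destruct Hz as [Hz _].
  assert (X : forall u v, (0 < u)%R -> (u <= v)%R -> is_RInt f u v (RInt f u v)).
  { intros u v Hu Huv; apply (RInt_correct (V := R_CompleteNormedModule)),
      (ex_RInt_continuous (V := R_CompleteNormedModule)).
    rewrite Rmin_left, Rmax_right by assumption; intros t Ht; apply Hc; lra. }
  assert (E : Re z = RInt f a b).
  { symmetry; apply is_RInt_unique.
    apply (is_RInt_ext (fun t => Re (gamma_kernel (RtoC x) t))); [|exact Hz].
    rewrite Rmin_left, Rmax_right by lra; intros t Ht; rewrite gamma_kernel_RtoC by lra; reflexivity. }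
  assert (P : forall u v, (0 < u)%R -> (u <= v)%R -> (0 <= RInt f u v)%R).
  { intros u v Hu Huv; apply RInt_ge_0; auto.
    - eexists; apply X; auto.
    - intros t Ht; left; apply Hf. }
  rewrite E, (is_RInt_unique _ _ _ _ (is_RInt_Chasles _ _ _ _ _ _ (X a 1%R ltac:(lra) ltac:(lra))
    (is_RInt_Chasles _ _ _ _ _ _ (X 1%R 2%R ltac:(lra) ltac:(lra)) (X 2%R b ltac:(lra) ltac:(lra))))).
  unfold plus; simpl.
  generalize (P a 1%R ltac:(lra) ltac:(lra)) (P 2%R b ltac:(lra) ltac:(lra)); lra.
Qed.

(** * Absence of zeros of gamma in the right half-plane *)

Lemma cos_ge_quadratic (w : R) : (1 - w ^ 2 / 2 <= cos w)%R.
Proof.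
assert (S : forall v, (0 <= v)%R -> (sin v * sin v <= v * v)%R).
{ intros v Hv; destruct (Rle_dec 1 v) as [H|H].
  - generalize (SIN_bound v); nra.
  - destruct Hv as [Hv|Hv]; [|rewrite <- Hv, sin_0; lra].
    assert (K := sin_lt_x v Hv); assert (K2 : (0 < sin v)%R).
    { apply sin_gt_0; [exact Hv|generalize PI2_1; lra]. }
    nra. }
replace (cos w) with (1 - 2 * sin (w / 2) * sin (w / 2))%R
  by (rewrite <- cos_2a_sin; f_equal; field).
assert (K : (sin (w / 2) * sin (w / 2) <= w / 2 * (w / 2))%R).
{ destruct (Rle_dec 0 w) as [H|H]; [apply S; lra|].
  generalize (S (- (w / 2))%R ltac:(lra)); rewrite sin_neg; lra. }
lra.
Qed.

(** With [w = ln u / 2] the right-hand side is [(e^w - e^(-w))^2], so the claim is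
    [2 |w| <= |e^w - e^(-w)|], the elementary lower bound of the hyperbolic sine. *)
Lemma ln_sqr_le (u : R) : (0 < u)%R -> ((ln u) ^ 2 <= u - 2 + / u)%R.
Proof.
intros Hu.
assert (S : forall w, (0 <= w)%R -> (2 * w <= exp w - exp (- w))%R).
{ intros w Hw.
  destruct (MVT_gen (fun w => exp w - exp (- w) - 2 * w)%R 0 w
              (fun w => exp w + exp (- w) - 2)%R) as [t [_ Et]].
  - intros t _; auto_derive; [auto|ring].
  - intros t _; apply continuity_pt_filterlim.
    apply (ex_derive_continuous (V := R_NormedModule) (fun w => exp w - exp (- w) - 2 * w)%R t).
    auto_derive; auto.
  - assert (He := exp_pos t).
    assert (K : (0 <= exp t + exp (- t) - 2)%R).
    { rewrite exp_Ropp; apply Rmult_le_reg_r with (exp t); [exact He|].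
      replace ((exp t + / exp t - 2) * exp t)%R with ((exp t - 1) ^ 2)%R by (field; lra).
      rewrite Rmult_0_l; apply pow2_ge_0. }
    rewrite Ropp_0, exp_0 in Et; nra. }
set (w := (ln u / 2)%R).
assert (E : u = (exp w * exp w)%R).
{ unfold w; rewrite <- exp_plus; replace (ln u / 2 + ln u / 2)%R with (ln u) by field.
  now rewrite exp_ln. }
assert (He := exp_pos w).
replace (u - 2 + / u)%R with ((exp w - exp (- w)) ^ 2)%R.
2:{ rewrite E, exp_Ropp; field; lra. }
replace (ln u ^ 2)%R with ((2 * w) ^ 2)%R by (unfold w; field).
destruct (Rle_dec 0 w) as [H|H].
- generalize (S w H); nra.
- generalize (S (- w)%R ltac:(lra)); rewrite Ropp_involutive; nra.
Qed.

(* Rotating the integrand by [x^(-iy)] makes its phase stationary near the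
   maximum [t = x] of [t^x e^(-t)], and [cos (y ln u) >= 1 - y^2 (u - 2 + 1/u) / 2]
   with [u = t / x] integrates to [Gamma x (1 - y^2 / (2 (x - 1)))]. *)
Lemma Gamma_integral_neq_0_far (x y : R) :
  (1 < x)%R -> (y ^ 2 < 2 * (x - 1))%R -> Gamma_integral (x, y) <> RtoC 0.
Proof.
intros Hx Hy H0.
set (a := (x, y) : C); fold a in H0.
assert (G0 := is_RInt_0_oo_Gamma_integral a ltac:(unfold a, Re; simpl; lra)).
assert (G1 := is_RInt_0_oo_Gamma_integral (RtoC x) ltac:(simpl; lra)).
assert (G2 := is_RInt_0_oo_Gamma_integral (RtoC (x + 1)) ltac:(simpl; lra)).
assert (G3 := is_RInt_0_oo_Gamma_integral (RtoC (x - 1)) ltac:(simpl; lra)).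
set (c := Rcpow (/ x) (0, y)%R).
(* Up to sign, the coefficients of [1 - y^2 (u - 2 + 1/u) / 2] expanded with [u = t / x]; they
   multiply the real gamma kernels at [x], [x + 1] and [x - 1]. *)
set (k1 := RtoC (1 + y ^ 2)%R); set (k2 := RtoC (y ^ 2 / (2 * x))%R);
set (k3 := RtoC (y ^ 2 * x / 2)%R).
assert (K := is_RInt_gen_plus (V := C_R_NormedModule) _ _ _ _
  (is_RInt_gen_minus (V := C_R_NormedModule) _ _ _ _
     (is_RInt_gen_Cmult c _ _ G0) (is_RInt_gen_Cmult k1 _ _ G1))
  (is_RInt_gen_plus (V := C_R_NormedModule) _ _ _ _
     (is_RInt_gen_Cmult k2 _ _ G2) (is_RInt_gen_Cmult k3 _ _ G3))).
assert (P : (0 <= Re ((c * Gamma_integral a - k1 * Gamma_integral (RtoC x))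
      + (k2 * Gamma_integral (RtoC (x + 1)) + k3 * Gamma_integral (RtoC (x - 1)))))%R).
{ refine (is_RInt_0_oo_Re_ge _ _ 0 K _).
  intros u v z Hu Hv Hz; apply is_CRInt_iff in Hz; destruct Hz as [Hz _].
  apply (is_RInt_ge_0 _ u v (Re z)) with (2 := Hz); [lra|].
  intros t Ht; assert (Ht0 : (0 < t)%R) by lra; clear Hz K.
  set (w := Rpower t (x - 1)).
  assert (Hw : (0 < w)%R) by apply Rpower_pos.
  assert (He := exp_pos (- t)).
  change (0 <= Re ((c * gamma_kernel a t - k1 * gamma_kernel (RtoC x) t)
      + (k2 * gamma_kernel (RtoC (x + 1)) t + k3 * gamma_kernel (RtoC (x - 1)) t)))%R.
  rewrite !gamma_kernel_RtoC by assumption.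
  replace (x + 1 - 1)%R with (x - 1 + 1)%R by ring.
  replace (x - 1 - 1)%R with (x - 1 + - (1))%R by ring.
  rewrite !Rpower_plus, Rpower_Ropp, Rpower_1 by assumption; fold w.
  assert (E : c * gamma_kernel a t = RtoC (w * exp (- t))%R * Rcpow (t * / x) (0, y)%R).
  { unfold gamma_kernel; rewrite Rcpow_mult_distr by (auto; apply Rinv_0_lt_compat; lra).
    replace (a - 1) with (RtoC (x - 1)%R + (0, y)%R)
      by (unfold a; apply injective_projections; simpl; ring).
    rewrite Rcpow_plus, Rcpow_RtoC, RtoC_mult by assumption; unfold c, w; ring. }
  rewrite E, Rcpow_components.
  set (q := (t * / x)%R).
  assert (Hq : (0 < q)%R) by (apply Rmult_lt_0_compat; [lra|apply Rinv_0_lt_compat; lra]).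
  unfold k1, k2, k3, Re, Im; simpl.
  rewrite Rmult_0_l, exp_0.
  assert (C1 := cos_ge_quadratic (y * ln q)); assert (C2 := ln_sqr_le q Hq).
  assert (C3 : (1 - y ^ 2 / 2 * (q - 2 + / q) <= cos (y * ln q))%R).
  { eapply Rle_trans; [|exact C1].
    assert (y ^ 2 * (ln q) ^ 2 <= y ^ 2 * (q - 2 + / q))%R
      by (apply Rmult_le_compat_l; [apply pow2_ge_0|exact C2]).
    replace ((y * ln q) ^ 2)%R with (y ^ 2 * ln q ^ 2)%R by ring; lra. }
  assert (C4 : (0 <= w * exp (- t) * (cos (y * ln q) - (1 - y ^ 2 / 2 * (q - 2 + / q))))%R).
  { apply Rmult_le_pos; [apply Rmult_le_pos; lra|lra]. }
  evar_last; [exact C4|].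
  unfold q; field; lra. }
assert (Hg := Gamma_integral_pos (x - 1) ltac:(lra)).
assert (E1 : Gamma_integral (RtoC x) = RtoC (x - 1)%R * Gamma_integral (RtoC (x - 1))).
{ rewrite <- Gamma_integral_succ by (simpl; lra); f_equal.
  apply injective_projections; simpl; ring. }
assert (E2 : Gamma_integral (RtoC (x + 1)) = RtoC x * Gamma_integral (RtoC x)).
{ rewrite <- Gamma_integral_succ by (simpl; lra); f_equal.
  apply injective_projections; simpl; ring. }
(* If the value at [a] is 0, the functional equation turns the nonnegative quantity of [P] into
   [y^2 / 2 - (x - 1)] times the positive gamma value at [x - 1], which is negative. *)
rewrite H0, E2, E1 in P.
set (g0 := Gamma_integral (RtoC (x - 1))) in *.
replace (c * RtoC 0 - k1 * (RtoC (x - 1)%R * g0) + (k2 * (RtoC x * (RtoC (x - 1)%R * g0)) + k3 * g0))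
  with (RtoC (- (1 + y ^ 2) * (x - 1) + y ^ 2 / (2 * x) * x * (x - 1) + y ^ 2 * x / 2)%R * g0) in P.
2:{ unfold k1, k2, k3; rewrite !RtoC_plus, !RtoC_mult, RtoC_opp; rewrite !RtoC_plus; ring. }
replace (- (1 + y ^ 2) * (x - 1) + y ^ 2 / (2 * x) * x * (x - 1) + y ^ 2 * x / 2)%R
  with (y ^ 2 / 2 - (x - 1))%R in P by (field; lra).
unfold Re in *; simpl in P, Hg; nra.
Qed.

(** * Rising factorials, Pochhammer symbols and the confluent series *)

Fixpoint rising (a : C) (n : nat) : C :=
  match n with
  | O => RtoC 1
  | S m => rising a m * (a + RtoC (INR m))
  end.

Lemma Re_plus_INR (a : C) (n : nat) : Re (a + RtoC (INR n)) = (Re a + INR n)%R.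
Proof. reflexivity. Qed.

Lemma rising_neq_0 (a : C) (n : nat) : (0 < Re a)%R -> rising a n <> RtoC 0.
Proof.
intros Ha; induction n as [|n IH]; simpl.
- intros K; apply RtoC_inj in K; lra.
- apply Cmult_neq_0; [exact IH|].
  intros K; apply (f_equal Re) in K; rewrite Re_plus_INR in K; simpl in K.
  generalize (pos_INR n); lra.
Qed.

Lemma Gamma_integral_rising (a : C) (n : nat) :
  (0 < Re a)%R -> Gamma_integral (a + RtoC (INR n)) = rising a n * Gamma_integral a.
Proof.
intros Ha; induction n as [|n IH].
- simpl; rewrite Cplus_0_r; ring.
- rewrite S_INR, RtoC_plus, Cplus_assoc, Gamma_integral_succ.
  + rewrite IH; simpl; ring.
  + rewrite Re_plus_INR; generalize (pos_INR n); lra.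
Qed.

(** A zero at [a] would propagate to every [a + n] by the functional equation. The imaginary part is
    unchanged while the real part grows, so some [a + n] enters the region already free of zeros. *)
Lemma Gamma_integral_neq_0 (a : C) : (0 < Re a)%R -> Gamma_integral a <> RtoC 0.
Proof.
intros Ha H0.
destruct (nfloor_ex (1 + Im a ^ 2)) as [n [_ Hn]]; [generalize (pow2_ge_0 (Im a)); lra|].
assert (K := Gamma_integral_rising a (S n) Ha); rewrite H0, Cmult_0_r in K.
rewrite <- S_INR in Hn; revert K.
replace (a + RtoC (INR (S n))) with ((Re a + INR (S n), Im a)%R : C)
  by (apply injective_projections; unfold Re, Im; cbn -[INR]; ring).
apply Gamma_integral_neq_0_far; generalize (pow2_ge_0 (Im a)); lra.
Qed.

Lemma Gamma_eq_Gamma_integral (a : C) : (0 < Re a)%R -> Gamma a = Gamma_integral a.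
Proof.
intros Ha.
assert (E : Gamma_shift a = O).
{ unfold Gamma_shift; destruct (archimed (- Re a)) as [_ H].
  (* [up] exceeds its argument by at most 1, so here it is at most 0 and [Z.to_nat] returns 0. *)
  assert (K : (IZR (up (- Re a)) < 1)%R) by lra.
  apply lt_IZR in K; lia. }
unfold Gamma; rewrite E; simpl.
rewrite Cplus_0_r; unfold Cdiv.
replace (/ RtoC 1) with (RtoC 1) by (field; intros K; apply RtoC_inj in K; lra); ring.
Qed.

(** The gamma quotient cancels because [Gamma a] is not 0; as [/ 0 = 0], a zero would make the
    quotient 0 whereas the product is not. *)
Lemma Pochhammer_rising (a : C) (n : nat) : (0 < Re a)%R -> Pochhammer a n = rising a n.
Proof.
intros Ha; destruct n as [|n]; [reflexivity|]; unfold Pochhammer.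
rewrite !Gamma_eq_Gamma_integral; [|exact Ha|].
- rewrite Gamma_integral_rising by exact Ha; field; now apply Gamma_integral_neq_0.
- rewrite Re_plus_INR; generalize (pos_INR (S n)); lra.
Qed.

Lemma Beta_rising (X Y : C) (n : nat) :
  (0 < Re X)%R -> (0 < Re Y)%R ->
  Beta (X + RtoC (INR n)) Y = rising X n / rising (X + Y) n * Beta X Y.
Proof.
intros HX HY.
assert (HXY : (0 < Re (X + Y))%R) by (unfold Re in *; simpl; lra).
assert (N1 : forall n, rising (X + Y) n <> RtoC 0) by (intros; now apply rising_neq_0).
induction n as [|n IH].
- simpl; rewrite Cplus_0_r; field; apply (N1 O).
- assert (Hn : (0 < Re (X + RtoC (INR n)))%R)
    by (rewrite Re_plus_INR; generalize (pos_INR n); lra).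
  assert (K := Beta_succ (X + RtoC (INR n)) Y Hn HY).
  assert (N2 : X + Y + RtoC (INR n) <> RtoC 0).
  { intros E; apply (f_equal Re) in E; rewrite Re_plus_INR in E; simpl in E.
    generalize (pos_INR n); unfold Re in *; simpl in *; lra. }
  rewrite S_INR, RtoC_plus, Cplus_assoc.
  replace (Beta (X + RtoC (INR n) + RtoC 1) Y)
    with ((X + RtoC (INR n)) * Beta (X + RtoC (INR n)) Y / (X + Y + RtoC (INR n))).
  + rewrite IH; simpl; field; split; [exact N2|apply N1].
  + rewrite <- K; replace (X + RtoC (INR n) + Y) with (X + Y + RtoC (INR n)) by ring.
    field; exact N2.
Qed.

(** Each factor [(X + n) / (X + Y + n)] differs from 1 by at most [|Y| / |X + Y + n|], and the
    denominator is at least [Re (X + Y)]. A geometric bound is enough against the factorial of the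
    confluent series. *)
Lemma rising_ratio_le (X Y : C) (n : nat) :
  (0 < Re X)%R -> (0 < Re Y)%R ->
  (Cmod (rising X n / rising (X + Y) n) <= (1 + Cmod Y / Re (X + Y)) ^ n)%R.
Proof.
intros HX HY.
assert (HXY : (0 < Re (X + Y))%R) by (unfold Re in *; simpl; lra).
induction n as [|n IH].
- simpl; rewrite Cmod_div by (intros K; apply RtoC_inj in K; lra); rewrite Cmod_1; lra.
- assert (N2 : X + Y + RtoC (INR n) <> RtoC 0).
  { intros E; apply (f_equal Re) in E; rewrite Re_plus_INR in E.
    generalize (pos_INR n); unfold Re in *; simpl in *; lra. }
  assert (N3 := rising_neq_0 (X + Y) n HXY).
  replace (rising X (S n) / rising (X + Y) (S n))
    with ((X + RtoC (INR n)) / (X + Y + RtoC (INR n)) * (rising X n / rising (X + Y) n))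
    by (simpl; field; auto).
  rewrite Cmod_mult, <- tech_pow_Rmult; apply Rmult_le_compat; auto using Cmod_ge_0.
  rewrite Cmod_div by exact N2.
  assert (D : (Re (X + Y) <= Cmod (X + Y + RtoC (INR n)))%R).
  { eapply Rle_trans; [|apply re_le_Cmod]; eapply Rle_trans; [|apply Rle_abs].
    rewrite Re_plus_INR; generalize (pos_INR n); lra. }
  assert (T : (Cmod (X + RtoC (INR n)) <= Cmod (X + Y + RtoC (INR n)) + Cmod Y)%R).
  { replace (X + RtoC (INR n)) with ((X + Y + RtoC (INR n)) + - Y) by ring.
    eapply Rle_trans; [apply Cmod_triangle|]; rewrite Cmod_opp; lra. }
  set (d := Cmod (X + Y + RtoC (INR n))) in *.
  apply Rmult_le_reg_r with d; [lra|].
  replace (Cmod (X + RtoC (INR n)) / d * d)%R with (Cmod (X + RtoC (INR n))) by (field; lra).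
  assert (Q : (Cmod Y <= Cmod Y / Re (X + Y) * d)%R).
  { replace (Cmod Y) with (Cmod Y / Re (X + Y) * Re (X + Y))%R at 1 by (field; lra).
    apply Rmult_le_compat_l; [|exact D].
    apply Rmult_le_pos; [apply Cmod_ge_0|left; now apply Rinv_0_lt_compat]. }
  lra.
Qed.

Lemma is_Cseries_Phi (X Y z : C) :
  (0 < Re X)%R -> (0 < Re Y)%R ->
  is_Cseries (fun n => exp_term z n * Beta (X + RtoC (INR n)) Y) (Beta X Y * Phi X (X + Y) z).
Proof.
intros HX HY.
assert (HXY : (0 < Re (X + Y))%R) by (unfold Re in *; simpl; lra).
set (term := fun n => Pochhammer X n / Pochhammer (X + Y) n * exp_term z n).
assert (E : forall n, term n = rising X n / rising (X + Y) n * exp_term z n).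
{ intros n; unfold term; rewrite !Pochhammer_rising; auto. }
set (r := (1 + Cmod Y / Re (X + Y))%R).
assert (K : ex_CSeries term).
{ apply (ex_series_le (V := C_CompleteNormedModule) term
           (fun n => (r * Cmod z) ^ n * / INR (fact n))%R).
  - intros n; change (Cmod (term n) <= (r * Cmod z) ^ n * / INR (fact n))%R.
    rewrite E, Cmod_mult, Cmod_exp_term, Rpow_mult_distr; unfold Rdiv.
    rewrite Rmult_assoc; apply Rmult_le_compat_r.
    + apply Rmult_le_pos; [apply pow_le, Cmod_ge_0|left; apply Rinv_0_lt_compat, INR_fact_lt_0].
    + now apply rising_ratio_le.
  - exists (exp (r * Cmod z)); generalize (is_exp_Reals (r * Cmod z)); unfold is_pseries.
    apply is_series_ext; intros n; rewrite pow_n_pow; reflexivity. }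
assert (S := is_Cseries_Cmult (Beta X Y) term _ (CSeries_correct term K)).
revert S; apply is_series_ext; intros n; C_eq.
rewrite E, Beta_rising by assumption; ring.
Qed.

(** * The M-series as a power series, and the Mellin transform *)

Definition Mseries_coef (kappa mu : list C) (alpha beta : C) (m : nat) : C :=
  Cprod (map (fun k => Pochhammer k m) kappa) / Cprod (map (fun k => Pochhammer k m) mu)
  / Gamma (alpha * RtoC (INR m) + beta).

Lemma Mseries_term_coef (kappa mu : list C) (alpha beta z : C) (m : nat) :
  Mseries_term kappa mu alpha beta z m = Mseries_coef kappa mu alpha beta m * z ^ m.
Proof. unfold Mseries_term, Mseries_coef, Cdiv; ring. Qed.

Lemma Mseries_converges_coef (kappa mu : list C) (alpha beta z : C) :
  Mseries_converges kappa mu alpha beta z ->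
  ex_CSeries (fun m => Mseries_coef kappa mu alpha beta m * z ^ m).
Proof. apply ex_series_ext; intros m; apply Mseries_term_coef. Qed.

Lemma Mseries_Cpseries (kappa mu : list C) (alpha beta : C) (u : R) :
  Mseries_converges kappa mu alpha beta (RtoC u) ->
  Mseries kappa mu alpha beta (RtoC u) = Cpseries (Mseries_coef kappa mu alpha beta) u.
Proof.
intros H; assert (H' := Mseries_converges_coef _ _ _ _ _ H).
rewrite <- CSeries_Cpseries by exact H'.
apply CSeries_unique; generalize (CSeries_correct _ H'); apply is_series_ext.
intros m; symmetry; apply Mseries_term_coef.
Qed.

Lemma MGamma_arg_0 (t : R) : MGamma_arg (RtoC 0) t = RtoC (- t).
Proof. unfold MGamma_arg, Cdiv; rewrite RtoC_opp; ring. Qed.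

Lemma MBeta_arg_tau (rho t : R) : (0 < t < 1)%R -> MBeta_arg (RtoC rho) t = RtoC (- (rho / tau t)).
Proof.
intros Ht; assert (T := tau_pos t Ht); unfold MBeta_arg; fold (tau t).
rewrite RtoC_opp, RtoC_div by lra; unfold Cdiv; ring.
Qed.

Theorem theorem4p2 :
  forall (p q : nat) (kappa mu : list C) (alpha beta l2 l3 s z : C),
  length kappa = p ->
  length mu = q ->
  (forall k : C, In k kappa -> ~ nonpos_integer k) ->
  (forall k : C, In k mu -> ~ nonpos_integer k) ->
  (0 < Re alpha)%R ->
  (Re l2 < Re l3)%R ->
  (0 < Re l2)%R ->
  (0 < Re s)%R ->
  MGamma_converges kappa mu alpha beta s (RtoC 0) ->
  (forall rho : R, (0 < rho)%R ->
     MPhi_converges kappa mu alpha beta l2 l3 z (RtoC rho)) ->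
  is_RInt_0_oo
    (fun rho : R =>
       Rcpow rho (s - 1) * MPhi kappa mu alpha beta l2 l3 z (RtoC rho))
    (MGamma kappa mu alpha beta s (RtoC 0) * Beta (l2 + s) (l3 + s - l2)
     / Beta l2 (l3 - l2)
     * Phi (l2 + s) (l3 + 2 * s) z).
Proof.
intros p q kappa mu alpha beta l2 l3 s z _ _ _ _ _ Hl Hl2 Hs [HMser HMint] HPhi.
set (c := Mseries_coef kappa mu alpha beta).
(* The power series stands for the M-series: the two agree for [u > 0], and the former is continuous
   on the whole line, in particular at [u = 0]. *)
set (F0 := fun u : R => Cpseries c (- u)).
set (iB := / Beta l2 (l3 - l2)).
(* At [rho = 0] the argument of the M-gamma integrand is [- t], which runs through all negative
   reals. *)
assert (Hconv : forall u, (u < 0)%R -> Mseries_converges kappa mu alpha beta (RtoC u)).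
{ intros u Hu; rewrite <- (Ropp_involutive u), <- MGamma_arg_0; apply HMser; lra. }
assert (HF0 : forall u, (0 < u)%R -> Mseries kappa mu alpha beta (RtoC (- u)) = F0 u).
{ intros u Hu; apply Mseries_Cpseries, Hconv; lra. }
assert (HF0c : forall v, Ccontinuous F0 v).
{ intros v; apply (continuous_comp Ropp (Cpseries c)).
  - apply (continuous_opp (V := R_NormedModule) (fun u => u)), continuous_id.
  - apply continuous_Cpseries; intros u Hu; now apply Mseries_converges_coef, Hconv. }
assert (Hy : (0 < Re (l3 - l2))%R) by (unfold Re in *; simpl; lra).
replace (MGamma kappa mu alpha beta s (RtoC 0) * Beta (l2 + s) (l3 + s - l2)
     / Beta l2 (l3 - l2) * Phi (l2 + s) (l3 + 2 * s) z)
  with (iB * MGamma kappa mu alpha beta s (RtoC 0)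
        * (Beta (l2 + s) (l3 - l2 + s) * Phi (l2 + s) (l2 + s + (l3 - l2 + s)) z)).
2:{ replace (l2 + s + (l3 - l2 + s)) with (l3 + 2 * s) by ring.
    replace (l3 - l2 + s) with (l3 + s - l2) by ring.
    unfold iB, Cdiv; ring. }
(* The inverse beta value is carried as a constant factor of [F], so the terms of the abstract
   series are exactly those of [MPhi]. *)
apply (mellin_beta_series (fun u => iB * F0 u) l2 (l3 - l2) s z
         (iB * MGamma kappa mu alpha beta s (RtoC 0))
         (fun n rho => iB * MBeta kappa mu alpha beta (l2 + RtoC (INR n)) (l3 - l2) (RtoC rho))
         (fun rho => MPhi kappa mu alpha beta l2 l3 z (RtoC rho))
         (fun n => Beta (l2 + s + RtoC (INR n)) (l3 - l2 + s))); auto.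
- intros v _; apply continuous_Cmult; [apply continuous_Cconst|apply HF0c].
- assert (K := is_RInt_gen_Cmult iB _ _
     (RInt_gen_correct (V := C_R_CompleteNormedModule) _ HMint)).
  refine (is_RInt_gen_ext (V := C_R_NormedModule) _ _ _ _ K).
  exists (fun a => (0 < a)%R) (fun b => (0 < b)%R);
    [apply positive_at_right|apply positive_p_oo|].
  intros a b Ha Hb t Ht; simpl in Ht.
  assert (Ht0 : (0 < t)%R).
  { apply Rlt_trans with (2 := proj1 Ht); now apply Rmin_pos. }
  C_eq; unfold MGamma_integrand; rewrite MGamma_arg_0, HF0 by exact Ht0; ring.
- intros n rho Hrho; destruct (HPhi rho Hrho) as [HB _]; destruct (HB n) as [_ Hint].
  assert (K := is_RInt_gen_Cmult iB _ _
     (RInt_gen_correct (V := C_R_CompleteNormedModule) _ Hint)).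
  refine (is_RInt_gen_ext (V := C_R_NormedModule) _ _ _ _ K).
  exists unit_interval unit_interval; [apply unit_interval_at_right|apply unit_interval_at_left|].
  intros a b Ha Hb t Ht; simpl in Ht.
  assert (Ht0 : unit_interval t).
  { revert Ht; unfold Rmin, Rmax, unit_interval in *; destruct (Rle_dec a b); lra. }
  C_eq; unfold MBeta_integrand, convolution_kernel, beta_kernel.
  rewrite MBeta_arg_tau, HF0 by (auto; apply Rdiv_lt_0_compat; auto; now apply tau_pos); ring.
- intros rho Hrho; destruct (HPhi rho Hrho) as [_ Hser].
  generalize (CSeries_correct _ Hser); apply is_series_ext; intros n; C_eq.
  unfold MPhi_term, exp_term, iB, Cdiv; ring.
- intros n; replace (l2 + RtoC (INR n) + s) with (l2 + s + RtoC (INR n)) by ring.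
  apply is_RInt_gen_Beta; unfold Re in *; simpl in *; generalize (pos_INR n); lra.
- apply is_Cseries_Phi; unfold Re in *; simpl in *; lra.
Qed.
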